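(* Let the data $\mathcal{H},A,T,\epsilon,\alpha,f,\beta,w,y^*$ be fixed as in the context, and let $\zeta>\max\sigma(A)$ and $R>0$ be fixed. Then there exist constants $\nu_0\in(0,1)$ and $C>0$, with $C$ not depending on $\nu$, such that the following holds for every $0<\nu<\nu_0$. Suppose that the perturbations satisfy: (i) $\delta\alpha\in\mathbb{R}$ with $|\delta\alpha|<\nu$ and $\alpha+\delta\alpha>0$; (ii) $\delta f\in L^2((0,\infty);\mathcal{H})$ with $\lVert\delta f\rVert_{L^2((0,\infty);\mathcal{H})}<\nu$; (iii) $\delta\beta\in L^\infty((0,T);\mathbb{R})$ with $\lVert\delta\beta\rVert_{L^\infty((0,T);\mathbb{R})}<\nu$ and $\beta+\delta\beta\in L^\infty((0,T);[0,\infty))$; (iv) $\delta w\in L^2((0,T);\mathcal{H})$ with $\lVert\delta w\rVert_{L^2((0,T);\mathcal{H})}<\nu$; (v) $\delta y^*\in\mathcal{H}$ with $\lVert\delta y^*\rVert<\nu$; (vi) $\delta A$ is a symmetric linear operator in $\mathcal{H}$ such that $A+\delta A$ is an upper-bounded self-adjoint operator in $\mathcal{H}$, $\zeta>\max\{\max\sigma(A),\max\sigma(A+\delta A)\}$, and for all $s\in\mathbb{R}$ $$\bigl\lVert(\zeta+\mathrm{i}s-A-\delta A)^{-1}-(\zeta+\mathrm{i}s-A)^{-1}\bigr\rVert<\nu\cdot\begin{cases}1,&|s|\le R,\\ s^{-2},&|s|>R.\end{cases}$$ Then $$\lVert u^{\mathrm{opt}}_\delta-u^{\mathrm{opt}}\rVert<C\nu,$$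 where $u^{\mathrm{opt}}$ is the unique solution of the unperturbed problem and $u^{\mathrm{opt}}_\delta$ is the unique solution of the perturbed problem defined in the context.
   Context: $\mathcal{H}$ is a Hilbert space (if it is real, resolvents at non-real points are understood in the complexification), $A$ is a (possibly unbounded) self-adjoint operator in $\mathcal{H}$ that is bounded from above, and $(S_t)_{t\ge0}$ is the $C_0$-semigroup generated by $A$. Fix $T,\epsilon>0$, $y^*\in\mathcal{H}$, $f\in L^2((0,\infty);\mathcal{H})$, $\alpha>0$, $\beta\in L^\infty((0,T);[0,\infty))$ and $w\in L^2((0,T);\mathcal{H})$. Unperturbed problem: minimize $$J(u)=\frac{\alpha}{2}\lVert u\rVert^2+\frac12\int_0^T\beta(t)\Bigl\lVert S_tu+\int_0^tS_\tau f(t-\tau)\,\mathrm{d}\tau-w(t)\Bigr\rVert^2\,\mathrm{d}t$$ over all $u\in\mathcal{H}$ with $\lVert S_Tu+\int_0^TS_\tau f(T-\tau)\,\mathrm{d}\tau-y^*\rVert\le\epsilon$. It has a unique solution $u^{\mathrm{opt}}$. Perturbed problem: given perturbations $\delta\alpha,\delta f,\delta\beta,\delta w,\delta y^*,\delta A$, put $\alpha_\delta=\alpha+\delta\alpha$, $f_\delta=f+\delta f$, $\beta_\delta=\beta+\delta\beta$, $w_\delta=w+\delta w$, $y^*_\delta=y^*+\delta y^*$, and let $(S^\delta_t)_{t\ge0}$ be the semigroup generated by $A+\delta A$. Minimize $$J_\delta(u)=\frac{\alpha_\delta}{2}\lVert u\rVert^2+\frac12\int_0^T\beta_\delta(t)\Bigl\lVert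 S^\delta_tu+\int_0^tS^\delta_\tau f_\delta(t-\tau)\,\mathrm{d}\tau-w_\delta(t)\Bigr\rVert^2\,\mathrm{d}t$$ over all $u\in\mathcal{H}$ with $\lVert S^\delta_Tu+\int_0^TS^\delta_\tau f_\delta(T-\tau)\,\mathrm{d}\tau-y^*_\delta\rVert\le\epsilon$. It has a unique solution $u^{\mathrm{opt}}_\delta$. *)

(* Defs.v *)
From HB Require Import structures.
From mathcomp Require Import all_boot all_order all_algebra.
From mathcomp Require Import sesquilinear complex.
From mathcomp Require Import all_classical all_reals all_analysis.

Set Implicit Arguments.
Unset Strict Implicit.
Unset Printing Implicit Defensive.

Import Order.TTheory GRing.Theory Num.Def Num.Theory.
Import numFieldNormedType.Exports.

Local Open Scope classical_set_scope.
Local Open Scope ring_scope.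
Local Open Scope complex_scope.

(** A Hilbert space may be real or complex: [scalar_field R k] is [R] or [R[i]].
    A Hilbert space over it is a [completeNormedModType (scalar_field R k)] with an
    inner product [ip : {dot H for scalar_conj k}] such that
    [ip x x = `|x| ^+ 2]; [ip] is linear in its first argument and conjugate-linear in the second. *)
Variant scalar_kind := RealScalars | ComplexScalars.

Definition scalar_field (R : realType) (k : scalar_kind) : numFieldType :=
  match k with RealScalars => R | ComplexScalars => R[i] end.

Definition of_real (R : realType) (k : scalar_kind) : R -> scalar_field R k :=
  match k return R -> scalar_field R k with
  | RealScalars => fun r => r
  | ComplexScalars => fun r => r%:C
  end.

Definition re (R : realType) (k : scalar_kind) : scalar_field R k -> R :=
  match k return scalar_field R k -> R with
  | RealScalars => fun z => z
  | ComplexScalars => fun z => complex.Re z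
  end.

Definition scalar_conj (R : realType) (k : scalar_kind) :
    {rmorphism scalar_field R k -> scalar_field R k} :=
  match k return {rmorphism scalar_field R k -> scalar_field R k} with
  | RealScalars => idfun
  | ComplexScalars => Num.conj
  end.

Arguments of_real {R} k r.
Arguments scalar_conj {R} k.

(** The norm of [H] takes its values in [scalar_field R k], so in the complex case
    it is a complex number with zero imaginary part. *)
Definition rnorm (R : realType) (k : scalar_kind)
  (H : completeNormedModType (scalar_field R k)) (x : H) : R := re `|x|.

(** The values of [op_app] outside [op_dom] are irrelevant. *)
Record operator (K : numFieldType) (V : lmodType K) := Operator {
  op_dom : set V;
  op_app :> V -> V }.

Definition op_linear (K : numFieldType) (V : lmodType K) (A : operator V) :=
  op_dom A 0 /\
  forall (a : K) (x y : V), op_dom A x -> op_dom A y ->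
    op_dom A (a *: x + y) /\ A (a *: x + y) = a *: A x + A y.

Definition op_add (K : numFieldType) (V : lmodType K) (A B : operator V) :
  operator V := Operator (op_dom A `&` op_dom B) (fun x => A x + B x).

Section operators_on_hilbert_space.
Variables (R : realType) (k : scalar_kind).
Variable H : completeNormedModType (scalar_field R k).
Variable ip : {dot H for scalar_conj k}.

Definition op_symmetric (A : operator H) :=
  forall x y, op_dom A x -> op_dom A y -> ip (A x) y = ip x (A y).

(** The graph of the adjoint; [z] is unique when [op_dom A] is dense. *)
Definition adjoint_graph (A : operator H) (y z : H) :=
  forall x, op_dom A x -> ip (A x) y = ip x z.

Definition self_adjoint (A : operator H) :=
  [/\ op_linear A, dense (op_dom A) &
      forall y z, adjoint_graph A y z <-> op_dom A y /\ A y = z].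

Definition bounded_from_above (A : operator H) :=
  exists c : R, forall x, op_dom A x -> re (ip (A x) x) <= c * rnorm x ^+ 2.

End operators_on_hilbert_space.

Section semigroups.
Variables (R : realType) (k : scalar_kind).
Variable H : completeNormedModType (scalar_field R k).

(** The values [S t] for [t < 0] are irrelevant. *)
Definition C0_semigroup (S : R -> H -> H) :=
  [/\ forall t, 0 <= t -> linear (S t) /\ continuous (S t),
      forall x, S 0 x = x,
      forall s t x, 0 <= s -> 0 <= t -> S (s + t) x = S s (S t x) &
      forall x, S h x @[h --> 0^'+] --> x].

Definition generates (A : operator H) (S : R -> H -> H) :=
  C0_semigroup S /\
  forall x y, op_dom A x /\ A x = y <->
    of_real k h^-1 *: (S h x - x) @[h --> 0^'+] --> y.

End semigroups.

(** The pair [(x, y)] stands for [x + i y]. *)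
Definition complexification (R : realType) (H : lmodType R) : Type :=
  (H * H)%type.

Section complexification_lmod.
Variables (R : realType) (H : lmodType R).

HB.instance Definition _ :=
  GRing.Zmodule.copy (complexification H) (H * H)%type.

Definition complexification_scale (z : R[i]) (v : complexification H) :
    complexification H :=
  (complex.Re z *: v.1 - complex.Im z *: v.2,
   complex.Re z *: v.2 + complex.Im z *: v.1).

Let scaleA z1 z2 v : complexification_scale z1 (complexification_scale z2 v) =
  complexification_scale (z1 * z2) v.
Proof.
case: z1 z2 v => [a b] [c d] [x y]; rewrite /complexification_scale /=.
congr pair; rewrite !scalerBr !scalerDr !scalerBl !scalerDl !scalerA.
  by rewrite !opprD -!addrA; congr (_ + _); rewrite addrA addrC.
by rewrite -!addrA; congr (_ + _); rewrite addrA addrC.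
Qed.

Let scale1 : left_id 1 complexification_scale.
Proof.
by case=> x y; rewrite /complexification_scale /= !scale1r !scale0r subr0 addr0.
Qed.

Let scaleDr : right_distributive complexification_scale +%R.
Proof.
move=> [a b] [x y] [x' y']; rewrite /complexification_scale /=.
by congr pair; rewrite !scalerDr ?opprD addrACA.
Qed.

Let scaleDl v : {morph complexification_scale^~ v : a b / a + b}.
Proof.
case: v => x y [a b] [c d]; rewrite /complexification_scale /=.
by congr pair; rewrite !scalerDl ?opprD addrACA.
Qed.

HB.instance Definition _ :=
  GRing.Zmodule_isLmodule.Build R[i] (complexification H)
    scaleA scale1 scaleDr scaleDl.

End complexification_lmod.

(** [cspace H] is the complexification of [H] if [H] is real, and [H] itself
    if it is complex; [cnorm] and [cop] are the norm and the extension of an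
    operator accordingly. *)
Definition cspace (R : realType) (k : scalar_kind) :
    completeNormedModType (scalar_field R k) -> lmodType R[i] :=
  match k return completeNormedModType (scalar_field R k) -> lmodType R[i] with
  | RealScalars => fun H : completeNormedModType R => complexification H
  | ComplexScalars => fun H : completeNormedModType R[i] => H
  end.

Definition cnorm (R : realType) (k : scalar_kind) :
    forall H : completeNormedModType (scalar_field R k), cspace H -> R :=
  match k return forall H : completeNormedModType (scalar_field R k),
    cspace H -> R with
  | RealScalars => fun (H : completeNormedModType R) (v : H * H) =>
      Num.sqrt (`|v.1| ^+ 2 + `|v.2| ^+ 2)
  | ComplexScalars => fun (H : completeNormedModType R[i]) (v : H) =>
      complex.Re `|v|
  end.

Definition cop (R : realType) (k : scalar_kind) :
    forall H : completeNormedModType (scalar_field R k),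
      operator H -> operator (cspace H) :=
  match k return forall H : completeNormedModType (scalar_field R k),
    operator H -> operator (cspace H) with
  | RealScalars => fun (H : completeNormedModType R) (A : operator H) =>
      @Operator R[i] (complexification H)
        [set v : H * H | op_dom A v.1 /\ op_dom A v.2]
        (fun v : H * H => (A v.1, A v.2))
  | ComplexScalars => fun (H : completeNormedModType R[i]) (A : operator H) => A
  end.

Section spectral.
Variables (R : realType) (k : scalar_kind).
Variable H : completeNormedModType (scalar_field R k).

(** [resolvent A z] is [(z - A)^-1], meaningful for [z] in the resolvent set. *)
Definition resolvent (A : operator H) (z : R[i]) (y : cspace H) : cspace H :=
  xget 0 [set x | op_dom (cop A) x /\ z *: x - cop A x = y].

Definition resolvent_set (A : operator H) : set R[i] :=
  [set z | (forall y, exists! x, op_dom (cop A) x /\ z *: x - cop A x = y) /\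
           exists M : R, forall y, cnorm (resolvent A z y) <= M * cnorm y].

Definition spectrum (A : operator H) : set R[i] := ~` resolvent_set A.

Definition is_max (E : set R[i]) (m : R) :=
  E m%:C /\ forall z, E z -> z <= m%:C.

(** For self-adjoint [A] bounded from above the maximum exists as soon as [H]
    is not the null space; on the null space the spectrum is empty and the
    condition is void. *)
Definition gt_max_spectrum (zeta : R) (A : operator H) :=
  forall m, is_max (spectrum A) m -> m < zeta.

Definition opnorm (B : cspace H -> cspace H) : R :=
  sup [set cnorm (B x) | x in [set x | cnorm x <= 1]].

End spectral.

Section integration.
Variables (R : realType) (k : scalar_kind).
Variable H : completeNormedModType (scalar_field R k).
Let mu := @lebesgue_measure R.

Definition simple (s : R -> H) :=
  finite_set (range s) /\ forall v, measurable (s @^-1` [set v]).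

(** Only used for [D] of finite measure. *)
Definition simple_integral (D : set R) (s : R -> H) : H :=
  \sum_(v \in range s) (of_real k (fine (mu (D `&` s @^-1` [set v]))) *: v).

(** Elements of Lebesgue spaces are represented by functions that are
    everywhere on [D] pointwise limits of Borel simple functions; every class
    of a.e. equal functions has such a representative. *)
Definition strongly_measurable (D : set R) (g : R -> H) :=
  exists s : nat -> R -> H, (forall n, simple (s n)) /\
    forall t, D t -> s n t @[n --> \oo] --> g t.

Definition is_bochner_integral (D : set R) (g : R -> H) (x : H) :=
  strongly_measurable D g /\
  exists s : nat -> R -> H,
    [/\ forall n, simple (s n),
        (\int[mu]_(t in D) (rnorm (g t - s n t))%:E)%E @[n --> \oo] --> 0%E &
        simple_integral D (s n) @[n --> \oo] --> x].

(** Junk value 0 if [g] is not Bochner integrable on [D]. *)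
Definition bochner (D : set R) (g : R -> H) : H :=
  xget 0 (is_bochner_integral D g).

Definition L2norm (D : set R) (g : R -> H) : \bar R :=
  Lnorm mu 2%:E ((fun t => (rnorm (g t))%:E) \_ D).

Definition L2 (D : set R) (g : R -> H) :=
  strongly_measurable D g /\ (L2norm D g < +oo)%E.

End integration.

Section Linfty.
Variable R : realType.
Let mu := @lebesgue_measure R.

Definition Linfty_norm (D : set R) (b : R -> R) : \bar R :=
  Lnorm mu +oo%E ((fun t => (b t)%:E) \_ D).

Definition Linfty (D : set R) (b : R -> R) :=
  measurable_fun D b /\ (Linfty_norm D b < +oo)%E.

Definition Linfty_nonneg (D : set R) (b : R -> R) :=
  Linfty D b /\ {ae mu, forall t, D t -> 0 <= b t}.

End Linfty.

Section control_problem.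
Variables (R : realType) (k : scalar_kind).
Variable H : completeNormedModType (scalar_field R k).
Variables (S : R -> H -> H) (T eps alpha : R) (f : R -> H) (beta : R -> R).
Variables (w : R -> H) (ystar : H).
Let mu := @lebesgue_measure R.

Definition state (u : H) (t : R) : H :=
  S t u + bochner `]0, t[ (fun tau => S tau (f (t - tau))).

Definition cost (u : H) : R :=
  alpha / 2 * rnorm u ^+ 2 +
  2^-1 * \int[mu]_(t in `]0, T[) (beta t * rnorm (state u t - w t) ^+ 2).

Definition feasible (u : H) := rnorm (state u T - ystar) <= eps.

Definition is_optimal (u : H) :=
  feasible u /\ forall v, feasible v -> cost u <= cost v.

End control_problem.

(* Main.v *)
Require Import Defs.
From HB Require Import structures.
From mathcomp Require Import all_boot all_order all_algebra.
From mathcomp Require Import sesquilinear complex.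
From mathcomp Require Import all_classical all_reals all_analysis.
From mathcomp Require Import measurable_realfun ess_sup_inf ring lra.

Set Implicit Arguments.
Unset Strict Implicit.
Unset Printing Implicit Defensive.

Import Order.TTheory GRing.Theory Num.Def Num.Theory.
Import numFieldNormedType.Exports.

Local Open Scope classical_set_scope.
Local Open Scope ring_scope.

(** The resolvent estimate is needed only for large [s]. For [q] in the domain of
    [A + dA], [p] in the domain of [A] and [x] the value of [(z - A)^-1] at
    [(z - A - dA) q], symmetry gives [<dA q, p> = <q - x, (conj z - A) p>], and since
    both [|(z - A - dA) q|] and [|(conj z - A) p|] grow like [|s|], the bound
    [nu s^-2] yields [|dA q| <= 4 nu |q|]: the perturbation is bounded and small.
    Gronwall estimates for [|S_t x|^2] and [|Sd_t x - S_t x|^2] then bound both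
    semigroups and make their difference [O(nu)] on [[0, T]], so that all data of
    the two problems, seen as quadratic functionals of [u], differ by [O(nu)].

    As [S_T] is symmetric and injective it has dense range, hence the unperturbed
    constraint has a Slater point and the Lagrange multipliers [lam] of the
    perturbed problems stay bounded. Coercivity and the two optimality conditions
    give, with [D] the distance of the minimizers,
    [a D^2 <= |lam - mu| O(nu) + O(nu) D], while [|lam - mu| = O(nu + D)]; so
    [D = O(nu)]. *)

(** Two requirements shape the argument. The constants may depend on the unperturbed data only,
    whereas the bound that the semigroup axioms give for [Sd] depends on [Sd]; so every quantitative
    estimate comes from an energy inequality with a rate at most [c + 4], where [c] bounds [A] from
    above, and bounds from the uniform boundedness principle serve only limits and extensions by
    density. And the rate must be linear in [nu]: comparing the two problems crudely leaves a bare
    term of order [nu] and gives only $D = O(\sqrt\nu)$. The gain is that the constraint errors at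
    the two minimizers enter with opposite signs, so that, up to a term with the difference of the
    multipliers, only the increment of the error between the two points remains. Real and complex
    spaces are treated at once through the real part of the inner product; complex scalars matter
    for the resolvents alone. *)

Local Notation "a %* x" := (of_real _ a *: x)
  (at level 40, left associativity, format "a  %*  x") : ring_scope.

(** * Real scalars inside the scalar field and the real-valued norm *)

Section scalars.
Variables (R : realType) (k : scalar_kind).
Implicit Types a b : R.

Lemma of_realD a b : of_real k (a + b) = of_real k a + of_real k b.
Proof. by case: k => //=; rewrite rmorphD. Qed.

Lemma of_realN a : of_real k (- a) = - of_real k a.
Proof. by case: k => //=; rewrite rmorphN. Qed.

Lemma of_realM a b : of_real k (a * b) = of_real k a * of_real k b.
Proof. by case: k => //=; rewrite rmorphM. Qed.

Lemma of_real0 : of_real k (0 : R) = 0.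
Proof. by case: k. Qed.

Lemma of_real1 : of_real k (1 : R) = 1.
Proof. by case: k. Qed.

Lemma of_realK a : re (of_real k a) = a.
Proof. by case: k. Qed.

Lemma reD (x y : scalar_field R k) : re (x + y) = re x + re y.
Proof. by case: k x y => //= -[a b] [c d]. Qed.

Lemma re_ofM a (x : scalar_field R k) : re (of_real k a * x) = a * re x.
Proof. by case: k x => //= -[b c] /=; rewrite mul0r subr0. Qed.

Lemma re_conj (x : scalar_field R k) : re (scalar_conj k x) = re x.
Proof. by case: k x => //= -[b c]. Qed.

Lemma of_real_le a b : (of_real k a <= of_real k b) = (a <= b).
Proof. by case: k => //=; rewrite lecR. Qed.

Lemma of_real_lt a b : (of_real k a < of_real k b) = (a < b).
Proof. by case: k => //=; rewrite ltcR. Qed.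

Lemma of_real_norm a : of_real k `|a| = `|of_real k a|.
Proof. by case: k => //=; rewrite normc_def /= expr0n addr0 sqrtr_sqr. Qed.

Lemma ge0_of_real (x : scalar_field R k) : 0 <= x -> of_real k (re x) = x.
Proof. by case: k x => //= -[a b]; rewrite lecE /= => /andP[/eqP -> _]. Qed.

Lemma re_of_sqr (x : scalar_field R k) : 0 <= x -> re (x ^+ 2) = re x ^+ 2.
Proof.
by move=> /ge0_of_real <-; rewrite of_realK expr2 -of_realM of_realK.
Qed.

End scalars.

Section realnorm.
Variables (R : realType) (k : scalar_kind).
Variable H : completeNormedModType (scalar_field R k).
Implicit Types (a : R) (x y z : H).

Lemma of_real_rnorm x : of_real k (rnorm x) = `|x|.
Proof. exact: ge0_of_real. Qed.

Lemma rnorm_ge0 x : 0 <= rnorm x.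
Proof. by rewrite -(of_real_le k) of_real_rnorm of_real0. Qed.
Hint Resolve rnorm_ge0 : core.

Lemma rnorm0 : rnorm (0 : H) = 0.
Proof. by rewrite /rnorm normr0 -(of_real0 R k) of_realK. Qed.

Lemma rnorm0_eq0 x : rnorm x = 0 -> x = 0.
Proof. by move=> x0; apply/normr0_eq0; rewrite -of_real_rnorm x0 of_real0. Qed.

Lemma rnormN x : rnorm (- x) = rnorm x.
Proof. by rewrite /rnorm normrN. Qed.

Lemma rnormZ a x : rnorm (a %* x) = `|a| * rnorm x.
Proof.
by rewrite /rnorm normrZ -of_real_norm -of_real_rnorm re_ofM of_realK.
Qed.

Lemma rnormD x y : rnorm (x + y) <= rnorm x + rnorm y.
Proof. by rewrite -(of_real_le k) of_realD !of_real_rnorm ler_normD. Qed.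

Lemma rnormB x y : rnorm (x - y) <= rnorm x + rnorm y.
Proof. by rewrite -(rnormN y) rnormD. Qed.

Lemma rnorm_distC x y : rnorm (x - y) = rnorm (y - x).
Proof. by rewrite -rnormN opprB. Qed.

Lemma rnorm_distD z x y : rnorm (x - y) <= rnorm (x - z) + rnorm (z - y).
Proof. by apply: le_trans (rnormD _ _); rewrite addrA subrK. Qed.

Lemma rnorm_le_dist x y : rnorm x <= rnorm y + rnorm (x - y).
Proof. by apply: le_trans (rnormD _ _); rewrite addrC subrK. Qed.

Lemma rnorm_dist_dist x y : `|rnorm x - rnorm y| <= rnorm (x - y).
Proof.
have := rnorm_le_dist x y; have := rnorm_le_dist y x.
by rewrite (rnorm_distC y x) ler_norml => ? ?; apply/andP; split; lra.
Qed.

(** A limit in [H] is tested with epsilons from [scalar_field R k]. In the order of [R[i]] a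
    positive element has zero imaginary part, so such an epsilon is [of_real] of its real part and
    real epsilons suffice. *)
Lemma cvg_rnormP {T : Type} {F : set_system T} {FF : Filter F} (f : T -> H) l :
  f @ F --> l <-> rnorm (f t - l) @[t --> F] --> 0.
Proof.
split=> [/cvgrPdist_lt fl|/cvgr0Pnorm_lt fl];
  [apply/cvgr0Pnorm_lt|apply/cvgrPdist_lt] => e e0.
  have /fl : 0 < of_real k e by rewrite -(of_real0 R k) of_real_lt.
  apply: filterS => t.
  by rewrite distrC -of_real_rnorm of_real_lt ger0_norm.
have e0' : 0 < re e.
  by rewrite -(of_real_lt k) ge0_of_real ?of_real0// ltW.
have := fl _ e0'; apply: filterS => t; rewrite ger0_norm// => h.
by rewrite distrC -of_real_rnorm -(ge0_of_real (ltW e0)) of_real_lt.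
Qed.

Lemma cvg_rnorm {T : Type} {F : set_system T} {FF : Filter F} (f : T -> H) l :
  f @ F --> l -> rnorm (f t) @[t --> F] --> rnorm l.
Proof.
move=> /cvg_rnormP/cvgr0Pnorm_lt fl; apply/cvgrPdist_lt => e /fl.
apply: filterS => t; rewrite ger0_norm//; apply: le_lt_trans.
by rewrite rnorm_distC rnorm_dist_dist.
Qed.

Lemma rcauchy_cvg (u : nat -> H) :
  (forall e, 0 < e -> exists N, forall m n, (N <= m)%N -> (N <= n)%N ->
     rnorm (u m - u n) < e) ->
  exists l : H, u n @[n --> \oo] --> l.
Proof.
move=> cu; suff /cauchy_cvg/cvg_ex : cauchy (u @ \oo) by [].
apply/cauchy_exP => e e0.
have e0' : 0 < re e.
  by rewrite -(of_real_lt k) ge0_of_real ?of_real0// ltW.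
have [N Nu] := cu _ e0'.
exists (u N); exists N => //= n Nn.
rewrite -ball_normE /= -of_real_rnorm -(ge0_of_real (ltW e0)) of_real_lt.
exact: Nu.
Qed.

Lemma dense_rnorm (D : set H) x e : dense D -> 0 < e ->
  exists2 y, D y & rnorm (y - x) < e.
Proof.
move=> dD e0.
have e0' : 0 < of_real k e by rewrite -(of_real0 R k) of_real_lt.
have [|y [xy Dy]] := dD (ball x (of_real k e)) _ (ball_open _ _).
  by exists x; exact: ballxx.
exists y => //; move: xy; rewrite -ball_normE /= -of_real_rnorm of_real_lt.
by rewrite rnorm_distC.
Qed.

End realnorm.
#[global] Hint Extern 0 (is_true (0 <= rnorm _)) => exact: rnorm_ge0 : core.

(** * The real part of the inner product *)

Section realinner.
Variables (R : realType) (k : scalar_kind).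
Variable H : completeNormedModType (scalar_field R k).
Variable ip : {dot H for scalar_conj k}.
Hypothesis ip_norm : forall x, ip x x = `|x| ^+ 2.

(** Turns [H] into a real inner product space with the same norm: for both kinds of scalars [rip] is
    symmetric and real-bilinear. *)
Definition rip (x y : H) : R := re (ip x y).
Implicit Types (a : R) (x y z : H).

Lemma ripxx x : rip x x = rnorm x ^+ 2.
Proof. by rewrite /rip ip_norm re_of_sqr. Qed.

Lemma ripC x y : rip x y = rip y x.
Proof.
by rewrite /rip (hermitian_subproof x y) expr0 mul1r re_conj.
Qed.

Lemma ripDl x y z : rip (x + y) z = rip x z + rip y z.
Proof. by rewrite /rip linearDl reD. Qed.

Lemma ripZl a x y : rip (a %* x) y = a * rip x y.
Proof. by rewrite /rip linearZl_LR /= re_ofM. Qed.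

Lemma ripDr x y z : rip z (x + y) = rip z x + rip z y.
Proof. by rewrite ripC ripDl !(ripC z). Qed.

Lemma ripZr a x y : rip x (a %* y) = a * rip x y.
Proof. by rewrite ripC ripZl ripC. Qed.

Lemma scaleN1 x : (-1) %* x = - x.
Proof. by rewrite of_realN of_real1 scaleN1r. Qed.

Lemma ripNl x y : rip (- x) y = - rip x y.
Proof. by rewrite -scaleN1 ripZl mulN1r. Qed.

Lemma ripNr x y : rip x (- y) = - rip x y.
Proof. by rewrite ripC ripNl ripC. Qed.

Lemma ripBl x y z : rip (x - y) z = rip x z - rip y z.
Proof. by rewrite ripDl ripNl. Qed.

Lemma ripBr x y z : rip z (x - y) = rip z x - rip z y.
Proof. by rewrite ripDr ripNr. Qed.

Lemma rip0l x : rip 0 x = 0.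
Proof. by rewrite -(subrr x) ripBl subrr. Qed.

Lemma rip0r x : rip x 0 = 0.
Proof. by rewrite ripC rip0l. Qed.

Lemma rnormD_sqr x y :
  rnorm (x + y) ^+ 2 = rnorm x ^+ 2 + 2 * rip x y + rnorm y ^+ 2.
Proof. rewrite -!ripxx ripDl !ripDr (ripC y x); ring. Qed.

Lemma rnormB_sqr x y :
  rnorm (x - y) ^+ 2 = rnorm x ^+ 2 - 2 * rip x y + rnorm y ^+ 2.
Proof. by rewrite rnormD_sqr rnormN ripNr mulrN. Qed.

Lemma rip_le x y : rip x y <= rnorm x * rnorm y.
Proof.
have [xy0|xy0] := eqVneq (rnorm x * rnorm y) 0.
  move/eqP: xy0; rewrite mulf_eq0 => /orP[] /eqP /rnorm0_eq0 ->.
    by rewrite rip0l rnorm0 mul0r.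
  by rewrite rip0r rnorm0 mulr0.
have xyp : 0 < rnorm x * rnorm y by rewrite lt0r xy0 mulr_ge0.
have := sqr_ge0 (rnorm (rnorm y %* x - rnorm x %* y)).
rewrite rnormB_sqr !rnormZ ripZl ripZr !ger0_norm// => h.
suff : 0 <= rnorm x * rnorm y * (rnorm x * rnorm y - rip x y).
  by rewrite pmulr_rge0// subr_ge0.
nra.
Qed.

Lemma rip_abs x y : `|rip x y| <= rnorm x * rnorm y.
Proof. by rewrite ler_norml rip_le andbT lerNl -ripNl -(rnormN x) rip_le. Qed.

End realinner.

(** * Stability of constrained minimizers of quadratic functionals *)

Section quadratic_functionals.
Variables (R : realType) (V : zmodType) (sc : R -> V -> V) (nrm : V -> R).
Hypotheses (sc1 : forall x, sc 1 x = x) (scN1 : forall x, sc (- 1) x = - x).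
Hypotheses (nrm_ge0 : forall x, 0 <= nrm x).

(** [L u] is the derivative of [F] at [u] and [b] its (constant) Hessian. *)
Record quadratic (F : V -> R) (L b : V -> V -> R) : Prop := Quadratic {
  quadE : forall u h t, F (u + sc t h) = F u + t * L u h + t ^+ 2 / 2 * b h h;
  quadL : forall u h h' t, L u (h + sc t h') = L u h + t * L u h';
  quadH : forall u v h, L v h = L u h + b (v - u) h;
  quad_ge0 : forall h, 0 <= b h h }.

Section quadratic_theory.
Variables (F : V -> R) (L b : V -> V -> R).
Hypothesis qF : quadratic F L b.

Lemma quad_deriv0 u : L u 0 = 0.
Proof. by have := quadL qF u 0 0 1; rewrite sc1 addr0; lra. Qed.

Lemma quad_derivN u h : L u (- h) = - L u h.
Proof. by rewrite -scN1 -(add0r (sc _ _)) (quadL qF) quad_deriv0; lra. Qed.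

Lemma quad_taylor u v : F v = F u + L u (v - u) + b (v - u) (v - u) / 2.
Proof.
have := quadE qF u (v - u) 1; rewrite sc1 addrC subrK => ->.
by rewrite expr1n mul1r mulrC [1 / 2]mul1r.
Qed.

Lemma quad_mean u v : F v - F u = (L u (v - u) + L v (v - u)) / 2.
Proof. by rewrite (quad_taylor u v) (quadH qF u v); lra. Qed.

Lemma quad_convex u v : L u (v - u) <= F v - F u.
Proof. by rewrite (quad_taylor u v); have := quad_ge0 qF (v - u); lra. Qed.

End quadratic_theory.

Definition minimizer (F G : V -> R) (E : R) (u : V) :=
  G u <= E /\ forall v, G v <= E -> F u <= F v.

Section lagrange_multiplier.
Variables (F G : V -> R) (L b l c : V -> V -> R) (E : R) (u u0 : V).
Hypotheses (qF : quadratic F L b) (qG : quadratic G l c).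
Hypotheses (min_u : minimizer F G E u) (slater : G u0 < E).

(** If the derivative were negative along [h], a short step along [h] would lower [F]; the
    disjunction keeps short steps feasible, either by the slack of the constraint or because [G]
    decreases along [h]. *)
Lemma minimizer_deriv_ge0 h : G u < E \/ l u h < 0 -> 0 <= L u h.
Proof.
move=> Gl; have [Gu Fu] := min_u.
have bh := quad_ge0 qF h; have ch := quad_ge0 qG h.
have [t0 t0_gt0 feas] : exists2 t0, 0 < t0 &
    forall t, 0 < t -> t <= t0 -> G (u + sc t h) <= E.
  case: Gl => [GE|l0].
  - pose d := `|l u h| + c h h + 1.
    have d0 : 0 < d by rewrite /d; have := normr_ge0 (l u h); lra.
    (* For [t <= 1] the increment of [G] is at most [t * d], so the step uses up no more than the
       slack. *)
    exists (Num.min 1 ((E - G u) / d)).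
      by rewrite lt_min ltr01 divr_gt0// subr_gt0.
    move=> t t_gt0; rewrite le_min => /andP[t1]; rewrite ler_pdivlMr// => td.
    rewrite (quadE qG); have := ler_norm (l u h); rewrite /d in td => ?.
    have : t ^+ 2 <= t by rewrite expr2; nra.
    nra.
  - have d0 : 0 < c h h + 1 by lra.
    (* Up to this length the linear term of [G] outweighs the quadratic one; the step for [F] below
       is chosen in the same way. *)
    exists (- l u h / (c h h + 1)); first by rewrite divr_gt0// oppr_gt0.
    move=> t t_gt0; rewrite ler_pdivlMr// => td.
    rewrite (quadE qG) expr2.
    have : t * (l u h + t * c h h / 2) <= 0 by nra.
    lra.
rewrite leNgt; apply/negP => L0.
have d0 : 0 < b h h + 1 by lra.
have s0 : 0 < - L u h / (b h h + 1) by rewrite divr_gt0// oppr_gt0.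
pose t := Num.min t0 (- L u h / (b h h + 1)).
have t_gt0 : 0 < t by rewrite lt_min t0_gt0.
have tt0 : t <= t0 by rewrite ge_min lexx.
have := Fu _ (feas t t_gt0 tt0).
have : t <= - L u h / (b h h + 1) by rewrite ge_min lexx orbT.
rewrite ler_pdivlMr// (quadE qF) expr2 => td.
have : t * (L u h + t * b h h / 2) < 0 by nra.
lra.
Qed.

(** With an active constraint, [L u] is nonnegative on the kernel of [l u]: a kernel direction is
    tilted into the feasible set by a small multiple of [u0 - u], along which [l u] is negative by
    convexity. The kernel is symmetric, so [L u] vanishes there and the two linear forms are
    proportional; the factor is read off at [u0 - u]. *)
Lemma lagrange_multiplier : exists lam, [/\ 0 <= lam,
  forall h, L u h = - lam * l u h & lam * (G u - E) = 0].
Proof.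
have [Gu Fu] := min_u.
have [GE|EG] := ltP (G u) E.
  exists 0; split=> // [h|]; rewrite ?oppr0 mul0r//; apply/eqP.
  rewrite eq_le minimizer_deriv_ge0 ?andbT//; last by left.
  by rewrite -oppr_ge0 -(quad_derivN qF) minimizer_deriv_ge0//; left.
have GuE : G u = E by apply/eqP; rewrite eq_le Gu.
pose h0 := u0 - u.
have l0 : l u h0 < 0.
  have := quad_convex qG u u0; rewrite -/h0 GuE; have := slater; lra.
have L0 : 0 <= L u h0 by apply: minimizer_deriv_ge0; right.
have Lker h : l u h = 0 -> 0 <= L u h.
  move=> lh; rewrite leNgt; apply/negP => Lh.
  (* Chosen so that the derivative of [F] along the tilted direction equals [- e], which is
     negative. *)
  pose e := - L u h / (L u h0 + 1).
  have d0 : 0 < L u h0 + 1 by lra.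
  have e0 : 0 < e by rewrite divr_gt0// oppr_gt0.
  have : 0 <= L u (h + sc e h0).
    by apply: minimizer_deriv_ge0; right; rewrite (quadL qG) lh add0r pmulr_rlt0.
  rewrite (quadL qF).
  have : e * (L u h0 + 1) = - L u h by rewrite /e mulfVK// gt_eqF.
  lra.
exists (- L u h0 / l u h0); split.
- by rewrite mulNr -mulrN -invrN mulr_ge0// invr_ge0 oppr_ge0 ltW.
(* [h] is projected along [h0] onto the kernel of [l u]. *)
- move=> h; pose t := - l u h / l u h0.
  have tl : t * l u h0 = - l u h by rewrite /t mulfVK// lt_eqF.
  have lk : l u (h + sc t h0) = 0 by rewrite (quadL qG) tl subrr.
  have L1 := Lker _ lk.
  have L2 : 0 <= L u (- (h + sc t h0)).
    by apply: Lker; rewrite (quad_derivN qG) lk oppr0.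
  rewrite (quad_derivN qF) (quadL qF) in L2; rewrite (quadL qF) in L1.
  have -> : L u h = - t * L u h0 by lra.
  by rewrite /t; field; rewrite lt_eqF.
- by rewrite GuE subrr mulr0.
Qed.

End lagrange_multiplier.

(** The multipliers of the two problems are compared by evaluating both
    optimality conditions in the direction [u0 - u], along which the derivative
    of [G] at [u] is negative if the constraint is active at [u]. *)
Lemma minimizer_stability (F G : V -> R) (L b l c : V -> V -> R)
    (E a P : R) (u u0 : V) :
  quadratic F L b -> quadratic G l c -> 0 < a -> 0 <= P ->
  (forall h, a * nrm h ^+ 2 <= b h h) ->
  (forall x h, `|b x h| <= P * nrm x * nrm h) ->
  (forall x h, `|c x h| <= P * nrm x * nrm h) ->
  minimizer F G E u -> G u0 < E ->
  exists nu0 C, [/\ 0 < nu0, 0 < C & forall nu, 0 < nu -> nu < nu0 ->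
    forall (Fd Gd : V -> R) (Ld bd ld cd : V -> V -> R) (v : V),
    quadratic Fd Ld bd -> quadratic Gd ld cd ->
    (forall x h, `|Ld x h - L x h| <= P * nu * (1 + nrm x) * nrm h) ->
    (forall x h, `|ld x h - l x h| <= P * nu * (1 + nrm x) * nrm h) ->
    (forall x, `|Gd x - G x| <= P * nu * (1 + nrm x) ^+ 2) ->
    (forall x, a * nrm x ^+ 2 <= Fd x) -> Fd u0 <= P ->
    minimizer Fd Gd E v -> nrm (v - u) <= C * nu].
Proof.
move=> qF qG a_gt0 P_ge0 b_coer b_bd c_bd min_u slater.
(* Half the slack of the Slater point: for small [nu] the perturbed constraint still has slack [eta]
   at [u0]. *)
pose eta := (E - G u0) / 2.
have eta_gt0 : 0 < eta by rewrite /eta; lra.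
have [mu [mu_ge0 KKT comp]] := lagrange_multiplier qF qG min_u slater.
have [Gu Fu] := min_u.
pose Lam := P / eta.
have Lam_ge0 : 0 <= Lam by rewrite divr_ge0// ltW.
(* Bounds both minimizers: coercivity gives [a * nrm v ^+ 2 <= Fd v <= Fd u0 <= P], and [nrm v] is
   at most 1 or at most its square. *)
pose N := P / a + 1 + nrm u.
have Pa : 0 <= P / a by rewrite divr_ge0// ltW.
have N_ge0 : 0 <= N by rewrite /N; have := nrm_ge0 u; lra.
pose K := P * (1 + N).
have K_ge0 : 0 <= K by rewrite mulr_ge0//; lra.
have PK : P <= K by rewrite /K ler_peMr//; lra.
pose K' := P * (1 + N) ^+ 2.
have K'_ge0 : 0 <= K' by apply: mulr_ge0 => //; exact: sqr_ge0.
pose nh := nrm (u0 - u).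
have nh0 : 0 <= nh := nrm_ge0 _.
pose C1 := (Lam + 1) * K * nh / (2 * eta).
have C1_ge0 : 0 <= C1.
  apply: divr_ge0; last by lra.
  by apply: mulr_ge0 => //; apply: mulr_ge0 => //; lra.
pose C3 := C1 * K' + (mu + 1) * K.
have C3_ge0 : 0 <= C3.
  by apply: addr_ge0; apply: mulr_ge0 => //; apply: addr_ge0.
pose C := 2 * C3 / a + K / a + 1.
have Ca1 : 0 <= 2 * C3 / a by apply: divr_ge0; [exact: mulr_ge0|exact: ltW].
have Ca2 : 0 <= K / a by rewrite divr_ge0// ltW.
(* The slack of an inactive constraint, which keeps [u] feasible for the perturbed problem; 1 is a
   placeholder for the active case. *)
pose eta' := if G u < E then E - G u else 1.
have eta'_gt0 : 0 < eta'.
  by rewrite /eta'; case: ifPn => // ?; rewrite subr_gt0.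
pose d0 := P * (1 + nrm u0) ^+ 2 + 1.
have d0_gt0 : 0 < d0.
  by apply: ltr_wpDl; [apply: mulr_ge0 => //; exact: sqr_ge0|exact: ltr01].
pose d1 := P * (1 + nrm u) ^+ 2 + 1.
have d1_gt0 : 0 < d1.
  by apply: ltr_wpDl; [apply: mulr_ge0 => //; exact: sqr_ge0|exact: ltr01].
exists (Num.min (eta / d0) (eta' / d1)), C; split.
- by rewrite lt_min; apply/andP; split; exact: divr_gt0.
- by rewrite /C; lra.
move=> nu nu_gt0; rewrite lt_min !ltr_pdivlMr// => /andP[nu1 nu2].
have nu_ge0 := ltW nu_gt0; have a_ge0 := ltW a_gt0.
move=> Fd Gd Ld bd ld cd v qFd qGd HL Hl HG Fd_coer Fd0 min_v.
have [Gdv Fdv] := min_v.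
have Gd0 : Gd u0 <= E - eta.
  have := HG u0; rewrite ler_norml => /andP[_]; move: nu1 nu_gt0.
  by rewrite /eta /d0; clear; lra.
have slater' : Gd u0 < E by move: Gd0 eta_gt0; clear; lra.
have [lam [lam_ge0 KKTd compd]] := lagrange_multiplier qFd qGd min_v slater'.
have Fdv0 : Fd v <= P by apply: le_trans Fd0; apply: Fdv; exact: ltW.
(* Convexity of both perturbed functionals along [u0 - v], together with complementarity, gives
   [lam * eta <= Fd u0 - Fd v <= P]. *)
have lam_le : lam <= Lam.
  rewrite ler_pdivlMr//.
  have := quad_convex qGd v u0; have := quad_convex qFd v u0.
  have : 0 <= Fd v by apply: le_trans (Fd_coer v); apply: mulr_ge0 => //; exact: sqr_ge0.
  rewrite KKTd; move: (ld v (u0 - v)) => X Fv0 h1 h2.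
  have h3 : lam * X <= lam * (Gd u0 - Gd v) by rewrite ler_wpM2l.
  have h4 : lam * (Gd u0 - Gd v) <= - (lam * eta).
    rewrite (_ : _ * _ = lam * (Gd u0 - E) - lam * (Gd v - E)); last by ring.
    rewrite compd subr0 -mulrN ler_wpM2l//.
    by move: Gd0; clear; lra.
  by move: Fv0 h1 h2 h3 h4 Fdv0 Fd0; clear; lra.
have nrmv : nrm v <= N.
  have h1 : nrm v ^+ 2 <= P / a.
    by rewrite ler_pdivlMr// mulrC; apply: le_trans (Fd_coer v) _.
    rewrite /N; apply: (@le_trans _ _ (P / a + 1)); last by rewrite lerDl.
  have [v1|n1] := leP (nrm v) 1; first by apply: (le_trans v1); rewrite lerDr.
  apply: le_trans (_ : nrm v ^+ 2 <= _); last by apply: (le_trans h1); rewrite lerDl.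
  by rewrite expr2 ler_peMr// ltW.
have nrmu : nrm u <= N by rewrite /N lerDr addr_ge0.
have HLv h : `|Ld v h - L v h| <= K * nu * nrm h.
  apply: le_trans (HL v h) _; rewrite ler_wpM2r// /K.
  by rewrite mulrAC ler_wpM2r// ler_wpM2l// lerD2l.
have Hlv x h : nrm x <= N -> `|ld x h - l x h| <= K * nu * nrm h.
  move=> xN; apply: le_trans (Hl x h) _; rewrite ler_wpM2r// /K.
  by rewrite mulrAC ler_wpM2r// ler_wpM2l// lerD2l.
have HGu : `|Gd u - G u| <= K' * nu.
  apply: le_trans (HG u) _; rewrite /K' mulrAC ler_wpM2r// ler_wpM2l//.
  by rewrite lerXn2r ?nnegrE ?addr_ge0// lerD2l.
pose D := nrm (v - u); rewrite -/D.
have D_ge0 : 0 <= D := nrm_ge0 _.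
(* The Hessian along [v - u] is the difference of the derivatives of [F] at the two points, and both
   are expressed through the multipliers. *)
have mono : a * D ^+ 2 <= - lam * ld v (v - u) + mu * l u (v - u) + K * nu * D.
  apply: le_trans (b_coer _) _.
  have := quadH qF u v (v - u); have := HLv (v - u); rewrite -/D.
  by rewrite ler_norml KKT KKTd; clear => /andP[h _] h'; lra.
(* Convexity of [Gd] between [v] and [u]; complementarity replaces [lam * Gd v] by [lam * E]. *)
have ld_le : - lam * ld v (v - u) <= lam * (Gd u - E).
  have := quad_convex qGd v u; rewrite -(opprB v u) (quad_derivN qGd) => h.
  have := ler_wpM2l lam_ge0 h; by move: compd; clear; lra.
(* In the quadratic case either [D <= nu] already, or [nu ^+ 2 <= nu * D] and a factor [D]
   cancels. *)
have finish : a * D ^+ 2 <= C3 * (nu ^+ 2 + nu * D) \/ a * D <= K * nu ->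
    D <= C * nu.
  case=> [h|h].
  - have [Dnu|nuD] := leP D nu.
      apply: (le_trans Dnu); rewrite ler_peMl//.
      by rewrite /C lerDr addr_ge0.
    have D_gt0 : 0 < D by exact: lt_trans nuD.
    have h2 : a * D * D <= 2 * C3 * nu * D.
      apply: le_trans (_ : C3 * (nu ^+ 2 + nu * D) <= _).
        by rewrite -mulrA -expr2.
      rewrite expr2; have := ler_wpM2l C3_ge0 (ler_wpM2l (ltW nu_gt0) (ltW nuD)).
      by clear; lra.
    have h3 : a * D <= 2 * C3 * nu by rewrite -(ler_pM2r D_gt0).
    have h4 : D <= 2 * C3 / a * nu.
      by rewrite mulrAC ler_pdivlMr// mulrC.
    by apply: (le_trans h4); rewrite ler_wpM2r// /C -addrA lerDl addr_ge0.
  - have h4 : D <= K / a * nu by rewrite mulrAC ler_pdivlMr// mulrC.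
    by apply: (le_trans h4); rewrite ler_wpM2r// /C -addrA addrCA lerDl addr_ge0.
apply: finish.
(* Inactive constraint: [mu] vanishes and [u] is feasible for the perturbed problem, so both
   multiplier terms are at most 0. *)
have [GuE|EGu] := ltP (G u) E.
  right.
  have mu0 : mu = 0.
    move/eqP: comp; rewrite mulf_eq0 => /orP[/eqP//|].
    by rewrite subr_eq0 lt_eqF.
  have GdE : Gd u <= E.
    have := HG u; rewrite ler_norml => /andP[_]; move: nu2 nu_gt0.
    by rewrite /d1 /eta' GuE; clear; lra.
  have h : lam * (Gd u - E) <= 0 by rewrite mulr_ge0_le0// subr_le0.
  rewrite mu0 in mono.
  have [D0|D0] := eqVneq D 0; first by rewrite D0 mulr0 mulr_ge0// ltW.
  have D_gt0 : 0 < D by rewrite lt0r D0.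
  rewrite -(ler_pM2r D_gt0) -[a * D * D]mulrA -expr2.
  by move: mono ld_le h; clear; lra.
left.
have GuE : G u = E by apply/eqP; rewrite eq_le Gu.
pose q := - l u (u0 - u).
have q_ge : 2 * eta <= q.
  by have := quad_convex qG u u0; rewrite /q /eta GuE; clear; lra.
have ldl : `|ld v (u0 - u) - l u (u0 - u)| <= K * (nu + D) * nh.
  have := Hlv v (u0 - u) nrmv; have := c_bd (v - u) (u0 - u).
  rewrite (quadH qG u v) -/nh -/D.
  move: (ld _ _) (l _ _) (c _ _) => X Y Z h1 h2.
  rewrite (_ : X - Y = X - (Y + Z) + Z); last by ring.
  apply: le_trans (ler_normD _ _) _.
  have : P * D * nh <= K * D * nh by rewrite ler_wpM2r// ler_wpM2r.
  by move: h1 h2; clear; lra.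
have LdL : `|Ld v (u0 - u) - L u (u0 - u)| <= K * (nu + D) * nh.
  have := HLv (u0 - u); have := b_bd (v - u) (u0 - u).
  rewrite (quadH qF u v) -/nh -/D.
  move: (Ld _ _) (L _ _) (b _ _) => X Y Z h1 h2.
  rewrite (_ : X - Y = X - (Y + Z) + Z); last by ring.
  apply: le_trans (ler_normD _ _) _.
  have : P * D * nh <= K * D * nh by rewrite ler_wpM2r// ler_wpM2r.
  by move: h1 h2; clear; lra.
(* By the two optimality conditions [(lam - mu) * q] is a combination of the differences of the
   derivatives along [u0 - u], and [q] is bounded below by the Slater gap. *)
have lam_mu : `|lam - mu| <= C1 * (nu + D).
  have e0 : 0 < 2 * eta by rewrite mulr_gt0.
  have h1 : `|lam - mu| * (2 * eta) <= (Lam + 1) * (K * (nu + D) * nh).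
    apply: le_trans (_ : `|lam - mu| * q <= _); first by rewrite ler_wpM2l.
    rewrite -(@ger0_norm _ q) -?normrM; last by apply: le_trans q_ge; exact: ltW.
    rewrite (_ : _ * _ = lam * (ld v (u0 - u) - l u (u0 - u)) +
                         (Ld v (u0 - u) - L u (u0 - u))); last first.
      by rewrite KKT KKTd /q; ring.
    apply: le_trans (ler_normD _ _) _; rewrite normrM (ger0_norm lam_ge0).
    have := ler_pM lam_ge0 (normr_ge0 _) lam_le ldl.
    by move: LdL; clear; lra.
  rewrite /C1 mulrAC ler_pdivlMr//; move: h1; clear; lra.
have lu_le : l u (v - u) <= G v - G u by exact: quad_convex qG u v.
(* Each of [mu * (G v - Gd v)] and [lam * (Gd u - G u)] alone is only of order [nu]. Their sum is
   [(lam - mu) * (Gd u - G u)] plus [mu] times this increment of [G - Gd], which the mean value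
   identity for quadratics bounds by order [nu * D]. *)
have mean : `|(G v - Gd v) - (G u - Gd u)| <= K * nu * D.
  rewrite (_ : _ - _ = (G v - G u) - (Gd v - Gd u)); last by ring.
  rewrite (quad_mean qG u v) (quad_mean qGd u v).
  have := Hlv v (v - u) nrmv; have := Hlv u (v - u) nrmu; rewrite -/D.
  move: (K * nu * D) (l _ _) (l _ _) (ld _ _) (ld _ _) => X x1 x2 x3 x4.
  by rewrite !ler_norml; clear => /andP[? ?] /andP[? ?]; apply/andP; split; lra.
have h1 : mu * l u (v - u) <= mu * (G v - Gd v).
  by rewrite ler_wpM2l//; apply: (le_trans lu_le); rewrite GuE lerD2l lerN2.
have h2 : (lam - mu) * (Gd u - G u) <= C1 * (nu + D) * (K' * nu).
  apply: le_trans (ler_norm _) _; rewrite normrM.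
  by apply: ler_pM.
have h3 : mu * ((G v - Gd v) - (G u - Gd u)) <= mu * (K * nu * D).
  by rewrite ler_wpM2l//; apply: le_trans mean; rewrite ler_norm.
have h4 : a * D ^+ 2 <= C1 * (nu + D) * (K' * nu) + mu * (K * nu * D) + K * nu * D.
  by move: ld_le mono h1 h2 h3; rewrite GuE; clear; lra.
have h5 : 0 <= (mu + 1) * K * nu ^+ 2.
  by apply: mulr_ge0; [apply: mulr_ge0 => //; exact: addr_ge0|exact: sqr_ge0].
apply: (le_trans h4); rewrite /C3; move: h5; clear; lra.
Qed.

End quadratic_functionals.

(** * Resolvent estimates *)

Lemma subr_interchange (V : zmodType) (a b c d : V) :
  (a - b) - (c - d) = (a - c) - (b - d).
Proof. by rewrite [- (c - d)]opprD addrACA -opprD. Qed.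

Section linear_operators.
Variables (K : numFieldType) (V : lmodType K) (A : operator V).
Hypothesis A_lin : op_linear A.

Lemma op_linear0 : A 0 = 0.
Proof.
have [A0 lA] := A_lin.
by have := (lA (-1) 0 0 A0 A0).2; rewrite !scaleN1r oppr0 addr0 addNr.
Qed.

Lemma op_linearZ a x : op_dom A x ->
  op_dom A (a *: x) /\ A (a *: x) = a *: A x.
Proof.
have [A0 lA] := A_lin => Dx.
by have := lA a x 0 Dx A0; rewrite op_linear0 !addr0.
Qed.

Lemma op_linearD x y : op_dom A x -> op_dom A y ->
  op_dom A (x + y) /\ A (x + y) = A x + A y.
Proof.
by have [_ lA] := A_lin => Dx Dy; have := lA 1 x y Dx Dy; rewrite !scale1r.
Qed.

Lemma op_linearB x y : op_dom A x -> op_dom A y ->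
  op_dom A (x - y) /\ A (x - y) = A x - A y.
Proof.
move=> Dx Dy; have [DN EN] := op_linearZ (-1) Dy.
by rewrite !scaleN1r in DN EN; rewrite -EN; exact: op_linearD.
Qed.

End linear_operators.

Lemma self_adjoint_symmetric (R : realType) (k : scalar_kind)
    (H : completeNormedModType (scalar_field R k))
    (ip : {dot H for scalar_conj k}) (A : operator H) :
  self_adjoint ip A -> op_symmetric ip A.
Proof. by move=> [_ _ adjA] x y Dx Dy; have [_ ->] := adjA y (A y). Qed.

Section complexified.
Variables (R : realType) (k : scalar_kind).
Variable H : completeNormedModType (scalar_field R k).
Variable ip : {dot H for scalar_conj k}.
Hypothesis ip_norm : forall x, ip x x = `|x| ^+ 2.
Implicit Types (A : operator H) (v w : cspace H).

Definition cembed : H -> cspace H :=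
  match k return forall H : completeNormedModType (scalar_field R k),
    H -> cspace H with
  | RealScalars => fun H x => (x, 0)
  | ComplexScalars => fun H x => x
  end H.

Lemma cembedD x y : cembed (x + y) = cembed x + cembed y.
Proof.
rewrite /cembed; case: k H x y => //= H' x y.
by congr pair; rewrite addr0.
Qed.

Lemma cembedN x : cembed (- x) = - cembed x.
Proof.
by rewrite /cembed; case: k H x => //= H' x; congr pair; rewrite oppr0.
Qed.

Lemma cnorm_ge0 v : 0 <= cnorm v.
Proof.
by case: k H v => [H' v|H' v]; [exact: sqrtr_ge0|exact: (@rnorm_ge0 _ ComplexScalars)].
Qed.

Lemma cnorm_embed x : cnorm (cembed x) = rnorm x.
Proof.
rewrite /cembed /rnorm; case: k H x => //= H' x.
by rewrite normr0 expr0n addr0 sqrtr_sqr normr_id.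
Qed.

Lemma cnorm0 : cnorm (0 : cspace H) = 0.
Proof.
case: k H => H'; last exact: (@rnorm0 _ ComplexScalars).
by rewrite /= normr0 expr0n addr0 sqrtr0.
Qed.

Lemma cnormZ (a : R) v : cnorm (a%:C%C *: v) = `|a| * cnorm v.
Proof.
case: k H v => H' v; last exact: (@rnormZ _ ComplexScalars).
rewrite /= !scale0r subr0 addr0 !normrZ !exprMn -mulrDr.
by rewrite sqrtrM ?sqr_ge0// sqrtr_sqr normr_id.
Qed.

Lemma sqrt_sum_sqr_le (x y : R) : 0 <= x -> 0 <= y ->
  Num.sqrt (x ^+ 2 + y ^+ 2) <= x + y.
Proof.
move=> x0 y0; rewrite -[leRHS]ger0_norm ?addr_ge0// -sqrtr_sqr.
by rewrite ler_wsqrtr// sqrrD -addrA lerD2l lerDr mulrn_wge0 ?mulr_ge0.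
Qed.

Lemma le_sqrt_sum_sqr (x y : R) : 0 <= x -> 0 <= y ->
  x <= Num.sqrt (x ^+ 2 + y ^+ 2) /\ y <= Num.sqrt (x ^+ 2 + y ^+ 2).
Proof.
move=> x0 y0; split.
  by rewrite -[leLHS]ger0_norm// -sqrtr_sqr ler_wsqrtr// lerDl sqr_ge0.
by rewrite -[leLHS]ger0_norm// -sqrtr_sqr ler_wsqrtr// lerDr sqr_ge0.
Qed.

(** The crude factor 2 avoids Minkowski's inequality for pairs; the bound only has to show that the
    supremum in [opnorm] ranges over a bounded set. *)
Lemma cnormB_le v w : cnorm (v - w) <= 2 * (cnorm v + cnorm w).
Proof.
case: k H v w => H' v w.
  have [v1 v2] := le_sqrt_sum_sqr (normr_ge0 v.1) (normr_ge0 v.2).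
  have [w1 w2] := le_sqrt_sum_sqr (normr_ge0 w.1) (normr_ge0 w.2).
  apply: (le_trans (sqrt_sum_sqr_le (normr_ge0 _) (normr_ge0 _))) => /=.
  have := ler_normB v.1 w.1; have := ler_normB v.2 w.2; rewrite /=; lra.
have := @rnormB _ ComplexScalars H' v w; rewrite /rnorm /=.
have := @rnorm_ge0 _ ComplexScalars H' v.
have := @rnorm_ge0 _ ComplexScalars H' w; rewrite /rnorm /=; lra.
Qed.

Lemma complexE (H' : lmodType R[i]) (a b : R) (x : H') :
  (a +i* b)%C *: x = a%:C%C *: x + b%:C%C *: ('i%C *: x).
Proof.
rewrite scalerA -scalerDl; congr (_ *: x).
by apply/eqP; rewrite eq_complex /=; apply/andP; split; apply/eqP; ring.
Qed.

Lemma rnorm_i (H' : completeNormedModType R[i]) (x : H') :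
  @rnorm R ComplexScalars H' ('i%C *: x) = @rnorm R ComplexScalars H' x.
Proof.
by rewrite /rnorm normrZ normc_def /= expr0n expr1n add0r sqrtr1 mul1r.
Qed.

Lemma cnorm_zembed (a s : R) (x y : H) :
  cnorm ((a +i* s)%C *: cembed x - cembed y) <=
    (`|a| + `|s|) * rnorm x + rnorm y.
Proof.
rewrite /cembed; case: k H x y => H' x y.
  apply: (le_trans (sqrt_sum_sqr_le (normr_ge0 _) (normr_ge0 _))) => /=.
  rewrite !scaler0 subr0 add0r subr0 normrZ /rnorm /=.
  by have := ler_normB (a *: x) y; rewrite normrZ; lra.
rewrite complexE; apply: (le_trans (@rnormB _ ComplexScalars _ _ _)).
rewrite lerD2r mulrDl; apply: (le_trans (@rnormD _ ComplexScalars _ _ _)).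
by rewrite !(@rnormZ _ ComplexScalars) rnorm_i.
Qed.

Section symmetric.
Variable A : operator H.
Hypotheses (A_lin : op_linear A) (A_sym : op_symmetric ip A).

Lemma cop_linear : op_linear (cop A).
Proof.
case: k H A A_lin => //= H' A' lA'; have [A0 _] := lA'.
split=> // -[a b] [x1 x2] [y1 y2] /= [Dx1 Dx2] [Dy1 Dy2].
have lZ := op_linearZ lA'; have lD := op_linearD lA'.
have [D11 E11] := lZ a _ Dx1; have [D12 E12] := lZ a _ Dx2.
have [D21 E21] := lZ b _ Dx1; have [D22 E22] := lZ (- b) _ Dx2.
have [D3 E3] := lD _ _ D11 D22; have [D4 E4] := lD _ _ D12 D21.
have [D5 E5] := lD _ _ D3 Dy1; have [D6 E6] := lD _ _ D4 Dy2.
rewrite /complexification_scale /= -[- (b *: x2)]scaleNr; split=> //.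
by rewrite E5 E6 E3 E4 E11 E12 E21 E22 scaleNr.
Qed.

Lemma cop_embed x : op_dom A x ->
  op_dom (cop A) (cembed x) /\ cop A (cembed x) = cembed (A x).
Proof.
rewrite /cembed; case: k H A A_lin x => //= H' A' lA x Dx.
by split; [split=> //; exact: lA.1|rewrite (op_linear0 lA)].
Qed.

Lemma cauchy_schwarz2 (x1 x2 y1 y2 : R) :
  x1 * y1 + x2 * y2 <= Num.sqrt (x1 ^+ 2 + x2 ^+ 2) * Num.sqrt (y1 ^+ 2 + y2 ^+ 2).
Proof.
rewrite -sqrtrM ?addr_ge0 ?sqr_ge0//; apply: (le_trans (ler_norm _)).
rewrite -sqrtr_sqr ler_wsqrtr// -subr_ge0.
rewrite (_ : _ - _ = (x1 * y2 - x2 * y1) ^+ 2); last by ring.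
exact: sqr_ge0.
Qed.

(** Symmetry makes the quadratic form of [A] real, so [s * cnorm v ^+ 2] is the imaginary part of
    the inner product of $(z-A)v$ with [v], and Cauchy-Schwarz applies. *)
Lemma cnorm_resolvent_le (a s : R) v : 0 <= s -> op_dom (cop A) v ->
  s * cnorm v <= cnorm ((a +i* s)%C *: v - cop A v).
Proof.
move=> s0 Dv.
suff h : s * cnorm v ^+ 2 <= cnorm ((a +i* s)%C *: v - cop A v) * cnorm v.
  have [->|v0] := eqVneq (cnorm v) 0; first by rewrite mulr0 cnorm_ge0.
  have v_gt0 : 0 < cnorm v by rewrite lt0r v0 cnorm_ge0.
  by rewrite -(ler_pM2r v_gt0) -mulrA -expr2.
move: v Dv; case: k H ip ip_norm A A_sym => H' ip' ipn A' sA v Dv.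
  case: v Dv => v1 v2 [/= Dv1 Dv2].
  have sN : @rip R RealScalars H' ip' (A' v1) v2 = rip ip' (A' v2) v1.
    by rewrite /rip /= sA//; exact: (@ripC _ RealScalars H' ip').
  rewrite sqr_sqrtr ?addr_ge0 ?sqr_ge0//.
  set y1 := _ - A' v1; set y2 := _ - A' v2.
  (* The imaginary part of the complexified inner product, in components. *)
  have h1 : @rip R RealScalars H' ip' y2 v1 - rip ip' y1 v2 =
      s * (`|v1| ^+ 2 + `|v2| ^+ 2).
    rewrite /y1 /y2 !(@ripBl _ RealScalars) !(@ripDl _ RealScalars).
    rewrite !(@ripZl _ RealScalars).
    rewrite !(@ripxx _ RealScalars H' ip' ipn) sN.
    by rewrite (@ripC _ RealScalars H' ip' v2 v1) /rnorm /=; ring.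
  rewrite -h1; apply: le_trans (_ : `|y1| * `|v2| + `|y2| * `|v1| <= _).
    have := @rip_le _ RealScalars H' ip' ipn y2 v1.
    have := @rip_le _ RealScalars H' ip' ipn (- y1) v2.
    by rewrite (@rnormN _ RealScalars) (@ripNl _ RealScalars) /rnorm /=; lra.
  by apply: (le_trans (cauchy_schwarz2 _ _ _ _)); rewrite [X in Num.sqrt X * _]addrC
    [X in _ * Num.sqrt X]addrC [X in Num.sqrt X * _]addrC.
(* In a complex space, pairing with ['i%C *: y] extracts the imaginary part. *)
have imE (x y : H') : @rip R ComplexScalars H' ip' x ('i%C *: y) =
    complex.Im (ip' x y).
  rewrite /rip linearZr_LR /=; case: (ip' x y) => p q /=; ring.
have imxx (x : H') : complex.Im (ip' x x) = 0.
  have : 0 <= ip' x x by rewrite ipn exprn_ge0.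
  by rewrite lecE => /andP[/eqP].
have imC (z : R[i]) : complex.Im (scalar_conj ComplexScalars z) =
    - complex.Im z by case: z.
have imA : complex.Im (ip' (A' v) v) = 0.
  have : complex.Im (ip' (A' v) v) = - complex.Im (ip' v (A' v)).
    rewrite {1}[ip' (A' v) v]hermitian_subproof expr0 mul1r.
    exact: imC.
  by rewrite -(sA v v Dv Dv); lra.
have -> : s * @cnorm R ComplexScalars H' v ^+ 2 =
    @rip R ComplexScalars H' ip' ((a +i* s)%C *: v - A' v) ('i%C *: v).
  rewrite complexE (@ripBl _ ComplexScalars) (@ripDl _ ComplexScalars).
  rewrite !(@ripZl _ ComplexScalars) !imE imxx imA -imE.
  rewrite (@ripxx _ ComplexScalars H' ip' ipn) rnorm_i /rnorm /=; ring.
apply: le_trans (@rip_le _ ComplexScalars H' ip' ipn _ _) _.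
by rewrite rnorm_i.
Qed.

Lemma mul_rip_le (a x y : R) : `|x| <= y -> a * x <= `|a| * y.
Proof.
by move=> xy; apply: (le_trans (ler_norm _)); rewrite normrM ler_wpM2l.
Qed.

(** Symmetry moves the unbounded operator across: [y] paired with [x] equals [v] paired with $(\bar
    z-A)x$. Over the reals the first component of the equation for [v] is enough, because [x] and
    [y] lie in [H]. *)
Lemma rip_resolvent_le (a s : R) v (x y : H) :
  op_dom (cop A) v -> op_dom A x ->
  (a +i* s)%C *: v - cop A v = cembed y ->
  rip ip y x <= cnorm v * ((`|a| + `|s|) * rnorm x + rnorm (A x)).
Proof.
rewrite /cembed.
case: k H ip ip_norm A A_sym v x y => H' ip' ipn A' sA v x y Dv Dx.
  case: v Dv => v1 v2 [Dv1 Dv2] /(congr1 fst) yE.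
  have -> : y = a *: v1 - s *: v2 - A' v1 by exact: esym yE.
  rewrite !(@ripBl _ RealScalars) !(@ripZl _ RealScalars).
  have -> : @rip R RealScalars H' ip' (A' v1) x = rip ip' v1 (A' x).
    by rewrite /rip /= sA.
  have [n1 n2] := le_sqrt_sum_sqr (normr_ge0 v1) (normr_ge0 v2).
  pose n := Num.sqrt (`|v1| ^+ 2 + `|v2| ^+ 2); rewrite -/n in n1 n2.
  rewrite (_ : cnorm _ = n)//.
  have r1 := mul_rip_le a (@rip_abs _ RealScalars H' ip' ipn v1 x).
  have r2 := mul_rip_le (- s) (@rip_abs _ RealScalars H' ip' ipn v2 x).
  have r3 := mul_rip_le (- 1) (@rip_abs _ RealScalars H' ip' ipn v1 (A' x)).
  rewrite normrN in r2; rewrite normrN normr1 mul1r in r3; rewrite /rnorm /= in r1 r2 r3 *.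
  have l1 : `|a| * (`|v1| * `|x|) <= `|a| * (n * `|x|).
    by rewrite ler_wpM2l// ler_wpM2r.
  have l2 : `|s| * (`|v2| * `|x|) <= `|s| * (n * `|x|).
    by rewrite ler_wpM2l// ler_wpM2r.
  have l3 : `|v1| * `|A' x| <= n * `|A' x| by rewrite ler_wpM2r.
  lra.
move=> <-; rewrite complexE (@ripBl _ ComplexScalars) (@ripDl _ ComplexScalars).
rewrite !(@ripZl _ ComplexScalars).
have -> : @rip R ComplexScalars H' ip' (A' v) x = rip ip' v (A' x).
  by rewrite /rip /= sA.
have r1 := mul_rip_le a (@rip_abs _ ComplexScalars H' ip' ipn v x).
have r2 := mul_rip_le s (@rip_abs _ ComplexScalars H' ip' ipn ('i%C *: v) x).
have r3 := mul_rip_le (- 1) (@rip_abs _ ComplexScalars H' ip' ipn v (A' x)).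
rewrite normrN normr1 mul1r in r3; rewrite rnorm_i in r2.
rewrite /rnorm /= in r1 r2 r3 *; lra.
Qed.

Lemma cnorm0_eq0 v : cnorm v = 0 -> v = 0.
Proof.
case: k H v => H' v; last exact: (@rnorm0_eq0 _ ComplexScalars).
have [v1 v2] := le_sqrt_sum_sqr (normr_ge0 v.1) (normr_ge0 v.2).
move=> /= v0; rewrite v0 in v1 v2; case: v v1 v2 {v0} => x y /= v1 v2.
by congr pair; apply/eqP; rewrite -normr_le0.
Qed.

(** For [s > 0] the bound [cnorm_resolvent_le] makes $z-A$ injective, so any solution at hand is the
    one that [xget] selects. *)
Lemma resolvent_eq (a s : R) v w : 0 < s -> op_dom (cop A) v ->
  (a +i* s)%C *: v - cop A v = w -> resolvent A (a +i* s)%C w = v.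
Proof.
move=> s0 Dv vw; apply: xget_unique => // v' [Dv' v'w].
have [Dd Ad] := op_linearB cop_linear Dv' Dv.
apply/eqP; rewrite -subr_eq0; apply/eqP/cnorm0_eq0/eqP.
have := cnorm_resolvent_le a (ltW s0) Dd.
rewrite Ad scalerBr subr_interchange v'w vw subrr cnorm0.
rewrite pmulr_rle0// => h; rewrite eq_le h; exact: cnorm_ge0.
Qed.

(** Both branches of [xget] obey the bound: a genuine solution by [cnorm_resolvent_le], the default
    value 0 trivially. *)
Lemma cnorm_resolvent (a s : R) w : 0 < s ->
  cnorm (resolvent A (a +i* s)%C w) <= cnorm w / s.
Proof.
move=> s0; rewrite ler_pdivlMr// mulrC /resolvent.
case: xgetP => [v _ [Dv <-]|_].
  exact: (cnorm_resolvent_le _ (ltW s0)).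
by rewrite cnorm0 mulr0 cnorm_ge0.
Qed.

End symmetric.

Section relatively_bounded.
Variables (A B : operator H).
Hypotheses (A_lin : op_linear A) (A_sym : op_symmetric ip A).
Hypotheses (AB_lin : op_linear (op_add A B)) (AB_sym : op_symmetric ip (op_add A B)).
Hypothesis A_dense : dense (op_dom A).
Variables (zeta r nu : R).
Hypotheses (r_gt0 : 0 < r) (nu_gt0 : 0 < nu).
Hypothesis resolvent_close : forall s : R,
  opnorm (fun x => resolvent (op_add A B) (zeta +i* s)%C x
                   - resolvent A (zeta +i* s)%C x) <
    nu * (if `|s| <= r then 1 else s ^- 2).

Lemma opnorm_resolvent (s : R) w : r < s -> cnorm w <= 1 ->
  cnorm (resolvent (op_add A B) (zeta +i* s)%C w - resolvent A (zeta +i* s)%C w)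
    <= nu * s ^- 2.
Proof.
move=> rs w1; have s0 : 0 < s by exact: lt_trans rs.
have := resolvent_close s; rewrite leNgt gtr0_norm// rs /=.
move=> /ltW; apply: le_trans.
(* A real [sup] dominates the elements only of a set that is bounded above; the resolvent bounds
   $1/s$ supply this. *)
apply: ub_le_sup; last by exists w.
exists (2 * (s^-1 + s^-1)) => _ [v /= v1 <-].
apply: (le_trans (cnormB_le _ _)); rewrite ler_pM2l//.
have vs : cnorm v / s <= s^-1 by rewrite ler_piMl// invr_ge0 ltW.
by apply: lerD; apply: le_trans vs; apply: cnorm_resolvent.
Qed.

(** Let [w] be the image of [x] under $z-A-B$; its norm is at most [c]. The vector $e=x-(z-A)^{-1}w$
    satisfies $(z-A)e=Bx$ and is small by the resolvent estimate; pairing with [y] and moving $z-A$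
    across gives the second alternative. The first one covers a [w] outside the range of $z-A$. *)
Lemma rip_perturbation (s : R) x y : r < s ->
  op_dom (op_add A B) x -> op_dom A y ->
  let c := (`|zeta| + s) * rnorm x + rnorm (op_add A B x) in
  rnorm x <= c * (nu * s ^- 2) \/
  rip ip (B x) y <=
    c * (nu * s ^- 2) * ((`|zeta| + s) * rnorm y + rnorm (A y)).
Proof.
move=> rs Dx Dy c; have s0 : 0 < s by exact: lt_trans rs.
have m_ge0 : 0 <= nu * s ^- 2.
  by apply: mulr_ge0; [exact: ltW|rewrite invr_ge0 sqr_ge0].
have zs_ge0 : 0 <= `|zeta| + s by apply: addr_ge0 => //; exact: ltW.
have c_ge0 : 0 <= c by apply: addr_ge0 => //; exact: mulr_ge0.
have [x0|x0] := eqVneq (rnorm x) 0.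
  by left; rewrite x0; exact: mulr_ge0.
have x_gt0 : 0 < rnorm x by rewrite lt0r x0 rnorm_ge0.
pose z := (zeta +i* s)%C.
have [Dx' ABx] := cop_embed AB_lin Dx.
have [DxA Ax] := cop_embed A_lin Dx.1.
pose w := z *: cembed x - cembed (op_add A B x).
have wc : cnorm w <= c.
  by apply: (le_trans (cnorm_zembed _ _ _ _)); rewrite (gtr0_norm s0).
have w_gt0 : 0 < cnorm w.
  have := cnorm_resolvent_le AB_sym zeta (ltW s0) Dx'.
  rewrite ABx cnorm_embed; apply: lt_le_trans; exact: mulr_gt0.
(* Normalises [w], since [opnorm] tests the unit ball. *)
pose t := ((cnorm w)^-1)%:C%C : R[i].
have t0 : ((cnorm w)%:C%C : R[i]) * t = 1.
  by rewrite -rmorphM /= divff// gt_eqF.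
have [Dx2 Ex2] := op_linearZ (cop_linear AB_lin) t Dx'.
have AB_x : resolvent (op_add A B) z (t *: w) = t *: cembed x.
  by apply: resolvent_eq => //; rewrite Ex2 ABx scalerA mulrC -scalerA -scalerBr.
have tn : `|(cnorm w)^-1| = (cnorm w)^-1 by rewrite gtr0_norm// invr_gt0.
have w1 : cnorm (t *: w) <= 1 by rewrite cnormZ tn mulVf// gt_eqF.
have := opnorm_resolvent rs w1; rewrite -/z AB_x => close.
have [[v [Dv vw]]|nov] := pselect (exists v, op_dom (cop A) v /\
    z *: v - cop A v = t *: w).
- right; rewrite (resolvent_eq A_lin A_sym s0 Dv vw) in close.
  pose e := cembed x - (cnorm w)%:C%C *: v.
  have [Dcv Ecv] := op_linearZ (cop_linear A_lin) (cnorm w)%:C%C Dv.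
  have [De Ee] := op_linearB (cop_linear A_lin) DxA Dcv.
  have ze : z *: e - cop A e = cembed (B x).
    rewrite Ee Ax Ecv scalerBr subr_interchange scalerA mulrC -scalerA.
    rewrite -scalerBr vw scalerA t0 scale1r /w subr_interchange subrr sub0r.
    rewrite opprB -cembedN -cembedD; congr cembed.
    by rewrite /= addrC addKr.
  have en : cnorm e <= c * (nu * s ^- 2).
    rewrite (_ : e = (cnorm w)%:C%C *: (t *: cembed x - v)).
      rewrite cnormZ gtr0_norm//; apply: ler_pM => //; exact: cnorm_ge0.
    by rewrite scalerBr scalerA t0 scale1r.
  apply: (le_trans (rip_resolvent_le A_sym De Dy ze)).
  rewrite (gtr0_norm s0); apply: ler_wpM2r => //.
  by apply: addr_ge0 => //; exact: mulr_ge0.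
(* Without a solution [resolvent A] takes its default value 0, so the estimate bounds [x] itself. *)
- left; have A_w : resolvent A z (t *: w) = 0.
    by apply: xgetPN => v vw; apply: nov; exists v.
  move: close; rewrite A_w subr0 cnormZ tn cnorm_embed mulrC ler_pdivrMr//.
  move=> h; apply: (le_trans h); rewrite mulrC; exact: ler_wpM2r.
Qed.

Hypothesis nu_lt1 : nu < 1.

(** Here [s] may depend on [x] and [y]: once it is large against the quotients of [op_add A B] at
    [x] and of [A] at [y], the two factors are at most [2 * s * rnorm x] and [2 * s * rnorm y], and
    their growth cancels the decay [s ^- 2]. *)
Lemma rip_perturbation_le x y : op_dom (op_add A B) x -> op_dom A y ->
  rip ip (B x) y <= 4 * nu * rnorm x * rnorm y.
Proof.
move=> Dx Dy.
have [x0|x0] := eqVneq (rnorm x) 0.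
  have xE : x = 0 by exact: rnorm0_eq0.
  have B0 : B x = 0.
    by have := op_linear0 AB_lin; rewrite xE /= (op_linear0 A_lin) add0r.
  by rewrite B0 rip0l x0 mulr0 mul0r.
have [y0|y0] := eqVneq (rnorm y) 0.
  by rewrite (rnorm0_eq0 y0) rip0r rnorm0 mulr0.
have x_gt0 : 0 < rnorm x by rewrite lt0r x0 rnorm_ge0.
have y_gt0 : 0 < rnorm y by rewrite lt0r y0 rnorm_ge0.
have a0 : 0 <= rnorm (op_add A B x) / rnorm x by rewrite divr_ge0.
have b0 : 0 <= rnorm (A y) / rnorm y by rewrite divr_ge0.
(* The summand 2 excludes the first alternative of [rip_perturbation], which would force
   [s <= 2 * nu]. *)
pose s := r + `|zeta| + rnorm (op_add A B x) / rnorm x + rnorm (A y) / rnorm y + 2.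
have z0 := normr_ge0 zeta; have r0 := r_gt0; have nu1 := nu_lt1.
have rs : r < s by rewrite /s; lra.
have s0 : 0 < s by exact: lt_trans rs.
have s2 : 2 < s by rewrite /s; lra.
have cx : (`|zeta| + s) * rnorm x + rnorm (op_add A B x) <= 2 * s * rnorm x.
  have : rnorm (op_add A B x) / rnorm x <= s - `|zeta| by rewrite /s; lra.
  by rewrite ler_pdivrMr//; lra.
have cy : (`|zeta| + s) * rnorm y + rnorm (A y) <= 2 * s * rnorm y.
  have : rnorm (A y) / rnorm y <= s - `|zeta| by rewrite /s; lra.
  by rewrite ler_pdivrMr//; lra.
have m_ge0 : 0 <= nu * s ^- 2.
  by apply: mulr_ge0; [exact: ltW|rewrite invr_ge0 sqr_ge0].
have cm : ((`|zeta| + s) * rnorm x + rnorm (op_add A B x)) * (nu * s ^- 2) <=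
    2 * nu * rnorm x / s.
  apply: (le_trans (ler_wpM2r m_ge0 cx)).
  by rewrite le_eqVlt; apply/orP; left; apply/eqP; field; rewrite gt_eqF.
have [h|h] := rip_perturbation rs Dx Dy.
  have : rnorm x <= 2 * nu * rnorm x / s by exact: le_trans cm.
  rewrite ler_pdivlMr// mulrC [2 * nu * _]mulrC [_ * (2 * nu)]mulrC.
  by rewrite ler_pM2r// leNgt => /negP[]; lra.
apply: (le_trans h); apply: le_trans (_ : (2 * nu * rnorm x / s) * (2 * s * rnorm y) <= _).
  apply: ler_pM => //; last 1 first.
    apply: addr_ge0 => //; apply: mulr_ge0 => //; apply: addr_ge0 => //; exact: ltW.
  apply: mulr_ge0 => //; apply: addr_ge0 => //; apply: mulr_ge0 => //.
  by apply: addr_ge0 => //; exact: ltW.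
by rewrite le_eqVlt; apply/orP; left; apply/eqP; field; rewrite gt_eqF.
Qed.

(** By density some [y] in the domain of [A] lies close to [B x], so the form bound nearly tests
    [B x] against itself. *)
Lemma perturbation_le x : op_dom (op_add A B) x ->
  rnorm (B x) <= 4 * nu * rnorm x.
Proof.
move=> Dx; rewrite leNgt; apply/negP => lt_n.
pose d := rnorm (B x) - 4 * nu * rnorm x.
have d0 : 0 < d by rewrite /d subr_gt0.
have c0 : 0 <= 4 * nu * rnorm x by rewrite mulr_ge0// mulr_ge0// ltW.
have B0 : 0 < rnorm (B x) by exact: le_lt_trans lt_n.
have [|y Dy yB] := dense_rnorm (B x) A_dense (_ : 0 < d / 2).
  by rewrite divr_gt0.
have h1 := rip_perturbation_le Dx Dy.
have h2 : rnorm (B x) ^+ 2 <= rip ip (B x) y + rnorm (B x) * (d / 2).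
  have -> : rnorm (B x) ^+ 2 = rip ip (B x) y + rip ip (B x) (B x - y).
    by rewrite ripBr ripxx//; ring.
  rewrite lerD2l; apply: (le_trans (rip_le ip_norm _ _)).
  by rewrite ler_wpM2l// rnorm_distC ltW.
have h3 : rnorm y <= rnorm (B x) + d / 2.
  by apply: (le_trans (rnorm_le_dist _ (B x))); rewrite lerD2l ltW.
have h4 : 4 * nu * rnorm x * rnorm y <= 4 * nu * rnorm x * (rnorm (B x) + d / 2).
  by rewrite ler_wpM2l.
have h5 : rnorm (B x) * d <= d / 2 * (rnorm (B x) + 4 * nu * rnorm x).
  by rewrite /d in h1 h2 h4 *; lra.
have h6 : d / 2 * (rnorm (B x) + 4 * nu * rnorm x) < d / 2 * (2 * rnorm (B x)).
  by rewrite ltr_pM2l ?divr_gt0//; lra.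
lra.
Qed.

End relatively_bounded.
End complexified.

(** * Semigroups *)

Section uniform_boundedness.
Variables (R : realType) (k : scalar_kind).
Variable H : completeNormedModType (scalar_field R k).
Implicit Types (x y : H) (f : H -> H).

Section linear_maps.
Variable f : H -> H.
Hypothesis f_lin : linear f.

Lemma lin_mapD x y : f (x + y) = f x + f y.
Proof. by have := f_lin 1 x y; rewrite !scale1r. Qed.

Lemma lin_map0 : f 0 = 0.
Proof. by apply: (addrI (f 0)); rewrite -lin_mapD !addr0. Qed.

Lemma lin_mapZ a x : f (a *: x) = a *: f x.
Proof. by have := f_lin a x 0; rewrite lin_map0 !addr0. Qed.

Lemma lin_mapB x y : f (x - y) = f x - f y.
Proof. by rewrite -scaleN1r lin_mapD lin_mapZ scaleN1r. Qed.

Lemma lin_map_bounded : continuous f ->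
  exists2 M, 0 <= M & forall x, rnorm (f x) <= M * rnorm x.
Proof.
move=> /(_ 0) /cvg_rnormP; rewrite lin_map0 => /cvgr0Pnorm_lt /(_ 1 ltr01).
move=> /nbhs_ballP[e /= e0 fe].
have e0' : 0 < re e by rewrite -(of_real_lt k) ge0_of_real ?of_real0// ltW.
exists (2 / re e) => [|x]; first by rewrite divr_ge0// ltW.
have [x0|x0] := eqVneq (rnorm x) 0.
  by rewrite (rnorm0_eq0 x0) lin_map0 rnorm0 mulr0.
have x_gt0 : 0 < rnorm x by rewrite lt0r x0 rnorm_ge0.
pose t := re e / (2 * rnorm x).
have t0 : 0 < t by rewrite divr_gt0// mulr_gt0.
have : ball (0 : H) e (t %* x).
  rewrite -ball_normE /= sub0r normrN -of_real_rnorm -(ge0_of_real (ltW e0)).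
  rewrite of_real_lt rnormZ gtr0_norm// /t.
  rewrite (_ : re e / (2 * rnorm x) * rnorm x = re e / 2); last by field; rewrite gt_eqF.
  by rewrite ltr_pdivrMr// ltr_pMr// ltr1n.
move=> /fe /=; rewrite subr0 ger0_norm// lin_mapZ rnormZ gtr0_norm// => /ltW h.
rewrite -(ler_pM2l t0); apply: (le_trans h).
by rewrite le_eqVlt /t; apply/orP; left; apply/eqP; field; rewrite !gt_eqF.
Qed.

End linear_maps.

Lemma closed_ball_lim (u : nat -> H) l x d N : u n @[n --> \oo] --> l ->
  (forall n, (N <= n)%N -> rnorm (u n - x) <= d) -> rnorm (l - x) <= d.
Proof.
move=> /cvg_rnormP/cvgr0Pnorm_lt ul ud; apply/ler_addgt0Pr => e /ul[n0 _ h].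
apply: (le_trans (rnorm_distD (u (maxn n0 N)) _ _)); rewrite addrC lerD//.
  by apply: ud; rewrite leq_maxr.
rewrite rnorm_distC; apply/ltW/(le_lt_trans (ler_norm _)); apply: h.
by rewrite /= leq_maxl.
Qed.

(** The library's [Banach_Steinhauss] is restricted to real scalars. If no
    uniform bound existed, one could build nested balls such that on the [n]-th
    ball some [T i] exceeds [n] in norm; the common point contradicts pointwise
    boundedness. *)
Lemma uniform_boundedness (I : Type) (T : I -> H -> H) :
  (forall i, linear (T i) /\ continuous (T i)) ->
  (forall x, exists M, forall i, rnorm (T i x) <= M) ->
  exists M, forall i x, rnorm (T i x) <= M * rnorm x.
Proof.
move=> T_lc T_pw; apply: contrapT => unb.
have {}unb M : exists i x, M * rnorm x < rnorm (T i x).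
  apply: contrapT => h; apply: unb; exists M => i x; rewrite leNgt.
  by apply/negP => h'; apply: h; exists i, x.
(* One stage of the nested balls, a ball being a pair of centre and radius. The positivity premise
   sits under the existential quantifier, so that a choice function on all pairs can be
   extracted. *)
have step (K : R) (b : H * R) : exists b' : H * R, 0 < b.2 ->
    [/\ 0 < b'.2, b'.2 <= b.2 / 2,
        forall y, rnorm (y - b'.1) <= b'.2 -> rnorm (y - b.1) <= b.2 &
        exists i, forall y, rnorm (y - b'.1) <= b'.2 -> K < rnorm (T i y)].
  case: b => c d /=; have [d0|d0] := ltP 0 d; last first.
    by exists (0, 0).
  (* Otherwise every [T i] would be bounded by [K] on the ball of radius [d / 2] about [c], hence
     have norm at most [4 * K / d]: a short vector is the difference of two points of that ball. *)
  have [i [c' [cc' Kc']]] : exists i c', rnorm (c' - c) <= d / 2 /\ K < rnorm (T i c').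
    apply: contrapT => h.
    have {}h i y : rnorm (y - c) <= d / 2 -> rnorm (T i y) <= K.
      by move=> yc; rewrite leNgt; apply/negP => h'; apply: h; exists i, y.
    have [i [x]] := unb (4 * K / d); apply/negP; rewrite -leNgt.
    have [Tl Tc] := T_lc i.
    have [x0|x0] := eqVneq (rnorm x) 0.
      by rewrite (rnorm0_eq0 x0) (lin_map0 Tl) rnorm0 mulr0.
    have x_gt0 : 0 < rnorm x by rewrite lt0r x0 rnorm_ge0.
    pose t := d / 2 / rnorm x.
    have t0 : 0 < t by rewrite divr_gt0// divr_gt0.
    have h1 : rnorm (T i c) <= K.
      by apply: h; rewrite subrr rnorm0 divr_ge0// ltW.
    have h2 : rnorm (T i (c + t %* x)) <= K.
      by apply: h; rewrite addrC addKr rnormZ gtr0_norm// /t divfK.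
    rewrite -(ler_pM2l t0) -{1}(gtr0_norm t0) -rnormZ -(lin_mapZ Tl).
    rewrite -[t %* x](addKr c) addrC (lin_mapB Tl).
    apply: (le_trans (rnormB _ _)); apply: (le_trans (lerD h2 h1)).
    by rewrite le_eqVlt /t; apply/orP; left; apply/eqP; field; rewrite !gt_eqF.
  have [Tl Tc] := T_lc i.
  have [m m0 Tm] := lin_map_bounded Tl Tc.
  have m1 : 0 < 2 * (m + 1) by lra.
  (* Within [d'] of [c'] the value of [T i] moves by at most [m * d'], which is less than its excess
     over [K]. *)
  pose d' := Num.min (d / 2) ((rnorm (T i c') - K) / (2 * (m + 1))).
  have d'_gt0 : 0 < d' by rewrite lt_min !divr_gt0// subr_gt0.
  have d'1 : d' <= d / 2 by rewrite ge_min lexx.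
  have d'2 : d' * (2 * (m + 1)) <= rnorm (T i c') - K.
    by rewrite -ler_pdivlMr// ge_min lexx orbT.
  exists (c', d') => _ /=; split => // [y yc'|].
    by apply: (le_trans (rnorm_distD c' _ _)); lra.
  exists i => y yc'.
  have h1 := rnorm_le_dist (T i c') (T i y).
  have h2 : rnorm (T i c' - T i y) <= m * d'.
    rewrite -(lin_mapB Tl); apply: (le_trans (Tm _)).
    by rewrite rnorm_distC ler_wpM2l.
  have : 0 <= m * d' by rewrite mulr_ge0// ltW.
  lra.
have [st stP] : {st : R -> H * R -> H * R | forall K b, 0 < b.2 ->
    [/\ 0 < (st K b).2, (st K b).2 <= b.2 / 2,
        forall y, rnorm (y - (st K b).1) <= (st K b).2 -> rnorm (y - b.1) <= b.2 &
        exists i, forall y, rnorm (y - (st K b).1) <= (st K b).2 ->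
          K < rnorm (T i y)]}.
  exists (fun K b => sval (cid (step K b))) => K b b0.
  exact: (svalP (cid (step K b))) b0.
pose B := fix B n := if n is m.+1 then st m%:R (B m) else (0 : H, 1 : R).
have B0 n : 0 < (B n).2.
  by elim: n => [|n IH] /=; [exact: ltr01|have [] := stP n%:R _ IH].
have Bd n : (B n).2 <= 2^-1 ^+ n.
  elim: n => [|n IH]; first by rewrite expr0.
  have [_ h _ _] := stP n%:R _ (B0 n).
  by apply: (le_trans h); rewrite exprSr ler_pM2r// invr_gt0.
have Bs n m : (n <= m)%N -> forall y, rnorm (y - (B m).1) <= (B m).2 ->
    rnorm (y - (B n).1) <= (B n).2.
  move=> /subnK <-; elim: (m - n)%N => [//|j IH] y.
  rewrite addSn => yB; apply: IH.
  by have [_ _ h _] := stP (j + n)%:R _ (B0 (j + n)%N); exact: h.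
have Bc n m : (n <= m)%N -> rnorm ((B m).1 - (B n).1) <= (B n).2.
  by move=> nm; apply: (Bs n m nm); rewrite subrr rnorm0 ltW.
have [l Bl] : exists l : H, (B n).1 @[n --> \oo] --> l.
  apply: rcauchy_cvg => e e0.
  have [N NE] : exists N, 2^-1 ^+ N < e / 2 :> R.
    have : (2^-1 : R) ^+ n @[n --> \oo] --> (0 : R).
      by apply: cvg_expr; rewrite gtr0_norm ?invr_gt0// invf_lt1// ltr1n.
    move=> /cvgr0Pnorm_lt /(_ (e / 2)) []; first by rewrite divr_gt0.
    by move=> N _ /(_ N (leqnn N)) h; exists N; apply: le_lt_trans (ler_norm _) h.
  exists N => m n Nm Nn; apply: le_lt_trans (rnorm_distD (B N).1 _ _) _.
  rewrite (rnorm_distC (B N).1).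
  have := Bc _ _ Nm; have := Bc _ _ Nn; have := Bd N; lra.
have lB n : rnorm (l - (B n).1) <= (B n).2.
  by apply: closed_ball_lim Bl _ => m; exact: Bc.
have [M TM] := T_pw l.
have [_ _ _ [i Ti]] := stP (truncn M).+1%:R _ (B0 (truncn M).+1).
have /Ti := lB (truncn M).+2.
by rewrite ltNge (le_trans (TM i))// ltW// truncnS_gt.
Qed.

End uniform_boundedness.

Section semigroup.
Variables (R : realType) (k : scalar_kind).
Variable H : completeNormedModType (scalar_field R k).
Variable S : R -> H -> H.
Hypothesis S_C0 : C0_semigroup S.

Lemma semigroup_lin t : 0 <= t -> linear (S t).
Proof. by move=> t0; have [/(_ _ t0)[]] := S_C0. Qed.

Lemma semigroup_cont t : 0 <= t -> continuous (S t).
Proof. by move=> t0; have [/(_ _ t0)[]] := S_C0. Qed.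

Lemma semigroup0 x : S 0 x = x.
Proof. by have [_] := S_C0. Qed.

Lemma semigroupD s t x : 0 <= s -> 0 <= t -> S (s + t) x = S s (S t x).
Proof. by have [_ _ + _] := S_C0; exact. Qed.

Lemma at_right0P (P : R -> Prop) :
  (\forall h \near 0^'+, P h) <-> exists2 d, 0 < d & forall h, 0 < h -> h < d -> P h.
Proof.
split=> [[d /= d0 dP]|[d d0 dP]].
  exists d => // h h0 hd; apply: dP => //=.
  by rewrite sub0r normrN gtr0_norm.
exists d => //= h /=; rewrite sub0r normrN => hd h0; apply: dP => //.
by apply: le_lt_trans hd; exact: ler_norm.
Qed.

Lemma semigroup_near0 x e : 0 < e -> exists2 d, 0 < d &
  forall h, 0 <= h -> h < d -> rnorm (S h x - x) < e.
Proof.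
move=> e0; have [_ _ _ /(_ x)] := S_C0.
move=> /cvg_rnormP/cvgr0Pnorm_lt/(_ _ e0)/at_right0P[d d0 dP].
exists d => // h h0 hd; have [->|h1] := eqVneq h 0.
  by rewrite semigroup0 subrr rnorm0.
by apply: (le_lt_trans (ler_norm _)); apply: dP => //; rewrite lt0r h1.
Qed.

(** Otherwise there are times tending to 0 at which the operator norms are unbounded, although each
    orbit converges along them and is therefore bounded; this contradicts [uniform_boundedness]. *)
Lemma semigroup_bounded_near0 : exists d M,
  [/\ 0 < d, 1 <= M & forall h x, 0 <= h -> h <= d -> rnorm (S h x) <= M * rnorm x].
Proof.
apply: contrapT => unb.
have {}unb (n : nat) : exists h, [/\ 0 <= h, h <= n.+1%:R^-1 &
    exists x, n.+1%:R * rnorm x < rnorm (S h x)].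
  apply: contrapT => h; apply: unb; exists n.+1%:R^-1, n.+1%:R; split=> //.
    by rewrite ler1n.
  move=> t x t0 tn; rewrite leNgt; apply/negP => tx; apply: h.
  by exists t; split=> //; exists x.
pose t n := sval (cid (unb n)).
have tP n : [/\ 0 <= t n, t n <= n.+1%:R^-1 &
    exists x, n.+1%:R * rnorm x < rnorm (S (t n) x)].
  exact: svalP (cid (unb n)).
have [|x|M TM] := @uniform_boundedness _ _ H nat (fun n => S (t n)).
- move=> n; have [t0 _ _] := tP n.
  by split; [exact: semigroup_lin|exact: semigroup_cont].
- have [d d0 dP] := semigroup_near0 x ltr01.
  pose N := truncn d^-1.
  exists (rnorm x + 1 + \sum_(i < N.+1) rnorm (S (t i) x)) => n.
  have sum0 : 0 <= \sum_(i < N.+1) rnorm (S (t i) x) by exact: sumr_ge0.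
  have [nN|Nn] := ltnP n N.+1.
    rewrite (bigD1 (Ordinal nN))//= [X in _ <= X]addrC -addrA lerDl.
    by rewrite addr_ge0 ?sumr_ge0// addr_ge0.
  have [t0 tn _] := tP n.
  have td : t n < d.
    apply: (le_lt_trans tn); rewrite -[d]invrK ltf_pV2 ?posrE ?invr_gt0//.
    apply: (lt_le_trans (truncnS_gt _)); rewrite ler_nat -/N.
    exact: (leq_trans Nn).
  have h1 := dP _ t0 td; have h2 := rnorm_le_dist (S (t n) x) x.
  by rewrite -[rnorm _]addr0 lerD//; lra.
have [t0 _ [x]] := tP (truncn M).
apply/negP; rewrite -leNgt; apply: (le_trans (TM _ _)).
by rewrite ler_wpM2r// ltW// truncnS_gt.
Qed.

(** The constant depends on [S] itself and serves continuity, measurability and density arguments.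
    Bounds common to all perturbed semigroups come from [perturbed_growth]. *)
Lemma semigroup_bounded T : exists2 M, 0 < M &
  forall t x, 0 <= t -> t <= T -> rnorm (S t x) <= M * rnorm x.
Proof.
have [d [M [d0 M1 SM]]] := semigroup_bounded_near0.
have M0 : 0 <= M by apply: le_trans M1.
have Sn n t x : 0 <= t -> t <= n%:R * d -> rnorm (S t x) <= M ^+ n * rnorm x.
  elim: n t x => [|n IH] t x t0.
    rewrite mul0r => t0'; have -> : t = 0 by apply/eqP; rewrite eq_le t0'.
    by rewrite semigroup0 expr0 mul1r.
  have [td _|dt] := leP t d.
    apply: (le_trans (SM _ _ t0 td)); rewrite ler_wpM2r// exprS.
    by rewrite ler_peMr// exprn_ege1.
  rewrite -addn1 natrD mulrDl mul1r -lerBlDr => h.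
  have td0 : 0 <= t - d by rewrite subr_ge0 ltW.
  rewrite -{1}(subrK d t) (semigroupD _ td0 (ltW d0)).
  apply: (le_trans (IH _ _ td0 h)).
  by rewrite addn1 exprSr -mulrA ler_wpM2l ?exprn_ge0// SM// ltW.
exists (M ^+ (truncn (T / d)).+1) => [|t x t0 tT].
  by rewrite exprn_gt0// (lt_le_trans _ M1).
apply: Sn => //; apply: (le_trans tT).
by rewrite -ler_pdivrMr// ltW// truncnS_gt.
Qed.

Lemma semigroup_dist T : exists2 M, 0 < M & forall s t x,
  0 <= s <= T -> 0 <= t <= T ->
  rnorm (S s x - S t x) <= M * rnorm (S `|s - t| x - x).
Proof.
have [M M0 SM] := semigroup_bounded T; exists M => //.
have h s t x : 0 <= s -> s <= t -> t <= T ->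
    rnorm (S t x - S s x) <= M * rnorm (S (t - s) x - x).
  move=> s0 st tT; have ts : 0 <= t - s by rewrite subr_ge0.
  have {1}-> : t = s + (t - s) by rewrite addrC subrK.
  rewrite (semigroupD _ s0 ts).
  rewrite -(lin_mapB (semigroup_lin s0)); apply: SM => //.
  exact: le_trans tT.
move=> s t x /andP[s0 sT] /andP[t0 tT]; have [st|ts] := leP s t.
  by rewrite rnorm_distC distrC ger0_norm ?subr_ge0//; exact: h.
by rewrite gtr0_norm ?subr_gt0//; apply: h => //; exact: ltW.
Qed.

Lemma semigroup_continuous t x e : 0 <= t -> 0 < e -> exists2 d, 0 < d &
  forall s, 0 <= s -> `|s - t| < d -> rnorm (S s x - S t x) < e.
Proof.
move=> t0 e0; have [M M0 SM] := semigroup_dist (t + 1).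
have [d d0 dP] := semigroup_near0 x (divr_gt0 e0 M0).
exists (Num.min d 1) => [|s s0]; first by rewrite lt_min d0 ltr01.
rewrite lt_min => /andP[sd s1].
have sT : s <= t + 1 by move: s1; rewrite ltr_norml; lra.
apply: (le_lt_trans (SM _ _ _ _ _)); rewrite ?s0 ?t0//=; first by lra.
by rewrite mulrC -ltr_pdivlMr//; exact: dP.
Qed.

End semigroup.

(** * Differential inequalities with one-sided increments *)

Section gronwall.
Variable R : realType.
Implicit Types (G : R -> R) (a b t : R).

Lemma at_leftP_lt (P : R -> Prop) c :
  (\forall s \near c^'-, P s) -> exists2 d, 0 < d & forall s, c - d < s -> s < c -> P s.
Proof.
move=> [d /= d0 dP]; exists d => // s sd sc; apply: dP => //=.
by rewrite gtr0_norm ?subr_gt0//; lra.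
Qed.

(** A supremum replaces the mean value theorem: the supremum of the points where
    [G t <= G a + e * (t - a)] belongs to this set by left continuity, and the estimate to its right
    moves it further unless it is [b]. *)
Lemma dini_nonincreasing G a b : a <= b ->
  (forall c, a < c -> c <= b -> G t @[t --> c^'-] --> G c) ->
  (forall t e, a <= t -> t < b -> 0 < e ->
     \forall h \near 0^'+, G (t + h) <= G t + e * h) ->
  G b <= G a.
Proof.
move=> ab Gl Gr.
suff Ge e : 0 < e -> G b <= G a + e * (b - a).
  apply/ler_addgt0Pr => e e0.
  have d0 : 0 < b - a + 1 by lra.
  apply: (le_trans (Ge (e / (b - a + 1)) _)); first by rewrite divr_gt0.
  rewrite lerD2l mulrAC ler_pdivrMr// ler_pM2l//; lra.
move=> e0.
pose E := [set t | a <= t /\ t <= b /\ G t <= G a + e * (t - a)].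
have Ea : E a by split=> //; split=> //; rewrite subrr mulr0 addr0.
have Eb : has_ubound E by exists b => t [_ []].
have supE : has_sup E by split; [exists a|].
pose c := sup E.
have ac : a <= c by exact: ub_le_sup.
have cb : c <= b by apply: ge_sup; [exists a|move=> t [_ []]].
have Ec : G c <= G a + e * (c - a).
  have [->|ac'] := eqVneq c a; first by rewrite subrr mulr0 addr0.
  have {}ac' : a < c by rewrite lt_neqAle eq_sym ac'.
  apply/ler_addgt0Pr => n n0.
  have /cvgrPdist_lt /(_ _ n0) /at_leftP_lt[d d0 dP] := Gl c ac' cb.
  have [t [at_ [tb Gt]] ct] := sup_adherent d0 supE.
  have tc : t <= c by apply: ub_le_sup.
  have [->|tc'] := eqVneq c t; first by lra.
  have {}tc' : t < c by rewrite lt_neqAle eq_sym tc'.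
  have := dP t ct tc'; rewrite ltr_norml => /andP[_ h].
  have : e * (t - a) <= e * (c - a) by rewrite ler_pM2l//; lra.
  lra.
have [<-//|cb'] := eqVneq c b.
have {}cb' : c < b by rewrite lt_neqAle cb'.
have /at_right0P[d d0 dP] := Gr c e ac cb' e0.
pose h := Num.min (d / 2) (b - c).
have h0 : 0 < h by rewrite lt_min divr_gt0// subr_gt0.
have hd : h < d by rewrite gt_min; apply/orP; left; lra.
have hb : h <= b - c by rewrite ge_min lexx orbT.
have : c + h <= c.
  apply: ub_le_sup => //; split; first by lra.
  split; first by lra.
  by apply: (le_trans (dP h h0 hd)); lra.
lra.
Qed.

(** The function [expR (- (kappa * t)) * G t - beta * t] does not increase, because $e^{-\kappa
    h}(1+\kappa h)\le 1$ and [G] is nonnegative. *)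
Lemma gronwall G T kappa beta : 0 <= T -> 0 <= kappa -> 0 <= beta ->
  (forall t, 0 <= t -> t <= T -> 0 <= G t) ->
  (forall c, 0 < c -> c <= T -> G t @[t --> c^'-] --> G c) ->
  (forall t e, 0 <= t -> t < T -> 0 < e ->
     \forall h \near 0^'+, G (t + h) <= G t + h * (kappa * G t + beta + e)) ->
  G T <= expR (kappa * T) * (G 0 + beta * T).
Proof.
move=> T0 k0 b0 G0 Gl Gr.
pose W t := expR (- (kappa * t)) * G t - beta * t.
suff : W T <= W 0.
  rewrite /W !mulr0 oppr0 expR0 mul1r addr0 lerBlDr expRN mulrC.
  by rewrite ler_pdivrMr ?expR_gt0// mulrC.
apply: dini_nonincreasing => // [c c0 cT|t e t0 tT e0].
- apply: cvgB; last first.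
    by apply: cvgMr; apply: cvg_at_left_filter; exact: cvg_id.
  apply: cvgM; last exact: Gl.
  apply: (@cvg_comp _ _ _ (fun t => - (kappa * t)) expR _ (nbhs (- (kappa * c)))).
    apply: cvgN; apply: cvgMr.
    by apply: cvg_at_left_filter; exact: cvg_id.
  exact: continuous_expR.
- near=> h.
  have hp : 0 < h by near: h; exact: nbhs_right_gt.
  have Gh : G (t + h) <= G t + h * (kappa * G t + beta + e).
    by near: h; exact: Gr.
  have Gt : 0 <= G t by apply: G0 => //; exact: ltW.
  rewrite /W !mulrDr opprD expRD.
  set u := expR (- (kappa * t)); set v := expR (- (kappa * h)).
  have u1 : u <= 1 by rewrite -expR0 ler_expR oppr_le0 mulr_ge0.
  have u0 : 0 < u by exact: expR_gt0.
  have v0 : 0 < v by exact: expR_gt0.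
  have kh : 0 <= kappa * h by rewrite mulr_ge0// ltW.
  have v1 : v * (1 + kappa * h) <= 1.
    rewrite /v expRN mulrC ler_pdivrMr ?expR_gt0// mul1r.
    exact: expR_ge1Dx.
  have v1' : v <= 1 by rewrite -expR0 ler_expR oppr_le0.
  have hbe : 0 <= h * (beta + e).
    by apply: mulr_ge0; [exact: ltW|apply: addr_ge0 => //; exact: ltW].
  have h1 : v * G (t + h) <= G t + h * (beta + e).
    apply: (le_trans (ler_wpM2l (ltW v0) Gh)).
    have -> : v * (G t + h * (kappa * G t + beta + e)) =
        v * (1 + kappa * h) * G t + v * (h * (beta + e)) by ring.
    apply: lerD; first by rewrite ler_piMl.
    by rewrite ler_piMl.
  have h2 : u * (v * G (t + h)) <= u * G t + h * (beta + e).
    apply: (le_trans (ler_wpM2l (ltW u0) h1)); rewrite mulrDr lerD2l.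
    by rewrite ler_piMl.
  rewrite -mulrA; lra.
Unshelve. all: by end_near.
Qed.

End gronwall.

Lemma cvg_sqr (R : realType) {T : Type} {F : set_system T} {FF : Filter F}
    (f : T -> R) (a : R) : f @ F --> a -> f t ^+ 2 @[t --> F] --> a ^+ 2.
Proof. by move=> fa; rewrite expr2; under eq_fun do rewrite expr2; exact: cvgM. Qed.

(** * Generators, energy estimates and symmetry *)

Section generator.
Variables (R : realType) (k : scalar_kind).
Variable H : completeNormedModType (scalar_field R k).
Variable ip : {dot H for scalar_conj k}.
Hypothesis ip_norm : forall x, ip x x = `|x| ^+ 2.

(** Polarization reduces the claim to the convergence of norms. *)
Lemma cvg_rip {T : Type} {F : set_system T} {FF : Filter F} (f g : T -> H) a b :
  f @ F --> a -> g @ F --> b -> rip ip (f t) (g t) @[t --> F] --> rip ip a b.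
Proof.
move=> fa gb.
have ripE x y : rip ip x y = 2^-1 * (rnorm (x + y) ^+ 2 - rnorm x ^+ 2 - rnorm y ^+ 2).
  by rewrite (rnormD_sqr ip_norm); field.
rewrite ripE (_ : (fun t => rip ip (f t) (g t)) = fun t =>
  2^-1 * (rnorm (f t + g t) ^+ 2 - rnorm (f t) ^+ 2 - rnorm (g t) ^+ 2)); last first.
  by apply/funext => t; exact: ripE.
apply: cvgMr; apply: cvgB; last by apply: cvg_sqr; exact: cvg_rnorm.
apply: cvgB; apply: cvg_sqr; apply: cvg_rnorm => //.
exact: cvgD.
Qed.

Lemma rnorm_sqr_right_deriv (X : R -> H) t V e : 0 < e ->
  h^-1 %* (X (t + h) - X t) @[h --> 0^'+] --> V ->
  \forall h \near 0^'+,
    rnorm (X (t + h)) ^+ 2 <= rnorm (X t) ^+ 2 + h * (2 * rip ip (X t) V + e).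
Proof.
move=> e0 XV.
have : 2 * rip ip (X t) (h^-1 %* (X (t + h) - X t))
    + h * rnorm (h^-1 %* (X (t + h) - X t)) ^+ 2 @[h --> 0^'+] -->
    2 * rip ip (X t) V + 0 * rnorm V ^+ 2.
  apply: cvgD; first by apply: cvgMr; apply: cvg_rip => //; exact: cvg_cst.
  apply: cvgM; last by apply: cvg_sqr; exact: cvg_rnorm.
  by apply: cvg_at_right_filter; exact: cvg_id.
rewrite mul0r addr0 => /cvgrPdist_lt /(_ _ e0).
apply: filterS2 (nbhs_right_gt (0 : R)) => h h0.
set D := _ %* _; rewrite distrC => /ltW/ler_normlW hD.
have -> : X (t + h) = X t + h %* D.
  by rewrite /D scalerA -of_realM divff ?gt_eqF// of_real1 scale1r [RHS]addrC subrK.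
rewrite (rnormD_sqr ip_norm) ripZr rnormZ gtr0_norm// exprMn.
rewrite -addrA lerD2l.
have -> : 2 * (h * rip ip (X t) D) + h ^+ 2 * rnorm D ^+ 2 =
  h * (2 * rip ip (X t) D + h * rnorm D ^+ 2) by ring.
by rewrite ler_pM2l//; lra.
Qed.

(** Energy estimate under the regularity that is at hand for orbits starting in the domain: a right
    derivative, and continuity from the left. *)
Lemma evolution_bound (X : R -> H) T kappa beta : 0 <= T -> 0 <= kappa -> 0 <= beta ->
  (forall c, 0 < c -> c <= T -> X t @[t --> c^'-] --> X c) ->
  (forall t, 0 <= t -> t < T -> exists2 V,
    h^-1 %* (X (t + h) - X t) @[h --> 0^'+] --> V &
    2 * rip ip (X t) V <= kappa * rnorm (X t) ^+ 2 + beta) ->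
  rnorm (X T) ^+ 2 <= expR (kappa * T) * (rnorm (X 0) ^+ 2 + beta * T).
Proof.
move=> T0 k0 b0 Xl Xr.
apply: (@gronwall _ (fun t => rnorm (X t) ^+ 2)) => // [t _ _|c c0 cT|t e t0 tT e0].
- exact: sqr_ge0.
- by apply: cvg_sqr; apply: cvg_rnorm; exact: Xl.
- have [V XV Vk] := Xr t t0 tT.
  have := rnorm_sqr_right_deriv e0 XV.
  apply: filterS2 (nbhs_right_gt (0 : R)) => h h0 /le_trans; apply.
  by rewrite lerD2l ler_pM2l// lerD2r.
Qed.

Section generated.
Variables (A : operator H) (S : R -> H -> H).
Hypothesis S_gen : generates A S.

Let S_C0 := S_gen.1.

Lemma orbit_left (x : H) t : 0 < t -> S s x @[s --> t^'-] --> S t x.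
Proof.
move=> t0; apply/cvg_rnormP/cvgr0Pnorm_lt => e e0.
have [d d0 dP] := semigroup_continuous S_C0 x (ltW t0) e0.
near=> s.
have s0 : 0 < s by near: s; exact: nbhs_left_gt.
have st : s < t by near: s; exact: nbhs_left_lt.
have sd : t - d < s by near: s; apply: nbhs_left_gt; lra.
rewrite ger0_norm//; apply: dP; first exact: ltW.
by rewrite ltr0_norm ?subr_lt0//; lra.
Unshelve. all: by end_near.
Qed.

Lemma generator_dom t x : 0 <= t -> op_dom A x ->
  op_dom A (S t x) /\ A (S t x) = S t (A x).
Proof.
move=> t0 Dx; apply/(S_gen.2 (S t x) (S t (A x))).
have /(S_gen.2 x (A x)) xA : op_dom A x /\ A x = A x by [].
have St := semigroup_cont S_C0 t0 (x := A x).
have := cvg_comp _ _ xA St; apply: cvg_trans; apply: near_eq_cvg.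
apply: filterS (nbhs_right_gt (0 : R)) => h /ltW h0 /=.
rewrite (lin_mapZ (semigroup_lin S_C0 t0)) (lin_mapB (semigroup_lin S_C0 t0)).
by rewrite -!(semigroupD S_C0)// (addrC h).
Qed.

Lemma generator_deriv t x : 0 <= t -> op_dom A x ->
  h^-1 %* (S (t + h) x - S t x) @[h --> 0^'+] --> A (S t x).
Proof.
move=> t0 Dx; have [Dt _] := generator_dom t0 Dx.
have /(S_gen.2 (S t x)) : op_dom A (S t x) /\ A (S t x) = A (S t x) by [].
apply: cvg_trans; apply: near_eq_cvg.
apply: filterS (nbhs_right_gt (0 : R)) => h /ltW h0 /=.
by rewrite -(semigroupD S_C0)// (addrC h).
Qed.

End generated.

Lemma dense_lipschitz_bound (D : set H) (f : H -> H) M C : dense D ->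
  (forall x y, rnorm (f x - f y) <= M * rnorm (x - y)) -> 0 <= M -> 0 <= C ->
  (forall x, D x -> rnorm (f x) <= C * rnorm x) ->
  forall x, rnorm (f x) <= C * rnorm x.
Proof.
move=> dD fM M0 C0 fC x; apply/ler_addgt0Pr => e e0.
have d0 : 0 < C + M + 1 by lra.
have [y Dy xy] := dense_rnorm x dD (divr_gt0 e0 d0).
have h1 : rnorm (f x) <= C * rnorm y + M * rnorm (y - x).
  apply: (le_trans (rnorm_le_dist _ (f y))); apply: lerD; first exact: fC.
  by rewrite rnorm_distC; exact: fM.
have h2 := ler_wpM2l C0 (rnorm_le_dist y x).
have h3 : (C + M + 1) * rnorm (y - x) <= e by rewrite mulrC -ler_pdivlMr// ltW.
have := rnorm_ge0 (y - x); lra.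
Qed.

Lemma dense_lipschitz_eq0 (D : set H) (phi : H -> R) M : dense D -> 0 <= M ->
  (forall x y, `|phi x - phi y| <= M * rnorm (x - y)) ->
  (forall x, D x -> phi x = 0) -> forall x, phi x = 0.
Proof.
move=> dD M0 phiM phi0 x; apply/eqP; rewrite -normr_le0.
apply/ler_addgt0Pr => e e0; rewrite add0r.
have M1 : 0 < M + 1 by lra.
have [y Dy xy] := dense_rnorm x dD (divr_gt0 e0 M1).
have := phiM x y; rewrite (phi0 y Dy) subr0 rnorm_distC => /le_trans; apply.
have : (M + 1) * rnorm (y - x) <= e by rewrite mulrC -ler_pdivlMr// ltW.
have := rnorm_ge0 (y - x); lra.
Qed.

Section growth.
Variables (A : operator H) (S : R -> H -> H).
Hypotheses (S_gen : generates A S) (A_dense : dense (op_dom A)).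

(** On the domain the squared norm grows at rate at most [2 * c], and density extends the bound. The
    constant depends on [A] only through [c]. *)
Lemma semigroup_growth (c : R) T x : 0 <= T -> 0 <= c ->
  (forall x, op_dom A x -> rip ip (A x) x <= c * rnorm x ^+ 2) ->
  rnorm (S T x) <= expR (c * T) * rnorm x.
Proof.
move=> T0 c0 Ac; have S_C0 := S_gen.1.
have [M M0 SM] := semigroup_bounded S_C0 T.
move: x; apply: (dense_lipschitz_bound A_dense (M := M)) => //.
- move=> x y; rewrite -(lin_mapB (semigroup_lin S_C0 T0)); exact: SM.
- exact: ltW.
move=> y Dy.
have Ey : 0 <= expR (c * T) * rnorm y by rewrite mulr_ge0// expR_ge0.
rewrite -(@ler_pXn2r _ 2)// ?nnegrE// exprMn.
have := @evolution_bound (fun t => S t y) T (2 * c) 0 T0.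
rewrite mul0r addr0 semigroup0//.
have -> : expR (c * T) ^+ 2 = expR (2 * c * T).
  by rewrite expr2 -expRD; congr expR; ring.
apply=> //; first exact: mulr_ge0.
  by move=> t t0 _; exact: (orbit_left S_gen).
move=> t t0 tT; exists (A (S t y)); first exact: (generator_deriv S_gen).
rewrite addr0 -mulrA ler_pM2l// ripC; apply: Ac.
by have [] := generator_dom S_gen t0 Dy.
Qed.

End growth.

Section symmetric_generator.
Variables (A : operator H) (S : R -> H -> H).
Hypotheses (S_gen : generates A S) (A_sym : op_symmetric ip A).
Hypothesis A_dense : dense (op_dom A).
Let S_C0 := S_gen.1.

(** Joint continuity in time and vector, for the second factor of $\langle S_sx,S_{t-s}y\rangle$ as
    [s] increases. *)
Lemma semigroup_right_sub t (z : R -> H) z0 : 0 < t ->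
  z h @[h --> 0^'+] --> z0 -> S (t - h) (z h) @[h --> 0^'+] --> S t z0.
Proof.
move=> t0 /cvg_rnormP/cvgr0Pnorm_lt zz; apply/cvg_rnormP/cvgr0Pnorm_lt => e e0.
have [M M0 SM] := semigroup_bounded S_C0 t.
have e2 : 0 < e / 2 by rewrite divr_gt0.
have [d d0 dP] := semigroup_continuous S_C0 z0 (ltW t0) e2.
have zM := zz _ (divr_gt0 e2 M0).
near=> h.
have h0 : 0 < h by near: h; exact: nbhs_right_gt.
have ht : h < t by near: h; exact: nbhs_right_lt.
have hd : h < d by near: h; exact: nbhs_right_lt.
have zh : `|rnorm (z h - z0)| < e / 2 / M by near: h; exact: zM.
rewrite ger0_norm// in zh; rewrite ger0_norm//.
have th0 : 0 <= t - h by rewrite subr_ge0 ltW.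
apply: (le_lt_trans (rnorm_distD (S (t - h) z0) _ _)).
rewrite [ltRHS](splitr e); apply: ltrD.
  rewrite -(lin_mapB (semigroup_lin S_C0 th0)).
  apply: (@le_lt_trans _ _ (M * rnorm (z h - z0))); last by rewrite mulrC -ltr_pdivlMr.
  by apply: SM => //; lra.
by apply: dP => //; rewrite addrAC subrr sub0r normrN gtr0_norm.
Unshelve. all: by end_near.
Qed.

Lemma semigroup_left_sub t c (x : H) : 0 < c -> c <= t ->
  S (t - s) x @[s --> c^'-] --> S (t - c) x.
Proof.
move=> c0 ct; apply/cvg_rnormP/cvgr0Pnorm_lt => e e0.
have tc0 : 0 <= t - c by rewrite subr_ge0.
have [d d0 dP] := semigroup_continuous S_C0 x tc0 e0.
near=> s.
have sc : s < c by near: s; exact: nbhs_left_lt.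
have sd : c - d < s by near: s; apply: nbhs_left_gt; lra.
rewrite ger0_norm//; apply: dP; first by lra.
by rewrite ger0_norm; lra.
Unshelve. all: by end_near.
Qed.

(** The function $s\mapsto\langle S_sx,S_{t-s}y\rangle$ has right derivative $\langle
    AS_sx,S_{t-s}y\rangle-\langle S_sx,AS_{t-s}y\rangle=0$, so it does not increase from 0 to [t].
    Exchanging [x] and [y] turns the inequality into equality. *)
Lemma semigroup_symmetric_le t x y : 0 <= t -> op_dom A x -> op_dom A y ->
  rip ip (S t x) y <= rip ip x (S t y).
Proof.
move=> t0 Dx Dy.
have := @dini_nonincreasing _ (fun s => rip ip (S s x) (S (t - s) y)) 0 t t0.
rewrite subrr subr0 !semigroup0//; apply=> [c c0 ct|s e s0 st e0].
  by apply: cvg_rip; [exact: (orbit_left S_gen)|exact: semigroup_left_sub].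
have ts : 0 < t - s by rewrite subr_gt0.
(* The difference quotient of the product, with [S (t - s) y] written as [S (t - s - h) (S h y)]. *)
have lim : rip ip (h^-1 %* (S (s + h) x - S s x)) (S (t - s - h) y)
    - rip ip (S s x) (S (t - s - h) (h^-1 %* (S h y - y))) @[h --> 0^'+] -->
    rip ip (A (S s x)) (S (t - s) y) - rip ip (S s x) (S (t - s) (A y)).
  apply: cvgB; apply: cvg_rip.
  - exact: (generator_deriv S_gen).
  - by apply: semigroup_right_sub => //; exact: cvg_cst.
  - exact: cvg_cst.
  - by apply: semigroup_right_sub => //; apply/(S_gen.2 y (A y)).
have [Dsx _] := generator_dom S_gen s0 Dx.
have [Dty Ety] := generator_dom S_gen (ltW ts) Dy.
have lim0 : rip ip (A (S s x)) (S (t - s) y) - rip ip (S s x) (A (S (t - s) y)) = 0.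
  by rewrite /rip (A_sym Dsx Dty) subrr.
move: lim; rewrite -Ety lim0 => /cvgr0Pnorm_lt /(_ _ e0) near_lim.
near=> h.
have h0 : 0 < h by near: h; exact: nbhs_right_gt.
have hts : h < t - s by near: h; exact: nbhs_right_lt.
have : `|rip ip (h^-1 %* (S (s + h) x - S s x)) (S (t - s - h) y)
    - rip ip (S s x) (S (t - s - h) (h^-1 %* (S h y - y)))| < e.
  by near: h; exact: near_lim.
have tsh : 0 <= t - s - h by lra.
move=> /ltW/ler_normlW.
rewrite (lin_mapZ (semigroup_lin S_C0 tsh)) ripZl ripZr -mulrBr.
rewrite (lin_mapB (semigroup_lin S_C0 tsh)) -(semigroupD S_C0 _ tsh (ltW h0)).
rewrite subrK mulrC ler_pdivrMr// ripBl ripBr.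
rewrite (_ : t - (s + h) = t - s - h); last by rewrite opprD addrA.
lra.
Unshelve. all: by end_near.
Qed.

Lemma semigroup_symmetric t x y : 0 <= t -> rip ip (S t x) y = rip ip x (S t y).
Proof.
move=> t0.
have Deq u v : op_dom A u -> op_dom A v -> rip ip (S t u) v = rip ip u (S t v).
  move=> Du Dv; apply/eqP; rewrite eq_le semigroup_symmetric_le//=.
  by rewrite ripC [leRHS]ripC semigroup_symmetric_le.
have [M M0 SM] := semigroup_bounded S_C0 t.
have SB u : rnorm (S t u) <= M * rnorm u by apply: SM.
have D1 v : op_dom A v -> forall u, rip ip (S t u) v - rip ip u (S t v) = 0.
  move=> Dv; apply: (dense_lipschitz_eq0 A_dense (M := 2 * M * rnorm v)) => [|u u'|u Du].
  - by rewrite mulr_ge0// mulr_ge0// ltW.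
  - rewrite subr_interchange -!ripBl -(lin_mapB (semigroup_lin S_C0 t0)).
    apply: (le_trans (ler_normB _ _)).
    have := rip_abs ip_norm (S t (u - u')) v; have := rip_abs ip_norm (u - u') (S t v).
    have := ler_wpM2r (rnorm_ge0 v) (SB (u - u')).
    have := ler_wpM2l (rnorm_ge0 (u - u')) (SB v).
    lra.
  - by rewrite Deq// subrr.
apply/eqP; rewrite -subr_eq0; apply/eqP.
apply: (dense_lipschitz_eq0 A_dense (M := 2 * M * rnorm x)
  (phi := fun v => rip ip (S t x) v - rip ip x (S t v))) => [|u u'|v Dv].
- by rewrite mulr_ge0// mulr_ge0// ltW.
- rewrite subr_interchange -!ripBr -(lin_mapB (semigroup_lin S_C0 t0)).
  apply: (le_trans (ler_normB _ _)).
  have := rip_abs ip_norm (S t x) (u - u'); have := rip_abs ip_norm x (S t (u - u')).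
  have := ler_wpM2l (rnorm_ge0 x) (SB (u - u')).
  have := ler_wpM2r (rnorm_ge0 (u - u')) (SB x).
  lra.
- exact: D1.
Qed.

(** Halving time: [S t x = 0] gives [|S (t / 2) x|^2 = <S t x, x> = 0]. *)
Lemma semigroup_injective t x : 0 <= t -> S t x = 0 -> x = 0.
Proof.
move=> t0 Stx.
have Sn n : S (t / 2 ^+ n) x = 0.
  elim: n => [|n IH]; first by rewrite expr0 divr1.
  have tn : 0 <= t / 2 ^+ n.+1 by rewrite divr_ge0// exprn_ge0.
  apply: rnorm0_eq0; apply/eqP; rewrite -sqrf_eq0 -(ripxx ip_norm).
  rewrite semigroup_symmetric// -(semigroupD S_C0)//.
  rewrite (_ : _ + _ = t / 2 ^+ n) ?IH ?rip0r//.
  by rewrite exprS; field; rewrite expf_neq0// pnatr_eq0.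
apply: rnorm0_eq0; apply/eqP; rewrite eq_le rnorm_ge0 andbT.
apply/ler_addgt0Pr => e e0; rewrite add0r.
have [d d0 dP] := semigroup_near0 S_C0 x e0.
have [n nd] : exists n, t / 2 ^+ n < d.
  have : t * (2^-1 : R) ^+ n @[n --> \oo] --> t * 0.
    by apply: cvgMr; apply: cvg_expr; rewrite gtr0_norm ?invr_gt0// invf_lt1// ltr1n.
  rewrite mulr0 => /cvgr0Pnorm_lt /(_ _ d0) [n _ /(_ n (leqnn n)) h]; exists n.
  by rewrite -exprVn; exact: le_lt_trans (ler_norm _) h.
have tn : 0 <= t / 2 ^+ n by rewrite divr_ge0// exprn_ge0.
by have := dP _ tn nd; rewrite Sn sub0r rnormN => /ltW.
Qed.

(** A vector orthogonal to the range of [S t] satisfies $\|S_tx\|^2=\langle x,S_tS_tx\rangle=0$ and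
    vanishes by injectivity. This later supplies a descent direction for an active constraint. *)
Lemma semigroup_range_dense t x : 0 <= t -> x <> 0 -> exists y, rip ip x (S t y) != 0.
Proof.
move=> t0 x0; apply: contrapT => h; apply: x0; apply: (semigroup_injective t0).
apply: rnorm0_eq0; apply/eqP; rewrite -sqrf_eq0 -(ripxx ip_norm).
rewrite semigroup_symmetric//; apply/negP => h'; apply: h; exists (S t x).
exact/negP.
Qed.

End symmetric_generator.

(** * Comparison of the two semigroups *)

Section perturbed_semigroup.
Variables (A B : operator H) (S Sd : R -> H -> H) (c nu : R).
Hypotheses (A_lin : op_linear A).
Hypotheses (S_gen : generates A S) (Sd_gen : generates (op_add A B) Sd).
Hypothesis AB_dense : dense (op_dom (op_add A B)).
Hypotheses (c_ge0 : 0 <= c) (nu_ge0 : 0 <= nu) (nu_le1 : nu <= 1).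
Hypothesis A_le : forall x, op_dom A x -> rip ip (A x) x <= c * rnorm x ^+ 2.
Hypothesis B_le : forall x, op_dom (op_add A B) x -> rnorm (B x) <= 4 * nu * rnorm x.

(** The perturbation raises the upper bound of [A] by at most [4 * nu <= 4]. *)
Lemma perturbed_growth T x : 0 <= T ->
  rnorm (Sd T x) <= expR ((c + 4) * T) * rnorm x.
Proof.
move=> T0; apply: (semigroup_growth Sd_gen AB_dense) => //.
  by have := c_ge0; lra.
move=> y Dy; rewrite /= ripDl mulrDl lerD//; first exact: A_le Dy.1.
apply: (le_trans (rip_le ip_norm _ _)).
have := ler_wpM2r (rnorm_ge0 y) (B_le Dy).
have : nu * rnorm y ^+ 2 <= rnorm y ^+ 2.
  by rewrite ler_piMl// ?sqr_ge0.
rewrite expr2; lra.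
Qed.

(** For [q] in the domain of [op_add A B] the difference of the orbits solves $e'=Ae+B\,S^\delta q$
    with $e(0)=0$. By Young's inequality $2\langle e,e'\rangle\le(2c+1)\|e\|^2+(4\nu N)^2$, where
    [N] bounds the perturbed orbit; the energy estimate and a square root give order [nu]. *)
Lemma semigroup_perturbation t T x : 0 <= t -> t <= T ->
  rnorm (Sd t x - S t x) <=
    4 * (1 + T) * expR ((c + 1) * T) * expR ((c + 4) * T) * nu * rnorm x.
Proof.
move=> t0 tT; have c0 := c_ge0; have n0 := nu_ge0.
have S_C0 := S_gen.1; have Sd_C0 := Sd_gen.1.
have T0 : 0 <= T by exact: le_trans tT.
set e1 := expR ((c + 1) * T); set e2 := expR ((c + 4) * T).
have e1_gt0 : 0 < e1 by exact: expR_gt0.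
have e2_gt0 : 0 < e2 by exact: expR_gt0.
pose C := 4 * (1 + T) * e1 * e2 * nu; rewrite -/C.
have C0 : 0 <= C.
  apply: mulr_ge0 => //; apply: mulr_ge0; last exact: ltW.
  apply: mulr_ge0; last exact: ltW.
  by apply: mulr_ge0 => //; apply: addr_ge0.
have [M M0 SM] := semigroup_bounded S_C0 t.
have [Md Md0 SdM] := semigroup_bounded Sd_C0 t.
move: x; apply: (dense_lipschitz_bound AB_dense (M := Md + M)) => //.
- move=> x y; rewrite subr_interchange.
  rewrite -(lin_mapB (semigroup_lin S_C0 t0)) -(lin_mapB (semigroup_lin Sd_C0 t0)).
  apply: (le_trans (rnormB _ _)); rewrite mulrDl lerD//; first exact: SdM.
  exact: SM.
- by rewrite addr_ge0// ltW.
move=> q Dq.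
pose N := e2 * rnorm q.
have N0 : 0 <= N by rewrite mulr_ge0// ltW.
have Sdq s : 0 <= s -> s <= t -> rnorm (Sd s q) <= N.
  move=> s0 st; apply: (le_trans (perturbed_growth q s0)).
  by rewrite ler_wpM2r// ler_expR ler_wpM2l//; lra.
have Cq : 0 <= C * rnorm q by rewrite mulr_ge0.
rewrite -(@ler_pXn2r _ 2)// ?nnegrE//.
have := @evolution_bound (fun s => Sd s q - S s q) t (2 * c + 1) (16 * nu ^+ 2 * N ^+ 2) t0.
rewrite !semigroup0// subrr rnorm0 expr0n => h.
apply: (le_trans (h _ _ _ _)).
- lra.
- apply: mulr_ge0; last exact: sqr_ge0.
  by apply: mulr_ge0 => //; exact: sqr_ge0.
- by move=> s s0 _; apply: cvgB; [exact: (orbit_left Sd_gen)|exact: (orbit_left S_gen)].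
- move=> s s0 st.
  have [Ds _] := generator_dom Sd_gen s0 Dq.
  have [Ds' _] := generator_dom S_gen s0 Dq.1.
  exists (op_add A B (Sd s q) - A (S s q)).
    under eq_fun do rewrite subr_interchange scalerBr.
    by apply: cvgB; [exact: (generator_deriv Sd_gen)|exact: (generator_deriv S_gen s0 Dq.1)].
  set e := Sd s q - S s q.
  have [De Ae] := op_linearB A_lin Ds.1 Ds'.
  have -> : op_add A B (Sd s q) - A (S s q) = A e + B (Sd s q).
    by rewrite Ae /= addrAC.
  have h1 := A_le De; rewrite -/e in h1.
  have h2 : rip ip e (B (Sd s q)) <= rnorm e * (4 * nu * N).
    apply: (le_trans (rip_le ip_norm _ _)); rewrite ler_wpM2l//.
    apply: (le_trans (B_le Ds)); apply: ler_wpM2l; first exact: mulr_ge0.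
    by apply: Sdq => //; exact: ltW.
  rewrite ripDr ripC.
  have := sqr_ge0 (rnorm e - 4 * nu * N); lra.
(* [t] is absorbed into [(1 + T) ^+ 2] and the exponential into [e1 ^+ 2], so that the bound becomes
   a perfect square. *)
rewrite add0r (_ : 16 * nu ^+ 2 * N ^+ 2 * t = t * (4 * nu * N) ^+ 2); last by ring.
have -> : (C * rnorm q) ^+ 2 = e1 ^+ 2 * ((1 + T) ^+ 2 * (4 * nu * N) ^+ 2).
  by rewrite /C /N; ring.
apply: ler_pM.
- exact: expR_ge0.
- by apply: mulr_ge0 => //; exact: sqr_ge0.
- rewrite /e1 expr2 -expRD ler_expR.
  have : (2 * c + 1) * t <= (2 * c + 1) * T by rewrite ler_wpM2l//; lra.
  lra.
- apply: ler_wpM2r; first exact: sqr_ge0.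
  by have := mulr_ge0 T0 T0; rewrite expr2; lra.
Qed.

End perturbed_semigroup.
End generator.

(** * Strong measurability and Bochner integrals *)

Section finitely_valued.
Variable R : realType.
Implicit Types T U V : Type.

(** The condition of [simple] for values in any type, so that real times, truth values of membership
    and vectors can be combined by [finitely_valued2]. *)
Definition finitely_valued T (s : R -> T) :=
  finite_set (range s) /\ forall v, measurable (s @^-1` [set v]).

Lemma finitely_valued2 T U V (F : T -> U -> V) (s : R -> T) (r : R -> U) :
  finitely_valued s -> finitely_valued r ->
  finitely_valued (fun t => F (s t) (r t)).
Proof.
move=> [fs ms] [fr mr]; split.
  apply: (@sub_finite_set _ _ [set F x y | x in range s & y in range r]).
    by move=> _ [t _ <-]; exists (s t); [exists t|exists (r t); [exists t|]].
  exact: finite_image2.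
move=> v.
rewrite (_ : _ @^-1` _ = \bigcup_(p in (range s `*` range r) `&` [set p | F p.1 p.2 = v])
    (s @^-1` [set p.1] `&` r @^-1` [set p.2])).
  apply: fin_bigcup_measurable.
    by apply: finite_setIl; exact: finite_setX.
  by move=> p _; apply: measurableI; [exact: ms|exact: mr].
apply/seteqP; split=> t /=.
  by move=> <-; exists (s t, r t) => //=; split=> //; split; exists t.
by move=> [[x y] /= [_ <-] [-> ->]].
Qed.

Lemma finitely_valued_comp T U (F : T -> U) (s : R -> T) :
  finitely_valued s -> finitely_valued (F \o s).
Proof. by move=> fs; exact: (finitely_valued2 (fun x _ => F x) fs fs). Qed.

Lemma finitely_valued_measurable (s : R -> R) :
  finitely_valued s -> measurable_fun setT s.
Proof.
move=> [fs ms] _ Y _; rewrite setTI.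
rewrite (_ : _ @^-1` _ = \bigcup_(v in range s `&` Y) (s @^-1` [set v])).
  by apply: fin_bigcup_measurable; [exact: finite_setIl|move=> v _; exact: ms].
apply/seteqP; split=> t /=; first by move=> Yt; exists (s t) => //; split=> //; exists t.
by move=> [v [_ Yv] ->].
Qed.

Lemma finitely_valued_bounded (s : R -> R) : finitely_valued s ->
  exists M, forall t, `|s t| <= M.
Proof.
move=> [/finite_seqP[l sl] _].
exists (\sum_(v <- l) `|v|) => t.
have : (range s) (s t) by exists t.
rewrite sl /= => stl; rewrite (big_rem (s t)) //= lerDl.
exact: sumr_ge0.
Qed.

Lemma finitely_valued_if T (A : set R) (x y : T) : measurable A ->
  finitely_valued (fun t => if t \in A then x else y).
Proof.
move=> mA; split.
  apply: (@sub_finite_set _ _ [set x; y]); last exact: finite_set2.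
  by move=> _ [t _ <-]; case: ifPn => _; [left|right].
move=> v; have [->|xv] := pselect (x = v); have [->|yv] := pselect (y = v).
- rewrite (_ : _ @^-1` _ = setT)//; apply/seteqP; split=> // t _ /=; by case: ifP.
- rewrite (_ : _ @^-1` _ = A)//; apply/seteqP; split=> t /=.
    by case: ifPn => [/set_mem//|_ /yv].
  by move=> At; rewrite ifT//; exact: mem_set.
- rewrite (_ : _ @^-1` _ = ~` A); first exact: measurableC.
  apply/seteqP; split=> t /=; first by case: ifPn => [_ /xv//|/negP nA _ At]; apply: nA; exact: mem_set.
  by move=> nA; rewrite ifF//; exact: memNset.
- rewrite (_ : _ @^-1` _ = set0)//; apply/seteqP; split=> // t /=; by case: ifP.
Qed.

Lemma finitely_valued_preim T (s : R -> T) (phi : R -> R) :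
  measurable_fun setT phi -> finitely_valued s -> finitely_valued (s \o phi).
Proof.
move=> mphi [fs ms]; split.
  by apply: sub_finite_set fs => _ [t _ <-]; exists (phi t).
by move=> v; rewrite comp_preimage -[X in measurable X]setTI; exact: mphi.
Qed.

Import HBNNSimple.

(** Approximation from below keeps sampled times nonnegative and never beyond the time that they
    approximate. *)
Lemma finitely_valued_approx (D : set R) (a : R -> R) : measurable D ->
  measurable_fun D a -> (forall t, D t -> 0 <= a t) ->
  exists rho : nat -> R -> R, [/\ forall n, finitely_valued (rho n),
    forall n t, 0 <= rho n t, forall n t, D t -> rho n t <= a t &
    forall t, D t -> rho n t @[n --> \oo] --> a t].
Proof.
move=> mD ma a0.
have ma' : measurable_fun D (fun t => (a t)%:E) by exact/measurable_EFinP.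
have [g [gnd ga]] := approximation mD ma' (fun t Dt => a0 t Dt).
have ga' t : D t -> g n t @[n --> \oo] --> a t.
  by move=> /ga /fine_cvgP [].
exists (fun n => g n : R -> R); split => // n t Dt.
have gt : nondecreasing_seq (fun n => g n t).
  by move=> m n' mn; have /lefP := gnd m n' mn; apply.
rewrite -(cvg_lim _ (ga' t Dt))//; apply: nondecreasing_cvgn_le => //.
by apply/cvg_ex; exists (a t); exact: ga'.
Qed.

End finitely_valued.

Section strong_measurability.
Variables (R : realType) (k : scalar_kind).
Variable H : completeNormedModType (scalar_field R k).
Variable ip : {dot H for scalar_conj k}.
Hypothesis ip_norm : forall x, ip x x = `|x| ^+ 2.
Implicit Types (D : set R) (g : R -> H).

Lemma strongly_measurable2 D (F : H -> H -> H) g1 g2 :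
  strongly_measurable D g1 -> strongly_measurable D g2 ->
  (forall t, D t -> forall u v : nat -> H,
    u n @[n --> \oo] --> g1 t -> v n @[n --> \oo] --> g2 t ->
    F (u n) (v n) @[n --> \oo] --> F (g1 t) (g2 t)) ->
  strongly_measurable D (fun t => F (g1 t) (g2 t)).
Proof.
move=> [s1 [fs1 s1g]] [s2 [fs2 s2g]] Fc.
exists (fun n t => F (s1 n t) (s2 n t)); split.
  by move=> n; exact: (finitely_valued2 F (fs1 n) (fs2 n)).
by move=> t Dt; apply: Fc => //; [exact: s1g|exact: s2g].
Qed.

Lemma strongly_measurableD D g1 g2 :
  strongly_measurable D g1 -> strongly_measurable D g2 ->
  strongly_measurable D (fun t => g1 t + g2 t).
Proof. by move=> h1 h2; apply: strongly_measurable2 => // t Dt u v; exact: cvgD. Qed.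

Lemma strongly_measurableB D g1 g2 :
  strongly_measurable D g1 -> strongly_measurable D g2 ->
  strongly_measurable D (fun t => g1 t - g2 t).
Proof. by move=> h1 h2; apply: (strongly_measurable2 (F := fun x y => x - y)) => // t Dt u v; exact: cvgB. Qed.

Lemma strongly_measurableS D D' g : D' `<=` D ->
  strongly_measurable D g -> strongly_measurable D' g.
Proof. by move=> DD [s [fs sg]]; exists s; split=> // t /DD; exact: sg. Qed.

Lemma eq_strongly_measurable D g1 g2 : (forall t, D t -> g1 t = g2 t) ->
  strongly_measurable D g1 -> strongly_measurable D g2.
Proof. by move=> e [s [fs sg]]; exists s; split=> // t Dt; rewrite -e//; exact: sg. Qed.

Lemma strongly_measurable_cst D (x : H) : strongly_measurable D (fun=> x).
Proof.
exists (fun _ _ => x); split=> [n|t _]; last exact: cvg_cst.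
split; last by move=> v; rewrite preimage_cst; case: ifP.
by apply: (@sub_finite_set _ _ [set x]) => // _ [t _ <-].
Qed.

Lemma strongly_measurable_if D (A : set R) g : measurable A ->
  strongly_measurable D g ->
  strongly_measurable D (fun t => if t \in A then g t else 0).
Proof.
move=> mA [s [fs sg]].
have fA : finitely_valued (fun t => t \in A).
  rewrite (_ : (fun t => t \in A) = fun t => if t \in A then true else false).
    exact: finitely_valued_if.
  by apply/funext => t; case: ifP.
exists (fun n t => if t \in A then s n t else 0); split=> [n|t Dt].
  exact: (finitely_valued2 (fun (b : bool) (x : H) => if b then x else 0) fA (fs n)).
by case: ifP => _; [exact: sg|exact: cvg_cst].
Qed.

Lemma strongly_measurable_preim D g (phi : R -> R) : measurable_fun setT phi ->
  strongly_measurable D g -> strongly_measurable (phi @^-1` D) (g \o phi).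
Proof.
move=> mphi [s [fs sg]]; exists (fun n => s n \o phi); split=> [n|t /sg//].
exact: (finitely_valued_preim mphi (fs n)).
Qed.

Lemma measurable_rnorm D g : strongly_measurable D g ->
  measurable_fun D (fun t => rnorm (g t)).
Proof.
move=> [s [fs sg]].
apply: (@measurable_fun_cvg _ _ _ _ (fun n t => rnorm (s n t))) => [n|t Dt].
  apply: measurable_funTS; apply: finitely_valued_measurable.
  exact: (finitely_valued_comp (@rnorm R k H) (fs n)).
by apply: cvg_rnorm; exact: sg.
Qed.

Lemma measurable_rip D g1 g2 : strongly_measurable D g1 ->
  strongly_measurable D g2 -> measurable_fun D (fun t => rip ip (g1 t) (g2 t)).
Proof.
move=> [s1 [fs1 s1g]] [s2 [fs2 s2g]].
apply: (@measurable_fun_cvg _ _ _ _ (fun n t => rip ip (s1 n t) (s2 n t))) => [n|t Dt].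
  apply: measurable_funTS; apply: finitely_valued_measurable.
  exact: (finitely_valued2 (rip ip) (fs1 n) (fs2 n)).
by apply: cvg_rip => //; [exact: s1g|exact: s2g].
Qed.

(** Time and vector are both replaced by finitely valued approximations: the bound of [S] on
    [[0, T]] controls the error in the vector, strong continuity that in the time. *)
Lemma strongly_measurable_semigroup (S : R -> H -> H) D (a : R -> R) T g :
  C0_semigroup S -> measurable D -> measurable_fun D a ->
  (forall t, D t -> 0 <= a t <= T) ->
  strongly_measurable D g -> strongly_measurable D (fun t => S (a t) (g t)).
Proof.
move=> S_C0 mD ma aT [s [fs sg]].
have [|rho [frho rho0 rhoa rho_cvg]] := finitely_valued_approx mD ma.
  by move=> t /aT /andP[].
exists (fun n t => S (rho n t) (s n t)); split=> [n|t Dt].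
  exact: (finitely_valued2 S (frho n) (fs n)).
have /andP[at0 atT] := aT t Dt.
have [M M0 SM] := semigroup_bounded S_C0 T.
apply/cvg_rnormP/cvgr0Pnorm_lt => e e0.
have e2 : 0 < e / 2 by rewrite divr_gt0.
have /cvg_rnormP/cvgr0Pnorm_lt/(_ _ (divr_gt0 e2 M0)) near_s := sg t Dt.
have [d d0 dP] := semigroup_continuous S_C0 (g t) at0 e2.
have /cvgrPdist_lt/(_ _ d0) near_rho := rho_cvg t Dt.
near=> n.
have sn : `|rnorm (s n t - g t)| < e / 2 / M by near: n; exact: near_s.
have rn : `|a t - rho n t| < d by near: n; exact: near_rho.
rewrite ger0_norm// in sn; rewrite ger0_norm//.
apply: (le_lt_trans (rnorm_distD (S (rho n t) (g t)) _ _)).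
rewrite [ltRHS](splitr e); apply: ltrD; last by apply: dP => //; rewrite distrC.
rewrite -(lin_mapB (semigroup_lin S_C0 (rho0 n t))).
apply: (@le_lt_trans _ _ (M * rnorm (s n t - g t))); last by rewrite mulrC -ltr_pdivlMr.
by apply: SM => //; apply: le_trans atT; exact: rhoa.
Unshelve. all: by end_near.
Qed.

End strong_measurability.

(** * Integrability and estimates for real integrands *)

Section real_integrals.
Variable R : realType.
Notation mu := (@lebesgue_measure R).
Implicit Types (D : set (measurableTypeR R)) (f g : measurableTypeR R -> R).

Lemma le_intble D f g : measurable D -> measurable_fun D f ->
  (forall t, D t -> `|f t| <= g t) -> mu.-integrable D (EFin \o g) ->
  mu.-integrable D (EFin \o f).
Proof.
move=> mD mf fg ig; apply: le_integrable ig => //; first exact/measurable_EFinP.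
by move=> t Dt /=; rewrite lee_fin (le_trans (fg t Dt))// ler_norm.
Qed.

Lemma intbleD D f g : measurable D -> mu.-integrable D (EFin \o f) ->
  mu.-integrable D (EFin \o g) -> mu.-integrable D (EFin \o (fun t => f t + g t)).
Proof.
by move=> mD fi gi; apply: (eq_integrable mD _ _ _ (integrableD mD fi gi)).
Qed.

Lemma intbleB D f g : measurable D -> mu.-integrable D (EFin \o f) ->
  mu.-integrable D (EFin \o g) -> mu.-integrable D (EFin \o (fun t => f t - g t)).
Proof.
by move=> mD fi gi; apply: (eq_integrable mD _ _ _ (integrableB mD fi gi)).
Qed.

Lemma intbleZ D (c : R) f : measurable D -> mu.-integrable D (EFin \o f) ->
  mu.-integrable D (EFin \o (fun t => c * f t)).
Proof.
by move=> mD fi; apply: (eq_integrable mD _ _ _ (integrableZl mD c fi)).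
Qed.

Lemma intble_cst D (c : R) : measurable D -> (mu D < +oo)%E ->
  mu.-integrable D (EFin \o (fun=> c)).
Proof.
move=> mD fD; apply: measurable_bounded_integrable => //.
exists `|c|; split=> // M cM t _ /=; exact: ltW.
Qed.

Lemma intble_finitely_valued D f : measurable D -> (mu D < +oo)%E ->
  finitely_valued f -> mu.-integrable D (EFin \o f).
Proof.
move=> mD fD ff; have [M fM] := finitely_valued_bounded ff.
apply: (@le_intble _ _ (fun=> M)) => //; last exact: intble_cst.
by apply: measurable_funTS; exact: finitely_valued_measurable.
Qed.

Lemma Rintegral_sum D (I : Type) (s : seq I) (F : I -> measurableTypeR R -> R) : measurable D ->
  (forall i, mu.-integrable D (EFin \o F i)) ->
  mu.-integrable D (EFin \o (fun t => \sum_(i <- s) F i t)) /\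
  \int[mu]_(t in D) (\sum_(i <- s) F i t) = \sum_(i <- s) \int[mu]_(t in D) F i t.
Proof.
move=> mD iF; elim: s => [|i s [IH1 IH2]].
  under [X in EFin \o X]eq_fun do rewrite big_nil; split.
    by apply: (eq_integrable mD _ _ _ (integrable0 _ _)).
  under eq_Rintegral do rewrite big_nil.
  by rewrite big_nil Rintegral_cst// mul0r.
under [X in EFin \o X]eq_fun do rewrite big_cons; split; first exact: intbleD.
under eq_Rintegral do rewrite big_cons.
by rewrite big_cons RintegralD// IH2.
Qed.

Lemma Rintegral_le_cst D f g : measurable D -> measurable_fun D f ->
  (forall t, D t -> `|f t| <= g t) -> mu.-integrable D (EFin \o g) ->
  `|\int[mu]_(t in D) f t| <= \int[mu]_(t in D) g t.
Proof.
move=> mD mf fg ig; have fi := le_intble mD mf fg ig.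
apply: (le_trans (le_normr_Rintegral mD fi)); apply: le_Rintegral => //.
by apply: le_intble ig => //; [exact: measurableT_comp|move=> t Dt; rewrite normr_id fg].
Qed.

End real_integrals.

(** * Existence of the Bochner integral and its pairings *)

Section bochner.
Variables (R : realType) (k : scalar_kind).
Variable H : completeNormedModType (scalar_field R k).
Variable ip : {dot H for scalar_conj k}.
Hypothesis ip_norm : forall x, ip x x = `|x| ^+ 2.
Notation mu := (@lebesgue_measure R).

Lemma rnorm_le_of_rip (x : H) (C : R) : 0 <= C ->
  (forall y, rip ip x y <= C * rnorm y) -> rnorm x <= C.
Proof.
move=> C0 h; have [->//|x0] := eqVneq (rnorm x) 0.
have x_gt0 : 0 < rnorm x by rewrite lt0r x0 rnorm_ge0.
by have := h x; rewrite (ripxx ip_norm) expr2 ler_pM2r.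
Qed.

Section fixed_domain.
Variable D : set (measurableTypeR R).
Hypotheses (mD : measurable D) (fD : (mu D < +oo)%E).
Implicit Types (g : R -> H) (s : R -> H).

Lemma rip_sum (I : Type) (l : seq I) (F : I -> H) y :
  rip ip (\sum_(i <- l) F i) y = \sum_(i <- l) rip ip (F i) y.
Proof.
by apply: (big_morph (fun x => rip ip x y)) => [a b|]; [exact: ripDl|exact: rip0l].
Qed.

(** Pairing with a fixed vector turns vector-valued integrals into real ones, where linearity and
    domination are available. *)
Lemma simple_integral_rip s y : simple s ->
  rip ip (simple_integral D s) y = \int[mu]_(t in D) rip ip (s t) y.
Proof.
move=> ss; have [fs ms] := ss.
rewrite /simple_integral fsbig_finite//= rip_sum.
set l := (X in \sum_(i <- X) _).
have im (v : H) : mu.-integrable D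
    (EFin \o (fun t => rip ip v y * \1_(s @^-1` [set v]) t)).
  apply: intbleZ => //; apply: intble_finitely_valued => //.
  rewrite (_ : \1__ = fun t => if t \in s @^-1` [set v] then 1 else 0).
    exact: finitely_valued_if.
  by apply/funext => t; rewrite indicE; case: ifP.
have [_ sumE] := Rintegral_sum l mD im.
transitivity (\int[mu]_(t in D) \sum_(v <- l) rip ip v y * \1_(s @^-1` [set v]) t).
  rewrite sumE; apply: eq_bigr => v _; rewrite ripZl mulrC RintegralZl//.
    rewrite /Rintegral integral_indic//; last exact: ms.
    by rewrite setIC.
  apply: intble_finitely_valued => //.
  rewrite (_ : \1__ = fun t => if t \in s @^-1` [set v] then 1 else 0).
    exact: finitely_valued_if.
  by apply/funext => t; rewrite indicE; case: ifP.
apply: eq_Rintegral => t _.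
have stl : s t \in l by rewrite in_fset_set// inE; exists t.
rewrite (bigD1_seq _ stl)/=; last exact: finmap.fset_uniq.
rewrite big1 ?addr0 => [|v vs].
  by rewrite indicE mem_set// mulr1.
by rewrite indicE memNset ?mulr0// => /= e; move: vs; rewrite e eqxx.
Qed.

Lemma bochner_integral_rip g x y : strongly_measurable D g ->
  mu.-integrable D (EFin \o (fun t => rnorm (g t))) ->
  is_bochner_integral D g x ->
  rip ip x y = \int[mu]_(t in D) rip ip (g t) y.
Proof.
move=> mg ig [_ [s [ss sg sx]]].
have rE : rip ip (simple_integral D (s n)) y @[n --> \oo] --> rip ip x y.
  by apply: cvg_rip => //; exact: cvg_cst.
apply: (cvg_unique _ rE) => //; apply/cvgrPdist_lt => e e0.
have y1 : 0 < rnorm y + 1 by rewrite ltr_wpDl.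
have msg n : strongly_measurable D (s n).
  by exists (fun=> s n); split=> // t _; exact: cvg_cst.
have idn n : mu.-integrable D (EFin \o (fun t => rnorm (g t - s n t))).
  apply: (@le_intble _ _ _ (fun t => rnorm (g t) + rnorm (s n t))) => //.
  - by apply: measurable_rnorm; exact: strongly_measurableB.
  - by move=> t _; rewrite ger0_norm// rnormB.
  - apply: intbleD => //; apply: intble_finitely_valued => //.
    exact: (finitely_valued_comp (@rnorm R k H) (ss n)).
have irg : mu.-integrable D (EFin \o (fun t => rip ip (g t) y)).
  apply: (@le_intble _ _ _ (fun t => rnorm y * rnorm (g t))) => //.
  - by apply: measurable_rip => //; exact: strongly_measurable_cst.
  - by move=> t _; rewrite mulrC rip_abs.
  - exact: intbleZ.
have irs n : mu.-integrable D (EFin \o (fun t => rip ip (s n t) y)).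
  apply: intble_finitely_valued => //.
  exact: (finitely_valued_comp (fun v => rip ip v y) (ss n)).
have bd n : `|rip ip (simple_integral D (s n)) y - \int[mu]_(t in D) rip ip (g t) y| <=
    rnorm y * \int[mu]_(t in D) rnorm (g t - s n t).
  rewrite simple_integral_rip// -RintegralB// -RintegralZl//.
  apply: Rintegral_le_cst => //.
  - by apply/measurable_funB; [case/integrableP : (irs n) => /measurable_EFinP|
      case/integrableP : irg => /measurable_EFinP].
  - by move=> t _; rewrite -ripBl mulrC rnorm_distC rip_abs.
  - exact: intbleZ.
have /fine_cvgP[_ /cvgr0Pnorm_lt /(_ _ (divr_gt0 e0 y1))] := sg.
apply: filterS => n hn; rewrite distrC; apply: (le_lt_trans (bd n)).
have I0 : 0 <= \int[mu]_(t in D) rnorm (g t - s n t) by apply: Rintegral_ge0.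
apply: (@le_lt_trans _ _ ((rnorm y + 1) * \int[mu]_(t in D) rnorm (g t - s n t))).
  by rewrite ler_wpM2r// lerDl.
rewrite mulrC -ltr_pdivlMr//; apply: le_lt_trans hn; exact: ler_norm.
Qed.

(** The simple functions from strong measurability need not be dominated, so each is set to 0 where
    its norm exceeds [rnorm (g t) + 1]. Pointwise limits are unaffected, dominated convergence
    applies, and the integrals form a Cauchy sequence. *)
Lemma bochner_integral_exists g : strongly_measurable D g ->
  mu.-integrable D (EFin \o (fun t => rnorm (g t))) ->
  exists x, is_bochner_integral D g x.
Proof.
move=> mg ig; have [s [ss sg]] := mg.
pose E n := D `&` [set t | rnorm (s n t) <= rnorm (g t) + 1].
have mE n : measurable (E n).
  have mf : measurable_fun D (fun t => rnorm (g t) + 1 - rnorm (s n t)).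
    apply: measurable_funB.
      by apply: measurable_funD; [exact: measurable_rnorm|exact: measurable_cst].
    apply: measurable_funTS; apply: finitely_valued_measurable.
    exact: (finitely_valued_comp (@rnorm R k H) (ss n)).
  have := mf mD `[0, +oo[%classic (measurable_itv _).
  rewrite (_ : _ `&` _ = E n)//; apply/seteqP.
  by split=> t [Dt /=]; rewrite in_itv /= andbT subr_ge0.
pose r n t := if t \in E n then s n t else 0.
have sr n : simple (r n).
  have fE : finitely_valued (fun t => t \in E n).
    rewrite (_ : (fun t => t \in E n) = fun t => if t \in E n then true else false).
      by apply: finitely_valued_if; exact: mE.
    by apply/funext => t; case: ifP.
  exact: (finitely_valued2 (fun (b : bool) (x : H) => if b then x else 0) fE (ss n)).
have rg t : D t -> r n t @[n --> \oo] --> g t.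
  move=> Dt; have := sg t Dt; apply: cvg_trans; apply: near_eq_cvg.
  have /cvg_rnormP/cvgr0Pnorm_lt/(_ _ ltr01) := sg t Dt.
  apply: filterS => n; rewrite ger0_norm// => /ltW h.
  rewrite /r ifT//; apply: mem_set; split=> //=.
  by apply: (le_trans (rnorm_le_dist _ (g t))); rewrite lerD2l.
have rbd n t : D t -> rnorm (r n t) <= rnorm (g t) + 1.
  move=> Dt; rewrite /r; case: ifPn => [/set_mem[]//|_].
  by rewrite rnorm0 addr_ge0.
have msr n : strongly_measurable D (r n).
  by exists (fun=> r n); split=> // t _; exact: cvg_cst.
have ibd : mu.-integrable D (EFin \o (fun t => 2 * rnorm (g t) + 1)).
  by apply: intbleD => //; [exact: intbleZ|exact: intble_cst].
have mdn n : measurable_fun D (fun t => rnorm (g t - r n t)).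
  by apply: measurable_rnorm; exact: strongly_measurableB.
have dbd n t : D t -> rnorm (g t - r n t) <= 2 * rnorm (g t) + 1.
  by move=> Dt; apply: (le_trans (rnormB _ _)); have := rbd n t Dt; lra.
have idn n : mu.-integrable D (EFin \o (fun t => rnorm (g t - r n t))).
  apply: (le_intble mD (mdn n) _ ibd) => t Dt.
  by rewrite ger0_norm// dbd.
have cvg0 : (\int[mu]_(t in D) (rnorm (g t - r n t))%:E)%E @[n --> \oo] --> 0%E.
  rewrite -[0%E](_ : (\int[mu]_(t in D) cst 0 t)%E = 0%E); last exact: integral0.
  apply: (@dominated_cvg _ _ _ mu D mD (fun n t => (rnorm (g t - r n t))%:E)
    (cst 0%E) (fun t => (2 * rnorm (g t) + 1)%:E)) => //.
  - by move=> n; exact/measurable_EFinP.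
  - move=> t Dt; apply/fine_cvgP; split; first exact: nearW.
    have /cvg_rnormP := rg t Dt; apply: cvg_trans; apply: near_eq_cvg.
    by apply: nearW => n /=; rewrite rnorm_distC.
  - by move=> n t Dt; rewrite /= lee_fin ger0_norm// dbd.
have [|x rx] := @rcauchy_cvg _ _ H (fun n => simple_integral D (r n)).
  move=> e e0; have e2 : 0 < e / 2 by rewrite divr_gt0.
  have /fine_cvgP[_ /cvgr0Pnorm_lt /(_ _ e2) [N _ NJ]] := cvg0.
  exists N => m n Nm Nn.
  have J j : (N <= j)%N -> \int[mu]_(t in D) rnorm (g t - r j t) < e / 2.
    by move=> Nj; apply: le_lt_trans (NJ j Nj); exact: ler_norm.
  have Jm := J m Nm; have Jn := J n Nn.
  apply: le_lt_trans (_ : \int[mu]_(t in D) rnorm (g t - r m t)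
    + \int[mu]_(t in D) rnorm (g t - r n t) < e); last by lra.
  apply: rnorm_le_of_rip => [|y]; first by rewrite addr_ge0// Rintegral_ge0.
  have irs j : mu.-integrable D (EFin \o (fun t => rip ip (r j t) y)).
    apply: intble_finitely_valued => //.
    exact: (finitely_valued_comp (fun v => rip ip v y) (sr j)).
  rewrite ripBl !simple_integral_rip// -RintegralB// mulrC -RintegralD//.
  rewrite -RintegralZl//; last exact: intbleD.
  apply: le_Rintegral => //; first exact: intbleB.
    by apply: intbleZ => //; exact: intbleD.
  move=> t Dt; rewrite -ripBl; apply: (le_trans (rip_le ip_norm _ _)).
  rewrite mulrC ler_wpM2l//; apply: (le_trans (rnorm_distD (g t) _ _)).
  by rewrite rnorm_distC.
by exists x; split=> //; exists r.
Qed.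

(** Determines the integral by its pairings; later estimates of [bochner] go through this identity
    and duality. *)
Lemma bochner_rip g y : strongly_measurable D g ->
  mu.-integrable D (EFin \o (fun t => rnorm (g t))) ->
  rip ip (bochner D g) y = \int[mu]_(t in D) rip ip (g t) y.
Proof.
move=> mg ig; apply: bochner_integral_rip => //.
exact: (xgetPex 0 (bochner_integral_exists mg ig)).
Qed.

End fixed_domain.
End bochner.

(** * The substitution of [t - x] for [x] on []0, t[] *)

Section reflection.
Variable R : realType.
Notation mu := (@lebesgue_measure R).
Implicit Types (t : R).

Definition reflect_about (t : R) (x : measurableTypeR R) : measurableTypeR R := t - x.

Lemma measurable_reflect_about t : measurable_fun setT (reflect_about t).
Proof. by apply: measurable_funB => //; exact: measurable_cst. Qed.

HB.instance Definition _ t :=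
  isMeasurableFun.Build _ _ _ _ (reflect_about t) (measurable_reflect_about t).

Lemma lebesgue_measure_reflect t (A : set (measurableTypeR R)) : measurable A ->
  pushforward mu (reflect_about t) A = mu A.
Proof.
move=> mA; apply/esym/lebesgue_measure_unique => //= _ [[a b]] _ <-.
rewrite /pushforward (_ : _ @^-1` _ = `[t - b, t - a[%classic).
  rewrite !lebesgue_measure_itv/= !lte_fin ltrD2l ltrN2.
  by case: ifP => // _; rewrite -!EFinB; congr EFin; ring.
apply/seteqP; split=> x /=; rewrite !in_itv /= /reflect_about => /andP[? ?];
  apply/andP; split; lra.
Qed.

Lemma reflect_itv t : reflect_about t @^-1` `]0, t[ = `]0, t[%classic.
Proof.
by apply/seteqP; split=> x /=; rewrite !in_itv /= /reflect_about => /andP[? ?];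
  apply/andP; split; lra.
Qed.

Lemma ge0_integral_reflect t (h : R -> \bar R) : measurable_fun `]0, t[ h ->
  (forall x, x \in (`]0, t[%classic : set R) -> (0 <= h x)%E) ->
  (\int[mu]_(x in `]0%R, t[) h (t - x)%R)%E = (\int[mu]_(x in `]0%R, t[) h x)%E.
Proof.
move=> mh h0.
rewrite -[X in (\int[mu]_(x in X) h (t - x)%R)%E]reflect_itv.
have <- := @ge0_integral_pushforward _ _ _ _ R _ (measurable_reflect_about t) mu
  `]0, t[%classic h (measurable_itv _) mh h0.
by apply: eq_measure_integral => A mA _; exact: lebesgue_measure_reflect.
Qed.

Lemma measurable_fun_reflect t (h : R -> R) : measurable_fun `]0, t[ h ->
  measurable_fun `]0, t[ (fun x => h (t - x)).
Proof.
move=> mh; apply: (@measurable_comp _ _ _ _ _ _ `]0, t[%classic) => //.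
  by move=> _ [x /= + <-]; rewrite !in_itv /= => /andP[? ?]; apply/andP; split; lra.
by apply: measurable_funTS; exact: measurable_reflect_about.
Qed.

Lemma intble_reflect t (h : R -> R) : mu.-integrable `]0, t[ (EFin \o h) ->
  mu.-integrable `]0, t[ (EFin \o (fun x => h (t - x))).
Proof.
move=> /integrableP[/measurable_EFinP mh ih]; apply/integrableP; split.
  by apply/measurable_EFinP; exact: measurable_fun_reflect.
rewrite (@ge0_integral_reflect t (fun x => `|(h x)%:E|%E))//.
by apply: measurableT_comp => //; exact/measurable_EFinP.
Qed.

Lemma Rintegral_reflect t (h : R -> R) : mu.-integrable `]0, t[ (EFin \o h) ->
  \int[mu]_(x in `]0, t[) h (t - x) = \int[mu]_(x in `]0, t[) h x.
Proof.
move=> ih; have mh : measurable_fun `]0, t[ h.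
  by case/integrableP : ih => /measurable_EFinP.
have mt : measurable (`]0, t[%classic : set (measurableTypeR R)) by exact: measurable_itv.
have nh : mu.-integrable `]0, t[ (EFin \o (fun x => `|h x|)).
  exact: integrable_norm ih.
(* [h] is the difference of two nonnegative integrable functions, [h x + |h x|] and [|h x|], and the
   formula for nonnegative integrands applies to each. *)
have ph := intbleD mt ih nh.
have E (g : R -> R) : measurable_fun `]0, t[ g -> (forall x, 0 <= g x) ->
    \int[mu]_(x in `]0, t[) g (t - x) = \int[mu]_(x in `]0, t[) g x.
  move=> mg g0; congr fine; apply: (@ge0_integral_reflect t (EFin \o g)).
    exact/measurable_EFinP.
  by move=> x _ /=; rewrite lee_fin.
have -> : \int[mu]_(x in `]0, t[) h x = \int[mu]_(x in `]0, t[) ((h x + `|h x|) - `|h x|).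
  by apply: eq_Rintegral => x _; rewrite addrK.
have -> : \int[mu]_(x in `]0, t[) h (t - x) =
    \int[mu]_(x in `]0, t[) ((h (t - x) + `|h (t - x)|) - `|h (t - x)|).
  by apply: eq_Rintegral => x _; rewrite addrK.
rewrite !RintegralB//; last 2 first.
- exact: (intble_reflect ph).
- exact: (intble_reflect nh).
congr (_ - _).
  apply: (E (fun x => h x + `|h x|)) => [|x].
    by apply: measurable_funD => //; exact: measurableT_comp.
  by have := ler_norm (- h x); rewrite normrN; lra.
by apply: (E (fun x => `|h x|)) => //; exact: measurableT_comp.
Qed.

End reflection.

(** * Convolution of a semigroup with a forcing term *)

Section convolution.
Variables (R : realType) (k : scalar_kind).
Variable H : completeNormedModType (scalar_field R k).
Variable ip : {dot H for scalar_conj k}.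
Hypothesis ip_norm : forall x, ip x x = `|x| ^+ 2.
Notation mu := (@lebesgue_measure R).
Notation itv0 t := (`]0, t[%classic : set (measurableTypeR R)).

Definition convolution (S : R -> H -> H) (f : R -> H) (t : R) : H :=
  bochner `]0, t[ (fun tau => S tau (f (t - tau))).

Lemma measurable_itv0 (t : R) : measurable (itv0 t).
Proof. exact: measurable_itv. Qed.

Lemma itv0_fin (t : R) : (mu (itv0 t) < +oo)%E.
Proof. by rewrite lebesgue_measure_itv/=; case: ifP => _; rewrite ?ltry// -EFinB ltry. Qed.

Lemma sub_itv0 (s t : R) : s <= t -> itv0 s `<=` itv0 t.
Proof.
move=> st x /=; rewrite !in_itv /= => /andP[-> h]; exact: lt_le_trans st.
Qed.

Lemma intble_sub_itv0 (s t : R) (h : R -> R) : s <= t ->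
  mu.-integrable (itv0 t) (EFin \o h) -> mu.-integrable (itv0 s) (EFin \o h).
Proof.
move=> st; apply: integrableS; [exact: measurable_itv0..|exact: sub_itv0].
Qed.

Lemma Rintegral_sub_itv0 (s t : R) (h : R -> R) : s <= t ->
  (forall x, 0 <= h x) -> mu.-integrable (itv0 t) (EFin \o h) ->
  \int[mu]_(x in itv0 s) h x <= \int[mu]_(x in itv0 t) h x.
Proof.
move=> st h0 ih; have ihs := intble_sub_itv0 st ih.
apply: fine_le; [exact: integrable_fin_num ihs|exact: integrable_fin_num ih|].
apply: ge0_subset_integral; first exact: measurable_itv0.
- exact: measurable_itv0.
- by case/integrableP : ih.
- by move=> x _; rewrite lee_fin.
- exact: sub_itv0.
Qed.

(** Duality reduces the norm to pairings. The pointwise bound is in the reflected variable, so the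
    substitution produces an integral of [phi], enlarged to []0, T[] for a bound uniform in [t]. *)
Lemma rnorm_le_Rintegral_reflect (T t : R) (x : H) (g : R -> H) (phi : R -> R) :
  t <= T -> strongly_measurable `]0, t[ g ->
  mu.-integrable (itv0 t) (EFin \o (fun tau => rnorm (g tau))) ->
  (forall y, rip ip x y = \int[mu]_(tau in itv0 t) rip ip (g tau) y) ->
  (forall s, 0 <= phi s) ->
  mu.-integrable (itv0 T) (EFin \o phi) ->
  (forall tau, 0 < tau -> tau < t -> rnorm (g tau) <= phi (t - tau)) ->
  rnorm x <= \int[mu]_(s in itv0 T) phi s.
Proof.
move=> tT mg ig xg phi0 iphi gphi.
have mt := measurable_itv0 t.
have iphit := intble_sub_itv0 tT iphi.
have iphir := intble_reflect iphit.
apply: (le_trans _ (Rintegral_sub_itv0 tT phi0 iphi)).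
rewrite -(Rintegral_reflect iphit).
apply: (rnorm_le_of_rip ip_norm) => [|y]; first by apply: Rintegral_ge0.
rewrite xg mulrC -(RintegralZl _ mt iphir); apply: (le_trans (ler_norm _)).
apply: Rintegral_le_cst => //; last exact: intbleZ.
  apply: measurable_rip => //; last exact: strongly_measurable_cst.
move=> s; rewrite /= in_itv /= => /andP[s0 st].
apply: (le_trans (rip_abs ip_norm _ _)); rewrite mulrC ler_wpM2l//.
exact: gphi.
Qed.

Section one_semigroup.
Variables (S : R -> H -> H) (f : R -> H) (T M : R).
Hypotheses (S_C0 : C0_semigroup S) (M_ge0 : 0 <= M).
Hypothesis SM : forall t x, 0 <= t -> t <= T -> rnorm (S t x) <= M * rnorm x.
Hypothesis f_sm : strongly_measurable `]0, T[ f.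
Hypothesis f_int : mu.-integrable (itv0 T) (EFin \o (fun t => rnorm (f t))).

Lemma convolution_sm t : t <= T ->
  strongly_measurable `]0, t[ (fun tau => S tau (f (t - tau))).
Proof.
move=> tT; apply: (strongly_measurable_semigroup (a := id) (T := T) S_C0).
- exact: measurable_itv0.
- exact: measurable_id.
- move=> s /=; rewrite in_itv /= => /andP[/ltW -> /ltW st]; exact: le_trans tT.
- rewrite -reflect_itv; apply: (@strongly_measurable_preim _ _ _ _ f (reflect_about t)).
    exact: measurable_reflect_about.
  by apply: strongly_measurableS f_sm; exact: sub_itv0.
Qed.

Lemma convolution_int t : t <= T -> mu.-integrable (itv0 t)
  (EFin \o (fun tau => rnorm (S tau (f (t - tau))))).
Proof.
move=> tT; have mt := measurable_itv0 t.
apply: (@le_intble _ _ _ (fun tau => M * rnorm (f (t - tau)))) => //.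
- by apply: measurable_rnorm; exact: convolution_sm.
- move=> s /=; rewrite in_itv /= => /andP[s0 st]; rewrite ger0_norm//.
  by apply: SM; [exact: ltW|exact: le_trans (ltW st) tT].
- apply: intbleZ => //; apply: (intble_reflect (h := fun t => rnorm (f t))).
  exact: intble_sub_itv0 f_int.
Qed.

Lemma convolution_rip t y : t <= T -> rip ip (convolution S f t) y =
  \int[mu]_(tau in itv0 t) rip ip (S tau (f (t - tau))) y.
Proof.
move=> tT; apply: (bochner_rip ip_norm).
- exact: measurable_itv0.
- exact: itv0_fin.
- exact: convolution_sm.
- exact: convolution_int.
Qed.

Lemma convolution_le t : t <= T ->
  rnorm (convolution S f t) <= M * \int[mu]_(s in itv0 T) rnorm (f s).
Proof.
move=> tT; have mT := measurable_itv0 T.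
rewrite -RintegralZl//.
apply: (rnorm_le_Rintegral_reflect tT (convolution_sm tT) (convolution_int tT)).
- by move=> y; exact: convolution_rip.
- by move=> s; rewrite mulr_ge0.
- exact: intbleZ.
- move=> s s0 st; apply: SM; first exact: ltW.
  exact: le_trans (ltW st) tT.
Qed.

(** After the substitution [f] no longer depends on the upper limit [s], and extension by 0 puts the
    convolutions at all times [s <= t] on one interval. [Num.max 0] keeps the time argument
    nonnegative outside []0, s[], as the measurability lemma for [S] requires. *)
Let kernel s tau := if tau \in itv0 s then S (Num.max 0 (s - tau)) (f tau) else 0.

Let kernel_sm t s : t <= T -> s <= t -> strongly_measurable `]0, t[ (kernel s).
Proof.
move=> tT st; apply: strongly_measurable_if; first exact: measurable_itv0.
apply: (strongly_measurable_semigroup (T := T) S_C0).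
- exact: measurable_itv0.
- apply: measurable_maxr; first exact: measurable_cst.
  by apply: measurable_funTS; exact: measurable_reflect_about.
- move=> x /=; rewrite in_itv /= => /andP[x0 xt].
  by rewrite le_max lexx/= ge_max; apply/andP; split; lra.
- by apply: strongly_measurableS f_sm; exact: sub_itv0.
Qed.

Let kernel_le s tau : s <= T -> rnorm (kernel s tau) <= M * rnorm (f tau).
Proof.
move=> sT; rewrite /kernel; case: ifPn => [/set_mem|_]; last first.
  by rewrite rnorm0 mulr_ge0.
rewrite /= in_itv /= => /andP[t0 ts].
by apply: SM; [rewrite le_max lexx|rewrite ge_max; apply/andP; split; lra].
Qed.

Let kernel_rip t s y : t <= T -> s <= t -> rip ip (convolution S f s) y =
  \int[mu]_(tau in itv0 t) rip ip (kernel s tau) y.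
Proof.
move=> tT st; have sT := le_trans st tT; rewrite convolution_rip//.
have ms := measurable_itv0 s; have mt := measurable_itv0 t.
pose phi x := rip ip (S (Num.max 0 (s - x)) (f x)) y.
have iphi : mu.-integrable (itv0 s) (EFin \o phi).
  apply: (@le_intble _ _ _ (fun x => M * rnorm y * rnorm (f x))) => //.
  - apply: measurable_rip => //; last exact: strongly_measurable_cst.
    have := kernel_sm sT (lexx s); apply: eq_strongly_measurable => x sx.
    by rewrite /kernel ifT//; exact: mem_set.
  - move=> x /=; rewrite in_itv /= => /andP[x0 xs].
    apply: (le_trans (rip_abs ip_norm _ _)); rewrite mulrAC ler_wpM2r//.
    by apply: SM; [rewrite le_max lexx|rewrite ge_max; apply/andP; split; lra].
  - by apply: intbleZ => //; exact: intble_sub_itv0 f_int.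
transitivity (\int[mu]_(x in itv0 s) phi (s - x)).
  apply: eq_Rintegral => x /set_mem /=; rewrite in_itv /= => /andP[x0 xs].
  rewrite /phi subKr (max_idPr _)//; exact: ltW.
rewrite (Rintegral_reflect iphi).
rewrite -{1}(setIidr (sub_itv0 st)) Rintegral_mkcondr.
apply: eq_Rintegral => x _; rewrite /phi /kernel patchE.
by case: ifP => // _; rewrite rip0l.
Qed.

(** Dominated convergence for the kernels. Only approach from the left occurs, since the sampled
    times approximate from below. *)
Lemma convolution_cvg t (u : nat -> R) : 0 < t -> t <= T ->
  (forall n, u n <= t) -> u n @[n --> \oo] --> t ->
  convolution S f (u n) @[n --> \oo] --> convolution S f t.
Proof.
move=> t0 tT ut utt; have mt := measurable_itv0 t.
have cvg0 : (\int[mu]_(x in itv0 t) (rnorm (kernel (u n) x - kernel t x))%:E)%E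
    @[n --> \oo] --> 0%E.
  rewrite -[0%E](_ : (\int[mu]_(x in itv0 t) cst 0 x)%E = 0%E); last exact: integral0.
  apply: (@dominated_cvg _ _ _ mu _ mt (fun n x => (rnorm (kernel (u n) x - kernel t x))%:E)
    (cst 0%E) (fun x => (2 * M * rnorm (f x))%:E)) => //.
  - move=> n; apply/measurable_EFinP; apply: measurable_rnorm.
    by apply: strongly_measurableB; exact: kernel_sm.
  - move=> x /=; rewrite in_itv /= => /andP[x0 xt].
    apply/fine_cvgP; split; first exact: nearW.
    apply/cvgr0Pnorm_lt => e e0.
    have tx : 0 <= t - x by rewrite subr_ge0 ltW.
    have [d d0 dP] := semigroup_continuous S_C0 (f x) tx e0.
    (* The second bound places [u n] beyond [x], so that both kernels are evaluated inside their
       intervals. *)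
    have dm : 0 < Num.min d (t - x) by rewrite lt_min d0 subr_gt0.
    have /cvgrPdist_lt /(_ _ dm) := utt; apply: filterS => n.
    rewrite lt_min => /andP[h1 h2] /=.
    have xu : x < u n.
      by move: h2; rewrite ger0_norm ?subr_ge0//; lra.
    rewrite ger0_norm//; rewrite /kernel !ifT; last 2 first.
    + by apply: mem_set; rewrite /= in_itv /= x0.
    + by apply: mem_set; rewrite /= in_itv /= x0.
    rewrite !(max_idPr _) ?subr_ge0 ?ltW//; apply: dP; first by rewrite subr_ge0 ltW.
    by rewrite opprB addrA subrK distrC.
  - apply: intbleZ => //; exact: intble_sub_itv0 f_int.
  - move=> n x Dx; rewrite /= lee_fin ger0_norm//.
    apply: (le_trans (rnormB _ _)).
    have := kernel_le x (le_trans (ut n) tT); have := kernel_le x tT; lra.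
apply/cvg_rnormP/cvgr0Pnorm_lt => e e0.
have /fine_cvgP[_ /cvgr0Pnorm_lt /(_ _ e0)] := cvg0.
apply: filterS => n hn; rewrite ger0_norm//.
apply: le_lt_trans hn; apply: le_trans (ler_norm _).
have smn : strongly_measurable `]0, t[ (fun x => kernel (u n) x - kernel t x).
  by apply: strongly_measurableB; exact: kernel_sm.
have idn : mu.-integrable (itv0 t) (EFin \o (fun x => rnorm (kernel (u n) x - kernel t x))).
  apply: (@le_intble _ _ _ (fun x => 2 * M * rnorm (f x))) => //.
  - exact: measurable_rnorm.
  - move=> x Dx; rewrite ger0_norm//; apply: (le_trans (rnormB _ _)).
    have := kernel_le x (le_trans (ut n) tT); have := kernel_le x tT; lra.
  - by apply: intbleZ => //; exact: intble_sub_itv0 f_int.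
have irk s y : s <= t -> mu.-integrable (itv0 t) (EFin \o (fun x => rip ip (kernel s x) y)).
  move=> st; apply: (@le_intble _ _ _ (fun x => rnorm y * M * rnorm (f x))) => //.
  - by apply: measurable_rip => //; [exact: kernel_sm|exact: strongly_measurable_cst].
  - move=> x Dx; apply: (le_trans (rip_abs ip_norm _ _)).
    rewrite mulrC -mulrA ler_wpM2l//; apply: kernel_le; exact: le_trans tT.
  - by apply: intbleZ => //; exact: intble_sub_itv0 f_int.
apply: (rnorm_le_of_rip ip_norm) => [|y]; first exact: Rintegral_ge0.
rewrite ripBl (kernel_rip y tT (ut n)) (kernel_rip y tT (lexx t)).
rewrite -RintegralB//; [|exact: irk|exact: irk].
rewrite mulrC -RintegralZl//.
apply: le_Rintegral => //.
- by apply: intbleB => //; exact: irk.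
- exact: intbleZ.
- by move=> x _; rewrite -ripBl mulrC rip_le.
Qed.

Lemma convolution_strongly_measurable : strongly_measurable `]0, T[ (convolution S f).
Proof.
have mT := measurable_itv0 T.
have [| |rho [frho rho0 rhoa rho_cvg]] := @finitely_valued_approx R (itv0 T) id mT.
- exact: measurable_id.
- by move=> t /=; rewrite in_itv /= => /andP[/ltW].
exists (fun n t => convolution S f (rho n t)); split=> [n|t Dt].
  exact: (finitely_valued_comp (convolution S f) (frho n)).
have := Dt; rewrite /= in_itv /= => /andP[t0 tT].
apply: convolution_cvg => //; [exact: ltW|by move=> n; exact: rhoa|exact: rho_cvg].
Qed.

End one_semigroup.

(** Rests on $S^\delta f_\delta-Sf=S^\delta(f_\delta-f)+(S^\delta-S)f$ under the integral. *)
Lemma convolution_perturbation (S Sd : R -> H -> H) (f fd : R -> H) (T M Md e t : R) :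
  C0_semigroup S -> C0_semigroup Sd -> 0 <= Md -> 0 <= e -> t <= T ->
  (forall t x, 0 <= t -> t <= T -> rnorm (S t x) <= M * rnorm x) ->
  (forall t x, 0 <= t -> t <= T -> rnorm (Sd t x) <= Md * rnorm x) ->
  (forall t x, 0 <= t -> t <= T -> rnorm (Sd t x - S t x) <= e * rnorm x) ->
  strongly_measurable `]0, T[ f -> strongly_measurable `]0, T[ fd ->
  mu.-integrable (itv0 T) (EFin \o (fun t => rnorm (f t))) ->
  mu.-integrable (itv0 T) (EFin \o (fun t => rnorm (fd t))) ->
  mu.-integrable (itv0 T) (EFin \o (fun t => rnorm (fd t - f t))) ->
  rnorm (convolution Sd fd t - convolution S f t) <=
    Md * \int[mu]_(s in itv0 T) rnorm (fd s - f s)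
    + e * \int[mu]_(s in itv0 T) rnorm (f s).
Proof.
move=> S_C0 Sd_C0 Md0 e0 tT SM SdM Sde f_sm fd_sm f_int fd_int d_int.
have mT := measurable_itv0 T; have mt := measurable_itv0 t.
have g_sm := convolution_sm S_C0 f_sm tT.
have gd_sm := convolution_sm Sd_C0 fd_sm tT.
have g_int := convolution_int S_C0 SM f_sm f_int tT.
have gd_int := convolution_int Sd_C0 SdM fd_sm fd_int tT.
have d_sm := strongly_measurableB gd_sm g_sm.
rewrite -!RintegralZl// -RintegralD//; [|exact: intbleZ|exact: intbleZ].
apply: (rnorm_le_Rintegral_reflect tT d_sm).
- apply: (@le_intble _ _ _ (fun tau => rnorm (Sd tau (fd (t - tau))) + rnorm (S tau (f (t - tau))))) => //.
  + exact: measurable_rnorm.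
  + by move=> s _; rewrite ger0_norm// rnormB.
  + exact: intbleD.
- move=> y; rewrite ripBl (convolution_rip Sd_C0 SdM fd_sm fd_int _ tT).
  rewrite (convolution_rip S_C0 SM f_sm f_int _ tT) -RintegralB//.
  + by apply: eq_Rintegral => x _; rewrite ripBl.
  + apply: (@le_intble _ _ _ (fun tau => rnorm y * rnorm (Sd tau (fd (t - tau))))) => //.
    * by apply: measurable_rip => //; exact: strongly_measurable_cst.
    * by move=> s _; rewrite mulrC rip_abs.
    * exact: intbleZ.
  + apply: (@le_intble _ _ _ (fun tau => rnorm y * rnorm (S tau (f (t - tau))))) => //.
    * by apply: measurable_rip => //; exact: strongly_measurable_cst.
    * by move=> s _; rewrite mulrC rip_abs.
    * exact: intbleZ.
- by move=> s; rewrite addr_ge0// mulr_ge0.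
- by apply: intbleD => //; exact: intbleZ.
- move=> s /ltW s0 /ltW st; have sT := le_trans st tT.
  rewrite (_ : _ - _ = Sd s (fd (t - s) - f (t - s)) + (Sd s (f (t - s)) - S s (f (t - s)))).
    by apply: (le_trans (rnormD _ _)); rewrite lerD ?SdM ?Sde.
  by rewrite (lin_mapB (semigroup_lin Sd_C0 s0)) addrA subrK.
Qed.

End convolution.

(** * The tracking functional *)

Section weighted_form.
Variables (R : realType) (k : scalar_kind).
Variable H : completeNormedModType (scalar_field R k).
Variable ip : {dot H for scalar_conj k}.
Hypothesis ip_norm : forall x, ip x x = `|x| ^+ 2.
Notation mu := (@lebesgue_measure R).
Notation itv0 t := (`]0, t[%classic : set (measurableTypeR R)).
Variable T : R.
Implicit Types (a c : R -> H) (b : R -> R).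

Definition square_integrable a := strongly_measurable `]0, T[ a /\
  mu.-integrable (itv0 T) (EFin \o (fun t => rnorm (a t) ^+ 2)).

Let mT : measurable (itv0 T) := measurable_itv0 T.

Lemma measurable_rnorm_sqr (D : set R) a : strongly_measurable D a ->
  measurable_fun D (fun t => rnorm (a t) ^+ 2).
Proof.
by move=> ma; under eq_fun do rewrite -(ripxx ip_norm); exact: measurable_rip.
Qed.

Lemma square_integrableD a c : square_integrable a -> square_integrable c ->
  square_integrable (fun t => a t + c t).
Proof.
move=> [ma ia] [mc ic]; split; first exact: strongly_measurableD.
apply: (@le_intble _ _ _ (fun t => 2 * (rnorm (a t) ^+ 2 + rnorm (c t) ^+ 2))) => //.
- by apply: measurable_rnorm_sqr; exact: strongly_measurableD.
- move=> t _; rewrite ger0_norm ?sqr_ge0// (rnormD_sqr ip_norm).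
  have := sqr_ge0 (rnorm (a t - c t)); rewrite (rnormB_sqr ip_norm); lra.
- by apply: intbleZ => //; exact: intbleD.
Qed.

Lemma square_integrableB a c : square_integrable a -> square_integrable c ->
  square_integrable (fun t => a t - c t).
Proof.
move=> sa [mc ic]; apply: square_integrableD => //; split.
  apply: eq_strongly_measurable (strongly_measurableB (strongly_measurable_cst _ _) mc).
  by move=> t _; exact: sub0r.
by under [X in EFin \o X]eq_fun do rewrite rnormN.
Qed.

Lemma square_integrable_bounded a M : strongly_measurable `]0, T[ a ->
  (forall t, 0 < t -> t < T -> rnorm (a t) <= M) -> square_integrable a.
Proof.
move=> ma aM; split=> //.
apply: (@le_intble _ _ _ (fun=> M ^+ 2)) => //; last exact: intble_cst (itv0_fin _).
  exact: measurable_rnorm_sqr.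
move=> t /=; rewrite in_itv /= => /andP[t0 tT]; rewrite ger0_norm ?sqr_ge0//.
rewrite !expr2; apply: ler_pM => //; exact: aM.
Qed.

Lemma square_integrable_rnorm a : square_integrable a ->
  mu.-integrable (itv0 T) (EFin \o (fun t => rnorm (a t))).
Proof.
move=> [ma ia]; apply: (@le_intble _ _ _ (fun t => 1 + rnorm (a t) ^+ 2)) => //.
- exact: measurable_rnorm.
- move=> t _; rewrite ger0_norm//.
  have := sqr_ge0 (rnorm (a t) - 1); have := sqr_ge0 (rnorm (a t)); rewrite !expr2; lra.
- by apply: intbleD => //; exact: intble_cst (itv0_fin _).
Qed.

Lemma Rintegral_cst_itv0 (x : R) : 0 <= T -> \int[mu]_(t in itv0 T) x = x * T.
Proof.
move=> T0; rewrite Rintegral_cst//; congr (_ * _).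
have muT : mu (itv0 T) = T%:E.
  rewrite lebesgue_measure_itv/= lte_fin; case: ltP => [_|T0'].
    by rewrite -EFinB subr0.
  by congr EFin; apply/eqP; rewrite eq_le T0.
exact: (congr1 fine muT).
Qed.

(** AM-GM: [2 n <= nu + n^2 / nu]. *)
Lemma Rintegral_rnorm_le a nu K : 0 <= T -> 0 < nu -> square_integrable a ->
  \int[mu]_(t in itv0 T) (rnorm (a t) ^+ 2) <= K * nu ^+ 2 ->
  \int[mu]_(t in itv0 T) rnorm (a t) <= (T + K) * nu.
Proof.
move=> T0 nu0 sa aK; have ia := square_integrable_rnorm sa; have [ma ia2] := sa.
have i2 : mu.-integrable (itv0 T) (EFin \o (fun t => nu^-1 * rnorm (a t) ^+ 2)).
  exact: intbleZ.
have ic : mu.-integrable (itv0 T) (EFin \o (fun=> nu)).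
  exact: intble_cst (itv0_fin _).
apply: (@le_trans _ _ (\int[mu]_(t in itv0 T) (nu + nu^-1 * rnorm (a t) ^+ 2))).
  apply: le_Rintegral => //; first exact: intbleD.
  move=> t _; rewrite -(ler_pM2l nu0) mulrDr mulVKf ?gt_eqF// -expr2.
  have := sqr_ge0 (rnorm (a t) - nu); have := sqr_ge0 (rnorm (a t)).
  have := sqr_ge0 nu; rewrite !expr2; lra.
rewrite RintegralD// Rintegral_cst_itv0// RintegralZl//.
rewrite mulrDl [nu * T]mulrC lerD2l ler_pdivrMl// mulrCA -expr2; exact: aK.
Qed.

Section weight.
Variables (b : R -> R) (B : R).
Hypotheses (mb : measurable_fun `]0, T[ b) (b_ge0 : forall t, 0 <= b t).
Hypothesis b_le : forall t, b t <= B.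

(** The inner product of $L^2(b\,\mathrm{d}t)$ on []0, T[]; its bilinearity makes the tracking cost
    a quadratic functional. *)
Definition wform a c := \int[mu]_(t in itv0 T) (b t * rip ip (a t) (c t)).

Lemma wform_intble a c : square_integrable a -> square_integrable c ->
  mu.-integrable (itv0 T) (EFin \o (fun t => b t * rip ip (a t) (c t))).
Proof.
move=> [ma ia] [mc ic].
apply: (@le_intble _ _ _ (fun t => B * (rnorm (a t) ^+ 2 + rnorm (c t) ^+ 2))) => //.
- by apply: measurable_funM => //; exact: measurable_rip.
- move=> t _; rewrite normrM (ger0_norm (b_ge0 t)).
  apply: ler_pM => //; apply: (le_trans (rip_abs ip_norm _ _)).
  have := sqr_ge0 (rnorm (a t) - rnorm (c t)).
  have := sqr_ge0 (rnorm (a t)); have := sqr_ge0 (rnorm (c t)).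
  rewrite !expr2; lra.
- by apply: intbleZ => //; exact: intbleD.
Qed.

Lemma wformC a c : wform a c = wform c a.
Proof. by apply: eq_Rintegral => t _; rewrite ripC. Qed.

Lemma wform_ge0 a : 0 <= wform a a.
Proof.
by apply: Rintegral_ge0 => t _; rewrite mulr_ge0// (ripxx ip_norm) sqr_ge0.
Qed.

Lemma wformDr a c c' : square_integrable a -> square_integrable c ->
  square_integrable c' ->
  wform a (fun t => c t + c' t) = wform a c + wform a c'.
Proof.
move=> sa sc sc'; rewrite /wform -RintegralD//; [|exact: wform_intble..].
by apply: eq_Rintegral => t _; rewrite ripDr mulrDr.
Qed.

Lemma wformDl a a' c : square_integrable a -> square_integrable a' ->
  square_integrable c ->
  wform (fun t => a t + a' t) c = wform a c + wform a' c.
Proof. by move=> sa sa' sc; rewrite wformC wformDr// !(wformC c). Qed.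

Lemma wformZr a c (x : R) : square_integrable a -> square_integrable c ->
  wform a (fun t => x %* c t) = x * wform a c.
Proof.
move=> sa sc; rewrite /wform -RintegralZl//; last exact: wform_intble.
by apply: eq_Rintegral => t _; rewrite ripZr mulrCA.
Qed.

Lemma eq_wform a a' c c' : (forall t, 0 < t -> t < T -> a t = a' t) ->
  (forall t, 0 < t -> t < T -> c t = c' t) -> wform a c = wform a' c'.
Proof.
move=> aa cc; apply: eq_Rintegral => t /set_mem /=; rewrite in_itv /= => /andP[t0 tT].
by rewrite aa// cc.
Qed.

End weight.
End weighted_form.

Section tracking_functional.
Variables (R : realType) (k : scalar_kind).
Variable H : completeNormedModType (scalar_field R k).
Variable ip : {dot H for scalar_conj k}.
Hypothesis ip_norm : forall x, ip x x = `|x| ^+ 2.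
Notation mu := (@lebesgue_measure R).
Notation itv0 t := (`]0, t[%classic : set (measurableTypeR R)).
Notation quad := (quadratic (fun (t : R) (x : H) => t %* x)).

Section constraint.
Variables (K : H -> H) (d : H).
Hypothesis K_lin : linear K.

(** Squaring makes the norm constraint quadratic; the feasible set becomes the sublevel set at
    [eps ^+ 2 / 2]. *)
Definition constraint_fun u : R := 2^-1 * rnorm (K u - d) ^+ 2.
Definition constraint_deriv u h := rip ip (K u - d) (K h).
Definition constraint_hess x h := rip ip (K x) (K h).

Lemma constraint_quadratic : quad constraint_fun constraint_deriv constraint_hess.
Proof.
split.
- move=> u h t; rewrite /constraint_fun /constraint_deriv /constraint_hess.
  rewrite (lin_mapD K_lin) (lin_mapZ K_lin) addrAC.
  rewrite [rnorm (K u - d + _) ^+ 2](rnormD_sqr ip_norm).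
  by rewrite rnormZ exprMn real_normK ?num_real// ripZr (ripxx ip_norm); field.
- move=> u h h' t; rewrite /constraint_deriv.
  by rewrite (lin_mapD K_lin) (lin_mapZ K_lin) ripDr ripZr.
- move=> u v h; rewrite /constraint_deriv /constraint_hess.
  rewrite (lin_mapB K_lin) -ripDl; congr (rip ip _ _).
  by rewrite [RHS]addrC addrA subrK.
- by move=> h; rewrite /constraint_hess (ripxx ip_norm) sqr_ge0.
Qed.

End constraint.

Section tracking.
Variables (S : R -> H -> H) (T alpha M B : R) (b : R -> R) (p : R -> H).
Hypotheses (S_C0 : C0_semigroup S) (T_ge0 : 0 <= T) (alpha_ge0 : 0 <= alpha).
Hypothesis M_ge0 : 0 <= M.
Hypothesis SM : forall t x, 0 <= t -> t <= T -> rnorm (S t x) <= M * rnorm x.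
Hypotheses (mb : measurable_fun `]0, T[ b) (b_ge0 : forall t, 0 <= b t).
Hypotheses (b_le : forall t, b t <= B) (p_si : square_integrable T p).

Let form := wform ip T b.

(** [p] stands for the forcing convolution minus the target, so the tracked error is affine in [u]
    with linear part [S t u]. *)
Definition tracking_fun u := alpha / 2 * rnorm u ^+ 2 +
  2^-1 * form (fun t => S t u + p t) (fun t => S t u + p t).
Definition tracking_deriv u h := alpha * rip ip u h +
  form (fun t => S t u + p t) (fun t => S t h).
Definition tracking_hess x h := alpha * rip ip x h +
  form (fun t => S t x) (fun t => S t h).

Lemma orbit_square_integrable x : square_integrable T (fun t => S t x).
Proof.
apply: (square_integrable_bounded ip_norm (M := M * rnorm x)).
  apply: (strongly_measurable_semigroup (a := id) (T := T) S_C0).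
  - exact: measurable_itv0.
  - exact: measurable_id.
  - by move=> t /=; rewrite in_itv /= => /andP[/ltW -> /ltW ->].
  - exact: strongly_measurable_cst.
by move=> t t0 tT; apply: SM; exact: ltW.
Qed.
Let o_si := orbit_square_integrable.

Let s_si x : square_integrable T (fun t => S t x + p t).
Proof. exact: square_integrableD. Qed.

Lemma square_integrableZ x h : square_integrable T (fun t => x %* S t h).
Proof.
apply: (square_integrable_bounded ip_norm (M := `|x| * (M * rnorm h))).
  have [+ _] := o_si (x %* h); apply: eq_strongly_measurable => t /=.
  by rewrite in_itv /= => /andP[/ltW t0 _]; rewrite (lin_mapZ (semigroup_lin S_C0 t0)).
move=> t t0 tT; rewrite rnormZ ler_wpM2l//; apply: SM; exact: ltW.
Qed.

Lemma tracking_quadratic : quad tracking_fun tracking_deriv tracking_hess.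
Proof.
have fD := wformDr ip_norm mb b_ge0 b_le; have fDl := wformDl ip_norm mb b_ge0 b_le.
have fZ := wformZr ip_norm mb b_ge0 b_le; have z_si := square_integrableZ.
have expand X t h : square_integrable T X ->
    form (fun s => X s + t %* S s h) (fun s => X s + t %* S s h) =
    form X X + 2 * t * form X (fun s => S s h)
    + t ^+ 2 * form (fun s => S s h) (fun s => S s h).
  move=> sX; have sXZ := square_integrableD ip_norm sX (z_si t h).
  rewrite /form fD// !fDl// (wformC _ _ _ (fun s => t %* S s h)).
  by rewrite !fZ// (wformC _ _ _ (fun s => t %* S s h)) fZ//; ring.
split.
- move=> u h t; rewrite /tracking_fun /tracking_deriv /tracking_hess.
  (* Linearity of [S s] is available for [s >= 0], so the integrands are compared on the open
     interval. *)
  have E s : 0 < s -> s < T ->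
      S s (u + t %* h) + p s = (S s u + p s) + t %* S s h.
    move=> /ltW s0 _; rewrite (lin_mapD (semigroup_lin S_C0 s0)).
    by rewrite (lin_mapZ (semigroup_lin S_C0 s0)) addrAC.
  have -> : form (fun s => S s (u + t %* h) + p s) (fun s => S s (u + t %* h) + p s)
     = form (fun s => (S s u + p s) + t %* S s h) (fun s => (S s u + p s) + t %* S s h).
    exact: eq_wform.
  have -> : form (fun s => (S s u + p s) + t %* S s h) (fun s => (S s u + p s) + t %* S s h)
     = form (fun s => S s u + p s) (fun s => S s u + p s)
       + 2 * t * form (fun s => S s u + p s) (fun s => S s h)
       + t ^+ 2 * form (fun s => S s h) (fun s => S s h).
    exact: expand.
  rewrite (rnormD_sqr ip_norm) rnormZ exprMn real_normK ?num_real// ripZr.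
  by rewrite (ripxx ip_norm); field.
- move=> u h h' t; rewrite /tracking_deriv.
  have -> : form (fun s => S s u + p s) (fun s => S s (h + t %* h'))
     = form (fun s => S s u + p s) (fun s => S s h + t %* S s h').
    apply: eq_wform => // s /ltW s0 _.
    by rewrite (lin_mapD (semigroup_lin S_C0 s0)) (lin_mapZ (semigroup_lin S_C0 s0)).
  by rewrite /form fD// fZ// ripDr ripZr; ring.
- move=> u v h; rewrite /tracking_deriv /tracking_hess.
  have -> : form (fun s => S s v + p s) (fun s => S s h)
     = form (fun s => (S s u + p s) + S s (v - u)) (fun s => S s h).
    apply: eq_wform => // s /ltW s0 _.
    by rewrite (lin_mapB (semigroup_lin S_C0 s0)) addrAC [S s u + _]addrC subrK.
  by rewrite /form fDl// ripBl; ring.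
- move=> h; rewrite /tracking_hess (ripxx ip_norm).
  by apply: addr_ge0; [apply: mulr_ge0 => //; exact: sqr_ge0|exact: wform_ge0].
Qed.

Lemma tracking_hess_coercive h : alpha * rnorm h ^+ 2 <= tracking_hess h h.
Proof. by rewrite /tracking_hess (ripxx ip_norm) lerDl; exact: wform_ge0. Qed.

Lemma tracking_fun_coercive u : alpha / 2 * rnorm u ^+ 2 <= tracking_fun u.
Proof. by rewrite /tracking_fun lerDl mulr_ge0//; exact: wform_ge0. Qed.

Lemma tracking_hess_le x h :
  `|tracking_hess x h| <= (alpha + B * M ^+ 2 * T) * rnorm x * rnorm h.
Proof.
rewrite /tracking_hess; apply: (le_trans (ler_normD _ _)).
have mT := measurable_itv0 T.
have h1 : `|alpha * rip ip x h| <= alpha * (rnorm x * rnorm h).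
  by rewrite normrM (ger0_norm alpha_ge0) ler_wpM2l// rip_abs.
have h2 : `|form (fun t => S t x) (fun t => S t h)| <=
    B * M ^+ 2 * rnorm x * rnorm h * T.
  rewrite -(Rintegral_cst_itv0 _ T_ge0); apply: Rintegral_le_cst => //.
  - by apply: measurable_funM => //; apply: measurable_rip => //; [have [] := o_si x|have [] := o_si h].
  - move=> t /=; rewrite in_itv /= => /andP[/ltW t0 /ltW tT].
    rewrite normrM (ger0_norm (b_ge0 t)) -!mulrA; apply: ler_pM => //.
    apply: (le_trans (rip_abs ip_norm _ _)).
    apply: le_trans (ler_pM (rnorm_ge0 _) (rnorm_ge0 _) (SM x t0 tT) (SM h t0 tT)) _.
    by rewrite le_eqVlt; apply/orP; left; apply/eqP; ring.
  - exact: intble_cst (itv0_fin _).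
lra.
Qed.

End tracking.
End tracking_functional.

(** * Slater points and uniqueness of minimizers *)

Section slater.
Variables (R : realType) (V : zmodType) (sc : R -> V -> V).
Hypotheses (sc1 : forall x, sc 1 x = x) (scN1 : forall x, sc (- 1) x = - x).

(** At an active constraint a nonzero derivative yields, up to sign, a descent direction of [G], and
    a short step along it enters the interior. *)
Lemma slater_point (G : V -> R) (l c : V -> V -> R) (E : R) (u : V) :
  quadratic sc G l c -> G u <= E -> (G u = E -> exists h, l u h != 0) ->
  exists u0, G u0 < E.
Proof.
move=> qG GuE lu; have [GE|EG] := ltP (G u) E; first by exists u.
have {}GuE : G u = E by apply/eqP; rewrite eq_le GuE.
have [h lh] : exists h, l u h < 0.
  have [h lh] := lu GuE; have [h0|h0] := ltP (l u h) 0; first by exists h.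
  by exists (- h); rewrite (quad_derivN sc1 scN1 qG) oppr_lt0 lt0r lh.
have ch := quad_ge0 qG h.
have d0 : 0 < c h h + 1 by rewrite ltr_wpDl.
pose t := - l u h / (c h h + 1).
have t0 : 0 < t by rewrite divr_gt0// oppr_gt0.
have tc : t * (c h h + 1) = - l u h by rewrite /t divfK// gt_eqF.
exists (u + sc t h); rewrite (quadE qG) GuE -addrA gtrDl.
rewrite (_ : _ + _ = t * (l u h + t * c h h / 2)); last by rewrite expr2; field.
rewrite pmulr_rlt0//; lra.
Qed.

(** Equal minimal values and the optimality condition at [u] give $\frac12
    b(v-u,v-u)=\lambda\,l_u(v-u)$; convexity of [G] and complementarity make the right side
    nonpositive. For a coercive Hessian this is uniqueness. *)
Lemma minimizer_hess_eq0 (F G : V -> R) (L b l c : V -> V -> R) (E : R) (u v u0 : V) :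
  quadratic sc F L b -> quadratic sc G l c -> G u0 < E ->
  minimizer F G E u -> minimizer F G E v -> b (v - u) (v - u) = 0.
Proof.
move=> qF qG slater min_u min_v.
have [lam [lam0 KKT comp]] := lagrange_multiplier sc1 scN1 qF qG min_u slater.
have Fuv : F u = F v.
  by apply/eqP; rewrite eq_le min_u.2 ?min_v.2//; [exact: min_u.1|exact: min_v.1].
have := quad_taylor sc1 qF u v; rewrite -Fuv KKT => h.
have := quad_convex sc1 qG u v => h1.
have h2 := ler_wpM2l lam0 h1.
have h3 : lam * (G v - G u) <= 0.
  rewrite (_ : _ * _ = lam * (G v - E) - lam * (G u - E)); last by ring.
  by rewrite comp subr0 mulr_ge0_le0// subr_le0; exact: min_v.1.
apply/eqP; rewrite eq_le (quad_ge0 qF) andbT; lra.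
Qed.

End slater.

(** * Perturbation bounds for constraint and cost *)

Section tracking_perturbation.
Variables (R : realType) (k : scalar_kind).
Variable H : completeNormedModType (scalar_field R k).
Variable ip : {dot H for scalar_conj k}.
Hypothesis ip_norm : forall x, ip x x = `|x| ^+ 2.
Notation mu := (@lebesgue_measure R).
Notation itv0 t := (`]0, t[%classic : set (measurableTypeR R)).

Lemma rip_perturbation2 (x y xd yd : H) :
  rip ip xd yd - rip ip x y = rip ip (xd - x) yd + rip ip x (yd - y).
Proof. by rewrite ripBl ripBr addrA subrK. Qed.

Lemma rnorm_sqrB (x y : H) :
  rnorm x ^+ 2 - rnorm y ^+ 2 = rip ip (x - y) (x + y).
Proof. by rewrite -!(ripxx ip_norm) ripBl !ripDr (ripC _ y x); ring. Qed.

Lemma constraint_hess_le (K : H -> H) M x h : 0 <= M ->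
  (forall x, rnorm (K x) <= M * rnorm x) ->
  `|constraint_hess ip K x h| <= M ^+ 2 * rnorm x * rnorm h.
Proof.
move=> M0 KM; apply: (le_trans (rip_abs ip_norm _ _)).
apply: le_trans (ler_pM (rnorm_ge0 _) (rnorm_ge0 _) (KM x) (KM h)) _.
by rewrite le_eqVlt; apply/orP; left; apply/eqP; ring.
Qed.

Section constraint_perturbation.
Variables (K Kd : H -> H) (d dd : H) (M e C nu : R).
Hypotheses (M_ge0 : 0 <= M) (e_ge0 : 0 <= e) (C_ge0 : 0 <= C) (nu_ge0 : 0 <= nu).
Hypothesis (nu_le1 : nu <= 1).
Hypotheses (KM : forall x, rnorm (K x) <= M * rnorm x).
Hypotheses (KdM : forall x, rnorm (Kd x) <= M * rnorm x).
Hypotheses (KdK : forall x, rnorm (Kd x - K x) <= e * nu * rnorm x).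
Hypothesis dd_d : rnorm (dd - d) <= C * nu.

Let Y_le x : rnorm (K x - d) <= (M + rnorm d) * (1 + rnorm x).
Proof.
apply: (le_trans (rnormB _ _)); have := KM x.
have := mulr_ge0 (rnorm_ge0 d) (rnorm_ge0 x); have := M_ge0; lra.
Qed.

Let dY_le x : rnorm ((Kd x - dd) - (K x - d)) <= (e + C) * nu * (1 + rnorm x).
Proof.
rewrite subr_interchange; apply: (le_trans (rnormB _ _)).
have := KdK x; have := dd_d; have := mulr_ge0 e_ge0 nu_ge0.
have := mulr_ge0 (mulr_ge0 C_ge0 nu_ge0) (rnorm_ge0 x); lra.
Qed.

Lemma constraint_deriv_perturbation x h :
  `|constraint_deriv ip Kd dd x h - constraint_deriv ip K d x h| <=
    ((e + C) * M + (M + rnorm d) * e) * nu * (1 + rnorm x) * rnorm h.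
Proof.
rewrite /constraint_deriv rip_perturbation2; apply: (le_trans (ler_normD _ _)).
have h1 := rip_abs ip_norm (Kd x - dd - (K x - d)) (Kd h).
have h2 := rip_abs ip_norm (K x - d) (Kd h - K h).
have h3 := ler_pM (rnorm_ge0 _) (rnorm_ge0 _) (dY_le x) (KdM h).
have h4 := ler_pM (rnorm_ge0 _) (rnorm_ge0 _) (Y_le x) (KdK h).
lra.
Qed.

(** A difference of squares: the residuals differ by order [nu], their sum grows linearly in [x],
    and [nu <= 1] keeps the constant free of [nu]. *)
Lemma constraint_fun_perturbation x :
  `|constraint_fun Kd dd x - constraint_fun K d x| <=
    (M + rnorm d + (e + C)) * (e + C) * nu * (1 + rnorm x) ^+ 2.
Proof.
rewrite /constraint_fun -mulrBr.
set Yd := Kd x - dd; set Y := K x - d.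
rewrite rnorm_sqrB normrM ger0_norm//.
have h1 := rip_abs ip_norm (Yd - Y) (Yd + Y).
have h2 := dY_le x; rewrite -/Yd -/Y in h2.
have h3 := Y_le x; rewrite -/Y in h3.
have x1 : 0 <= 1 + rnorm x by rewrite addr_ge0.
have h4 : rnorm Yd <= (M + rnorm d + (e + C)) * (1 + rnorm x).
  apply: (le_trans (rnorm_le_dist Yd Y)).
  have : (e + C) * nu * (1 + rnorm x) <= (e + C) * (1 + rnorm x).
    by rewrite ler_wpM2r// ler_piMr// addr_ge0.
  lra.
have h5 : rnorm (Yd + Y) <= 2 * (M + rnorm d + (e + C)) * (1 + rnorm x).
  apply: (le_trans (rnormD _ _)).
  have : 0 <= (e + C) * (1 + rnorm x) by rewrite mulr_ge0// addr_ge0.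
  lra.
have h6 := ler_pM (rnorm_ge0 _) (rnorm_ge0 _) h2 h5.
lra.
Qed.

End constraint_perturbation.

Section functional_perturbation.
Variables (S Sd : R -> H -> H) (T alpha alphad M B e C nu : R) (b bd : R -> R).
Variables (p pd : R -> H).
Hypotheses (S_C0 : C0_semigroup S) (Sd_C0 : C0_semigroup Sd) (T_ge0 : 0 <= T).
Hypotheses (M_ge0 : 0 <= M) (B_ge0 : 0 <= B) (e_ge0 : 0 <= e) (C_ge0 : 0 <= C).
Hypotheses (nu_gt0 : 0 < nu) (nu_le1 : nu <= 1).
Hypothesis SM : forall t x, 0 <= t -> t <= T -> rnorm (S t x) <= M * rnorm x.
Hypothesis SdM : forall t x, 0 <= t -> t <= T -> rnorm (Sd t x) <= M * rnorm x.
Hypothesis SdS : forall t x, 0 <= t -> t <= T ->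
  rnorm (Sd t x - S t x) <= e * nu * rnorm x.
Hypotheses (mb : measurable_fun `]0, T[ b) (b_ge0 : forall t, 0 <= b t).
Hypotheses (b_le : forall t, b t <= B).
Hypotheses (mbd : measurable_fun `]0, T[ bd) (bd_ge0 : forall t, 0 <= bd t).
Hypotheses (bd_b : forall t, `|bd t - b t| <= nu).
Hypotheses (p_si : square_integrable T p) (pd_si : square_integrable T pd).
Hypothesis pd_p : \int[mu]_(t in itv0 T) (rnorm (pd t - p t) ^+ 2) <= C * nu ^+ 2.
Hypothesis alphad_alpha : `|alphad - alpha| <= nu.

Let nu_ge0 : 0 <= nu := ltW nu_gt0.
Let mT : measurable (itv0 T) := measurable_itv0 T.
Let N1 := \int[mu]_(t in itv0 T) rnorm (p t).
Let N2 := \int[mu]_(t in itv0 T) rnorm (pd t - p t).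
Let d_si := square_integrableB ip_norm pd_si p_si.

Let bd_le t : bd t <= B + 1.
Proof.
have := bd_b t; have := b_le t; have := nu_le1; rewrite ler_norml => ? ? /andP[_ ?]; lra.
Qed.

Let N1_ge0 : 0 <= N1. Proof. exact: Rintegral_ge0. Qed.

Let N2_le : N2 <= (T + C) * nu.
Proof. exact: Rintegral_rnorm_le. Qed.

(** Weight, state and test orbit are varied one after the other. [p] and [pd] are only square
    integrable, so the pointwise bound keeps their norms; these are integrated afterwards, and [N2]
    is of order [nu]. *)
Lemma tracking_deriv_perturbation x h :
  `|tracking_deriv ip Sd T alphad bd pd x h - tracking_deriv ip S T alpha b p x h| <=
    (1 + (M ^+ 2 + 2 * B * M * e) * T + (M + B * e) * N1 + (M + B * M) * (T + C))
    * nu * (1 + rnorm x) * rnorm h.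
Proof.
have o_si := orbit_square_integrable ip_norm S_C0 SM.
have od_si := orbit_square_integrable ip_norm Sd_C0 SdM.
have iw := wform_intble ip_norm mb b_ge0 b_le
  (square_integrableD ip_norm (o_si x) p_si) (o_si h).
have iwd := wform_intble ip_norm mbd bd_ge0 bd_le
  (square_integrableD ip_norm (od_si x) pd_si) (od_si h).
rewrite /tracking_deriv opprD addrACA -mulrBl; apply: (le_trans (ler_normD _ _)).
have h1 : `|(alphad - alpha) * rip ip x h| <= nu * (rnorm x * rnorm h).
  by rewrite normrM; apply: ler_pM => //; exact: rip_abs.
set a := rnorm x in h1 *; set n := rnorm h in h1 *.
have a0 : 0 <= a := rnorm_ge0 x; have n0 : 0 <= n := rnorm_ge0 h.
(* [c0], [c1], [c2] are the coefficients of 1, [rnorm (p t)] and [rnorm (pd t - p t)] in the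
   pointwise bound; [c2] has no overall factor [nu], which [N2] provides. *)
pose c0 := n * nu * a * (M ^+ 2 + 2 * B * M * e).
pose c1 := n * nu * (M + B * e).
pose c2 := n * (nu * M + B * M).
have h2 : `|wform ip T bd (fun t => Sd t x + pd t) (fun t => Sd t h)
    - wform ip T b (fun t => S t x + p t) (fun t => S t h)| <=
    c0 * T + c1 * N1 + c2 * N2.
  have ip1 := square_integrable_rnorm p_si.
  have ip2 := square_integrable_rnorm d_si.
  rewrite /wform -RintegralB// -(Rintegral_cst_itv0 _ T_ge0) /N1 /N2 -!RintegralZl//.
  have ic : mu.-integrable (itv0 T) (EFin \o (fun=> c0)) by exact: intble_cst (itv0_fin _).
  rewrite -RintegralD//; last exact: intbleZ.
  rewrite -RintegralD//; [|by apply: intbleD => //; exact: intbleZ|exact: intbleZ].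
  apply: Rintegral_le_cst => //.
  - by have /integrableP[/measurable_EFinP] := intbleB mT iwd iw.
  - move=> t /=; rewrite in_itv /= => /andP[/ltW t0 /ltW tT].
    set Xd := Sd t x + pd t; set X := S t x + p t.
    rewrite (_ : _ - _ = (bd t - b t) * rip ip Xd (Sd t h) +
       b t * (rip ip Xd (Sd t h) - rip ip X (S t h))); last by ring.
    rewrite rip_perturbation2.
    have X_le : rnorm X <= M * a + rnorm (p t).
      by apply: (le_trans (rnormD _ _)); rewrite lerD2r; exact: SM.
    have dX_le : rnorm (Xd - X) <= e * nu * a + rnorm (pd t - p t).
      rewrite /Xd /X opprD addrACA; apply: (le_trans (rnormD _ _)).
      by rewrite lerD2r; exact: SdS.
    have Xd_le : rnorm Xd <= M * a + (rnorm (p t) + rnorm (pd t - p t)).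
      apply: (le_trans (rnormD _ _)); apply: lerD; first exact: SdM.
      exact: rnorm_le_dist.
    have Hd_le : rnorm (Sd t h) <= M * n by exact: SdM.
    have dH_le : rnorm (Sd t h - S t h) <= e * nu * n by exact: SdS.
    have r1 : `|rip ip Xd (Sd t h)| <= (M * a + (rnorm (p t) + rnorm (pd t - p t))) * (M * n).
      by apply: (le_trans (rip_abs ip_norm _ _)); apply: ler_pM.
    have r2 : `|rip ip (Xd - X) (Sd t h)| <= (e * nu * a + rnorm (pd t - p t)) * (M * n).
      by apply: (le_trans (rip_abs ip_norm _ _)); apply: ler_pM.
    have r3 : `|rip ip X (Sd t h - S t h)| <= (M * a + rnorm (p t)) * (e * nu * n).
      by apply: (le_trans (rip_abs ip_norm _ _)); apply: ler_pM.
    apply: (le_trans (ler_normD _ _)); rewrite !normrM (ger0_norm (b_ge0 t)).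
    have q1 := ler_pM (normr_ge0 _) (normr_ge0 _) (bd_b t) r1.
    have q2 : b t * `|rip ip (Xd - X) (Sd t h) + rip ip X (Sd t h - S t h)| <=
       B * ((e * nu * a + rnorm (pd t - p t)) * (M * n) +
            (M * a + rnorm (p t)) * (e * nu * n)).
      apply: ler_pM => //; apply: (le_trans (ler_normD _ _)); exact: lerD.
    apply: (le_trans (lerD q1 q2)).
    by rewrite /c0 /c1 /c2 le_eqVlt; apply/orP; left; apply/eqP; ring.
  - by apply: intbleD => //; [apply: intbleD => //; exact: intbleZ|exact: intbleZ].
have c2_le : c2 * N2 <= n * (M + B * M) * ((T + C) * nu).
  have M1 : nu * M <= M by rewrite ler_piMl.
  apply: ler_pM => //; [|exact: Rintegral_ge0|].
    by rewrite /c2 mulr_ge0// addr_ge0// mulr_ge0.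
  by rewrite /c2 ler_wpM2l// lerD2r.
have s1 : 0 <= M ^+ 2 + 2 * B * M * e by rewrite addr_ge0 ?sqr_ge0// !mulr_ge0.
have s2 : 0 <= (M + B * e) * N1 by rewrite mulr_ge0// addr_ge0// mulr_ge0.
have s3 : 0 <= (M + B * M) * (T + C) by rewrite mulr_ge0// addr_ge0// mulr_ge0.
have nn : 0 <= nu * n by rewrite mulr_ge0.
have t1 : 0 <= nu * n * (1 + (M ^+ 2 + 2 * B * M * e) * T) by
  rewrite mulr_ge0// addr_ge0// mulr_ge0.
have t2 : 0 <= nu * n * a * ((M + B * e) * N1 + (M + B * M) * (T + C)).
  by rewrite mulr_ge0// ?mulr_ge0// addr_ge0.
apply: (le_trans (lerD h1 (le_trans h2 (_ : _ <= c0 * T + c1 * N1 + n * (M + B * M) * ((T + C) * nu))))).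
  by rewrite lerD2l.
move: t1 t2; rewrite /c0 /c1; lra.
Qed.

(** At the Slater point this bounds the perturbed cost independently of the perturbation. The factor
    3 comes from the square of a sum of three terms. *)
Lemma tracking_fun_perturbation_le x : 0 <= alphad -> 
  tracking_fun ip Sd T alphad bd pd x <=
  (alpha + 1) / 2 * rnorm x ^+ 2 +
  2^-1 * ((B + 1) * 3 * (M ^+ 2 * rnorm x ^+ 2 * T +
    \int[mu]_(t in itv0 T) (rnorm (p t) ^+ 2) + C)).
Proof.
move=> alphad0; rewrite /tracking_fun; apply: lerD.
  rewrite ler_wpM2r ?sqr_ge0//.
  have := alphad_alpha; have := nu_le1; rewrite ler_norml => ? /andP[_ ?]; lra.
rewrite ler_wpM2l//.
have od_si := orbit_square_integrable ip_norm Sd_C0 SdM.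
have ipp := p_si.2; have idd := d_si.2.
have ic : mu.-integrable (itv0 T) (EFin \o (fun=> M ^+ 2 * rnorm x ^+ 2)).
  exact: intble_cst (itv0_fin _).
have isum := intbleD mT (intbleD mT ic ipp) idd.
apply: (@le_trans _ _ (\int[mu]_(t in itv0 T) ((B + 1) * 3 *
   (M ^+ 2 * rnorm x ^+ 2 + rnorm (p t) ^+ 2 + rnorm (pd t - p t) ^+ 2)))).
  apply: le_Rintegral => //.
  - apply: (wform_intble ip_norm mbd bd_ge0 bd_le); exact: square_integrableD.
  - exact: intbleZ.
  move=> t /=; rewrite in_itv /= => /andP[/ltW t0 /ltW tT].
  rewrite (ripxx ip_norm) -mulrA; apply: ler_pM => //; first exact: sqr_ge0.
  have h1 : rnorm (Sd t x + pd t) <= M * rnorm x + rnorm (p t) + rnorm (pd t - p t).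
    apply: (le_trans (rnormD _ _)); rewrite -addrA; apply: lerD; first exact: SdM.
    exact: rnorm_le_dist.
  apply: (@le_trans _ _ ((M * rnorm x + rnorm (p t) + rnorm (pd t - p t)) ^+ 2)).
    by rewrite !expr2; apply: ler_pM.
  have := sqr_ge0 (M * rnorm x - rnorm (p t)).
  have := sqr_ge0 (M * rnorm x - rnorm (pd t - p t)).
  have := sqr_ge0 (rnorm (p t) - rnorm (pd t - p t)).
  rewrite -exprMn !expr2; lra.
rewrite RintegralZl// RintegralD//; last exact: intbleD.
rewrite RintegralD// (Rintegral_cst_itv0 _ T_ge0) ler_wpM2l//.
  by rewrite mulr_ge0// addr_ge0.
rewrite lerD2l; apply: (le_trans pd_p); rewrite ler_piMr// expr_le1//.
Qed.

End functional_perturbation.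
End tracking_perturbation.

(** * Lebesgue norms and representatives of the weights *)

Section lebesgue_spaces.
Variables (R : realType) (k : scalar_kind).
Variable H : completeNormedModType (scalar_field R k).
Variable ip : {dot H for scalar_conj k}.
Hypothesis ip_norm : forall x, ip x x = `|x| ^+ 2.
Notation mu := (@lebesgue_measure R).

Lemma L2norm_sqr (D : set (measurableTypeR R)) (g : R -> H) :
  (L2norm D g `^ 2 = \int[mu]_(t in D) (rnorm (g t) ^+ 2)%:E)%E.
Proof.
rewrite /L2norm poweR_Lnorm// [RHS]integral_mkcond; apply: eq_integral => t _.
rewrite !patchE; case: ifP => _; last by rewrite abse0 poweR0r.
by rewrite /= ger0_norm// -powR_mulrn.
Qed.

Lemma L2_intble (D : set (measurableTypeR R)) (g : R -> H) : measurable D ->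
  L2 D g -> mu.-integrable D (EFin \o (fun t => rnorm (g t) ^+ 2)).
Proof.
move=> mD [mg gfin]; apply/integrableP; split.
  by apply/measurable_EFinP; exact: (measurable_rnorm_sqr ip_norm).
rewrite (_ : (\int[mu]_(t in D) _)%E = (L2norm D g `^ 2)%E).
  exact: poweR_lty.
rewrite L2norm_sqr; apply: eq_integral => t _ /=.
by rewrite ger0_norm// sqr_ge0.
Qed.

Lemma L2norm_lt_Rintegral (D : set (measurableTypeR R)) (g : R -> H) (nu : R) :
  measurable D -> 0 < nu -> L2 D g -> (L2norm D g < nu%:E)%E ->
  \int[mu]_(t in D) (rnorm (g t) ^+ 2) <= nu ^+ 2.
Proof.
move=> mD nu0 gL2 gnu; have ig := L2_intble mD gL2.
rewrite -lee_fin /Rintegral fineK; last exact: integrable_fin_num ig.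
rewrite -L2norm_sqr.
have [r rE r0] : exists2 r, L2norm D g = r%:E & 0 <= r.
  have := Lnorm_ge0 mu 2%:E ((fun t => (rnorm (g t))%:E) \_ D).
  rewrite -/(L2norm D g); move: gnu; case: (L2norm D g) => [r _|//|//].
  by rewrite lee_fin => r0; exists r.
rewrite rE poweR_EFin lee_fin powR_mulrn//.
by move: gnu; rewrite rE lte_fin => /ltW rn; rewrite !expr2; apply: ler_pM.
Qed.

Lemma Linfty_norm_ae (D : set (measurableTypeR R)) (b : R -> R) (nu : R) :
  (Linfty_norm D b <= nu%:E)%E -> {ae mu, forall t, D t -> `|b t| <= nu}.
Proof.
rewrite /Linfty_norm unlock /=; case: ifPn => [_|].
  move=> h; have := ess_sup_ge mu (abse \o ((fun t => (b t)%:E) \_ D)).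
  apply: filterS => t /= bt Dt; move: (le_trans bt h).
  by rewrite patchE mem_set// lee_fin.
(* The norm at infinity is the essential supremum if the whole line has positive measure; the unit
   interval excludes the other case. *)
rewrite -leNgt => muT; exfalso; move: muT; apply/negP; rewrite -ltNge.
have : (mu (`]0%R, 1%R[%classic : set (measurableTypeR R)) <= mu setT)%E.
  by apply: le_measure => //; rewrite inE.
apply: lt_le_trans; rewrite lebesgue_measure_itv/= lte_fin ltr01 -EFinB subr0.
by rewrite lte_fin ltr01.
Qed.

Lemma Linfty_ae_bounded (D : set (measurableTypeR R)) (b : R -> R) : Linfty D b ->
  exists2 B, 0 <= B & {ae mu, forall t, D t -> `|b t| <= B}.
Proof.
move=> [_ bfin].
have [r rE r0] : exists2 r, Linfty_norm D b = r%:E & 0 <= r.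
  have := Lnorm_ge0 mu +oo%E ((fun t => (b t)%:E) \_ D).
  rewrite -/(Linfty_norm D b); move: bfin; case: (Linfty_norm D b) => [r _|//|//].
  by rewrite lee_fin => r0; exists r.
by exists r => //; apply: Linfty_norm_ae; rewrite rE.
Qed.

Lemma ae_eq_Rintegral (D : set (measurableTypeR R)) (f g : R -> R) : measurable D ->
  measurable_fun D f -> measurable_fun D g ->
  {ae mu, forall t, D t -> f t = g t} ->
  \int[mu]_(t in D) f t = \int[mu]_(t in D) g t.
Proof.
move=> mD mf mg fg; congr fine; apply: ae_eq_integral => //.
- exact/measurable_EFinP.
- exact/measurable_EFinP.
- by apply: filterS fg => t /= h Dt; rewrite h.
Qed.

End lebesgue_spaces.

Section weights.
Variable R : realType.
Notation mu := (@lebesgue_measure R).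
Implicit Types (D : set (measurableTypeR R)) (b : R -> R).

(** Clipping alters [b] on a null subset of [D] only, which integrals over [D] do not see, and turns
    almost everywhere bounds into bounds at every point. *)
Lemma weight_representative D b : Linfty_nonneg D b -> exists (b' : R -> R) (B : R),
  [/\ 0 <= B, measurable_fun D b', forall t, 0 <= b' t, forall t, b' t <= B &
      {ae mu, forall t, D t -> b t = b' t}].
Proof.
move=> [bL b0]; have [B B0 bB] := Linfty_ae_bounded bL.
exists (fun t => Num.max 0 (Num.min (b t) B)), B; split=> //.
- apply: measurable_maxr; first exact: measurable_cst.
  by apply: measurable_minr; [exact: bL.1|exact: measurable_cst].
- by move=> t; rewrite le_max lexx.
- by move=> t; rewrite ge_max B0 ge_min lexx orbT.
- have F : Filter (nbhs (almost_everywhere mu)) by exact: ae_filter_ringOfSetsType.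
  apply: (@filterS2 _ _ F _ _ _ _ b0 bB) => t {}b0 {}bB Dt.
  rewrite (min_idPl _); last exact: le_trans (ler_norm _) (bB Dt).
  by rewrite (max_idPr _)// b0.
Qed.

(** The perturbation is clipped to [[- nu, nu]] and the sum to nonnegative values; the second
    clipping moves towards [b' t >= 0], so the distance stays at most [nu]. *)
Lemma perturbed_weight_representative D b (db b' : R -> R) (nu : R) : 0 <= nu ->
  measurable_fun D b' -> (forall t, 0 <= b' t) ->
  {ae mu, forall t, D t -> b t = b' t} ->
  Linfty D db -> (Linfty_norm D db < nu%:E)%E ->
  Linfty_nonneg D (fun t => b t + db t) ->
  exists bd : R -> R, [/\ measurable_fun D bd, forall t, 0 <= bd t,
    forall t, `|bd t - b' t| <= nu & {ae mu, forall t, D t -> b t + db t = bd t}].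
Proof.
move=> nu0 mb' b'0 bb' [mdb _] /ltW/Linfty_norm_ae dbnu [_ bd0].
exists (fun t => Num.max 0 (b' t + Num.max (- nu) (Num.min nu (db t)))); split.
- apply: measurable_maxr; first exact: measurable_cst.
  apply: measurable_funD => //; apply: measurable_maxr; first exact: measurable_cst.
  by apply: measurable_minr => //; exact: measurable_cst.
- by move=> t; rewrite le_max lexx.
- move=> t; have := b'0 t.
  have : Num.max (- nu) (Num.min nu (db t)) <= nu.
    by rewrite ge_max ge_min lexx/= andbT; lra.
  have : - nu <= Num.max (- nu) (Num.min nu (db t)) by rewrite le_max lexx.
  move: (Num.max (- nu) _) => x x1 x2 b0; rewrite ler_norml.
  by have [h|h] := leP 0 (b' t + x); apply/andP; split; lra.
- have F : Filter (nbhs (almost_everywhere mu)) by exact: ae_filter_ringOfSetsType.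
  apply: (@filterS3 _ _ F _ _ _ _ _ bb' dbnu bd0) => t {}bb' {}dbnu {}bd0 Dt.
  have := dbnu Dt; rewrite ler_norml => /andP[h1 h2].
  by rewrite (min_idPr _)// (max_idPr (_ : - nu <= _))// -bb'// (max_idPr _)// bd0.
Qed.

End weights.

(** * From the control problem to quadratic functionals *)

Section optimal.
Variables (R : realType) (k : scalar_kind).
Variable H : completeNormedModType (scalar_field R k).
Variable ip : {dot H for scalar_conj k}.
Hypothesis ip_norm : forall x, ip x x = `|x| ^+ 2.
Notation mu := (@lebesgue_measure R).
Notation itv0 t := (`]0, t[%classic : set (measurableTypeR R)).
Variables (S : R -> H -> H) (T eps alpha : R) (f w : R -> H) (beta b : R -> R) (y : H).
Hypothesis eps_ge0 : 0 <= eps.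

Let p t := convolution S f t - w t.

Lemma stateE u t : state S f u t = S t u + convolution S f t.
Proof. by []. Qed.

Lemma feasibleE u : feasible S T eps f y u <->
  constraint_fun (S T) (y - convolution S f T) u <= eps ^+ 2 / 2.
Proof.
rewrite /feasible stateE /constraint_fun opprB addrA [eps ^+ 2 / 2]mulrC.
rewrite ler_pM2l ?invr_gt0// ler_pXn2r ?nnegrE//.
Qed.

Hypothesis o_si : forall u, square_integrable T (fun t => S t u).
Hypothesis p_si : square_integrable T p.
Hypotheses (mbeta : measurable_fun `]0, T[ beta) (mb : measurable_fun `]0, T[ b).
Hypothesis beta_b : {ae mu, forall t, `]0, T[%classic t -> beta t = b t}.

(** The weight enters only under the integral, so [beta] may be exchanged for a representative [b]
    that agrees with it almost everywhere. *)
Lemma costE u : cost S T alpha f beta w u = tracking_fun ip S T alpha b p u.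
Proof.
rewrite /cost /tracking_fun /wform; congr (_ + _ * _).
have [mn _] := square_integrableD ip_norm (o_si u) p_si.
have mn2 := measurable_rnorm_sqr ip_norm mn.
transitivity (\int[mu]_(t in itv0 T) (beta t * rnorm (S t u + p t) ^+ 2)).
  by apply: eq_Rintegral => t _; rewrite stateE /p addrA.
transitivity (\int[mu]_(t in itv0 T) (b t * rnorm (S t u + p t) ^+ 2)).
  apply: ae_eq_Rintegral; first exact: measurable_itv0.
  - by apply: measurable_funM.
  - by apply: measurable_funM.
  - have F : Filter (nbhs (almost_everywhere mu)) by exact: ae_filter_ringOfSetsType.
    by apply: (@filterS _ _ F _ _ _ beta_b) => t h Dt; rewrite h.
by apply: eq_Rintegral => t _; rewrite (ripxx ip_norm).
Qed.

Lemma optimal_minimizer u : is_optimal S T eps alpha f beta w y u ->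
  minimizer (tracking_fun ip S T alpha b p)
    (constraint_fun (S T) (y - convolution S f T)) (eps ^+ 2 / 2) u.
Proof.
move=> [/feasibleE fu min_u]; split=> // v /feasibleE /min_u.
by rewrite !costE.
Qed.

End optimal.

Section square_integrable_data.
Variables (R : realType) (k : scalar_kind).
Variable H : completeNormedModType (scalar_field R k).
Variable ip : {dot H for scalar_conj k}.
Hypothesis ip_norm : forall x, ip x x = `|x| ^+ 2.
Notation mu := (@lebesgue_measure R).
Notation itv0 t := (`]0, t[%classic : set (measurableTypeR R)).
Implicit Types (f w : R -> H) (T nu : R).

Lemma L2_square_integrable T w : L2 `]0, T[ w -> square_integrable T w.
Proof.
by move=> wL2; split; [exact: wL2.1|exact: (L2_intble ip_norm (measurable_itv0 T))].
Qed.

Lemma L2_half_line_square_integrable T f : L2 `]0, +oo[ f -> square_integrable T f.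
Proof.
move=> fL2.
have sub : itv0 T `<=` `]0, +oo[%classic.
  by move=> t /=; rewrite !in_itv /= andbT => /andP[].
have mI : measurable (`]0, +oo[%classic : set (measurableTypeR R)) by exact: measurable_itv.
split; first by apply: strongly_measurableS fL2.1.
by apply: integrableS (L2_intble ip_norm mI fL2) => //; exact: measurable_itv0.
Qed.

Lemma L2_half_line_Rintegral T f nu : 0 < nu -> L2 `]0, +oo[ f ->
  (L2norm `]0%R, +oo[ f < nu%:E)%E ->
  \int[mu]_(t in itv0 T) (rnorm (f t) ^+ 2) <= nu ^+ 2.
Proof.
move=> nu0 fL2 fnu.
have mI : measurable (`]0, +oo[%classic : set (measurableTypeR R)) by exact: measurable_itv.
have iI := L2_intble ip_norm mI fL2.
have [_ iT] := L2_half_line_square_integrable T fL2.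
apply: le_trans (L2norm_lt_Rintegral ip_norm mI nu0 fL2 fnu).
apply: fine_le; [exact: integrable_fin_num iT|exact: integrable_fin_num iI|].
apply: ge0_subset_integral => //.
- by case/integrableP : iI.
- by move=> x _; rewrite lee_fin sqr_ge0.
- by move=> t /=; rewrite !in_itv /= andbT => /andP[].
Qed.

End square_integrable_data.

(** * Effect of the perturbations on the inhomogeneous data *)

Section forcing_perturbation.
Variables (R : realType) (k : scalar_kind).
Variable H : completeNormedModType (scalar_field R k).
Variable ip : {dot H for scalar_conj k}.
Hypothesis ip_norm : forall x, ip x x = `|x| ^+ 2.
Notation mu := (@lebesgue_measure R).
Notation itv0 t := (`]0, t[%classic : set (measurableTypeR R)).
Variables (S Sd : R -> H -> H) (f df w dw : R -> H) (T M e nu : R).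
Hypotheses (S_C0 : C0_semigroup S) (Sd_C0 : C0_semigroup Sd) (T_ge0 : 0 <= T).
Hypotheses (M_ge0 : 0 <= M) (e_ge0 : 0 <= e) (nu_gt0 : 0 < nu).
Hypothesis SM : forall t x, 0 <= t -> t <= T -> rnorm (S t x) <= M * rnorm x.
Hypothesis SdM : forall t x, 0 <= t -> t <= T -> rnorm (Sd t x) <= M * rnorm x.
Hypothesis SdS : forall t x, 0 <= t -> t <= T ->
  rnorm (Sd t x - S t x) <= e * nu * rnorm x.
Hypotheses (f_si : square_integrable T f) (df_si : square_integrable T df).
Hypotheses (w_si : square_integrable T w) (dw_si : square_integrable T dw).
Hypothesis df_le : \int[mu]_(t in itv0 T) (rnorm (df t) ^+ 2) <= nu ^+ 2.
Hypothesis dw_le : \int[mu]_(t in itv0 T) (rnorm (dw t) ^+ 2) <= nu ^+ 2.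

(** The first term comes from the change of the forcing, [(T + 1) * nu] being the AM-GM bound for
    the integral of [rnorm (df t)]; the second comes from the change of the semigroup. *)
Let C := M * (T + 1) + e * \int[mu]_(t in itv0 T) rnorm (f t).
Let fd t := f t + df t.
Let fd_si : square_integrable T fd.
Proof. exact: square_integrableD. Qed.
Let mT : measurable (itv0 T) := measurable_itv0 T.

Lemma tracking_data_square_integrable :
  square_integrable T (fun t => convolution S f t - w t).
Proof.
apply: (square_integrableB ip_norm) => //.
have f_int := square_integrable_rnorm f_si.
apply: (square_integrable_bounded ip_norm (M := M * \int[mu]_(s in itv0 T) rnorm (f s))).
  exact: (convolution_strongly_measurable ip_norm S_C0 M_ge0 SM f_si.1 f_int).
move=> t t0 tT; exact: (convolution_le ip_norm S_C0 M_ge0 SM f_si.1 f_int (ltW tT)).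
Qed.

Lemma convolution_dist t : t <= T ->
  rnorm (convolution Sd fd t - convolution S f t) <= C * nu.
Proof.
move=> tT.
have f_int := square_integrable_rnorm f_si.
have fd_int := square_integrable_rnorm fd_si.
have df_int := square_integrable_rnorm df_si.
have fE : (fun t => rnorm (fd t - f t)) = (fun t => rnorm (df t)).
  by apply/funext => s; rewrite /fd addrAC subrr add0r.
have enu : 0 <= e * nu by rewrite mulr_ge0// ltW.
have := convolution_perturbation ip_norm S_C0 Sd_C0 M_ge0 enu tT SM SdM SdS
  f_si.1 fd_si.1 f_int fd_int.
rewrite fE => /(_ df_int) /le_trans; apply.
have : \int[mu]_(t in itv0 T) rnorm (df t) <= (T + 1) * nu.
  by apply: Rintegral_rnorm_le => //; rewrite mul1r.
move=> /(ler_wpM2l M_ge0); rewrite /C; lra.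
Qed.

(** From $(x+y)^2\le2x^2+2y^2$, with the uniform bound [C * nu] for the convolutions and the
    square-integral bound for [dw]. *)
Lemma tracking_data_perturbation :
  \int[mu]_(t in itv0 T)
    (rnorm ((convolution Sd fd t - (w t + dw t)) - (convolution S f t - w t)) ^+ 2) <=
  (2 * C ^+ 2 * T + 2) * nu ^+ 2.
Proof.
have C0 : 0 <= C.
  by rewrite addr_ge0// mulr_ge0// ?addr_ge0//; exact: Rintegral_ge0.
have f_int := square_integrable_rnorm f_si.
have fd_int := square_integrable_rnorm fd_si.
have c_sm := convolution_strongly_measurable ip_norm S_C0 M_ge0 SM f_si.1 f_int.
have cd_sm := convolution_strongly_measurable ip_norm Sd_C0 M_ge0 SdM fd_si.1 fd_int.
have ic : mu.-integrable (itv0 T) (EFin \o (fun=> 2 * (C * nu) ^+ 2)).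
  exact: intble_cst (itv0_fin _).
have idw : mu.-integrable (itv0 T) (EFin \o (fun t => 2 * rnorm (dw t) ^+ 2)).
  by apply: intbleZ => //; exact: dw_si.2.
have le t : 0 < t -> t < T ->
    rnorm ((convolution Sd fd t - (w t + dw t)) - (convolution S f t - w t)) ^+ 2 <=
    2 * (C * nu) ^+ 2 + 2 * rnorm (dw t) ^+ 2.
  move=> t0 tT; have h := convolution_dist (ltW tT).
  rewrite subr_interchange [w t + _]addrC addrK.
  have h2 : rnorm (convolution Sd fd t - convolution S f t - dw t) <= C * nu + rnorm (dw t).
    by apply: (le_trans (rnormB _ _)); rewrite lerD2r.
  apply: (@le_trans _ _ ((C * nu + rnorm (dw t)) ^+ 2)).
    by rewrite !expr2; apply: ler_pM.
  have := sqr_ge0 (C * nu - rnorm (dw t)); rewrite !expr2; lra.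
apply: (@le_trans _ _ (\int[mu]_(t in itv0 T) (2 * (C * nu) ^+ 2 + 2 * rnorm (dw t) ^+ 2))).
  apply: le_Rintegral => //; last 1 first.
  - by move=> t /=; rewrite in_itv /= => /andP[t0 tT]; exact: le.
  - apply: (@le_intble _ _ _ (fun t => 2 * (C * nu) ^+ 2 + 2 * rnorm (dw t) ^+ 2)) => //.
    + apply: (measurable_rnorm_sqr ip_norm); apply: strongly_measurableB.
        apply: strongly_measurableB => //.
        by apply: strongly_measurableD; [exact: w_si.1|exact: dw_si.1].
      by apply: strongly_measurableB => //; exact: w_si.1.
    + move=> t /=; rewrite in_itv /= => /andP[t0 tT].
      by rewrite ger0_norm ?sqr_ge0//; exact: le.
    + exact: intbleD.
  - exact: intbleD.
rewrite RintegralD// (Rintegral_cst_itv0 _ T_ge0) RintegralZl//; last exact: dw_si.2.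
have := dw_le; rewrite exprMn; lra.
Qed.

End forcing_perturbation.

(** * Choice of the constants and conclusion *)

Theorem theorem3p1 (R : realType) (k : scalar_kind)
  (H : completeNormedModType (scalar_field R k)) (ip : {dot H for scalar_conj k})
  (ip_norm : forall x, ip x x = `|x| ^+ 2)
  (A : operator H) (A_sa : self_adjoint ip A)
  (A_bd : bounded_from_above ip A)
  (S : R -> H -> H) (S_gen : generates A S)
  (T eps : R) (T_gt0 : 0 < T) (eps_gt0 : 0 < eps)
  (ystar : H) (f : R -> H) (f_L2 : L2 `]0, +oo[ f)
  (alpha : R) (alpha_gt0 : 0 < alpha)
  (beta : R -> R) (beta_Linfty : Linfty_nonneg `]0, T[ beta)
  (w : R -> H) (w_L2 : L2 `]0, T[ w)
  (zeta : R) (zeta_gt : gt_max_spectrum zeta A)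
  (r : R) (r_gt0 : 0 < r) :
  exists nu0 C : R, [/\ 0 < nu0, nu0 < 1, 0 < C &
    forall nu : R, 0 < nu -> nu < nu0 ->
    forall (dalpha : R) (df : R -> H) (dbeta : R -> R) (dw : R -> H)
      (dystar : H) (dA : operator H) (Sd : R -> H -> H) (uopt uoptd : H),
    `|dalpha| < nu -> 0 < alpha + dalpha ->
    L2 `]0, +oo[ df -> (L2norm `]0%R, +oo[ df < nu%:E)%E ->
    Linfty `]0, T[ dbeta -> (Linfty_norm `]0%R, T[ dbeta < nu%:E)%E ->
    Linfty_nonneg `]0, T[ (fun t => beta t + dbeta t) ->
    L2 `]0, T[ dw -> (L2norm `]0%R, T[ dw < nu%:E)%E ->
    rnorm dystar < nu ->
    op_linear dA -> op_symmetric ip dA ->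
    self_adjoint ip (op_add A dA) -> bounded_from_above ip (op_add A dA) ->
    gt_max_spectrum zeta (op_add A dA) ->
    (forall s : R,
      opnorm (fun x => resolvent (op_add A dA) (zeta +i* s)%C x
                       - resolvent A (zeta +i* s)%C x) <
      nu * (if `|s| <= r then 1 else s ^- 2)) ->
    generates (op_add A dA) Sd ->
    is_optimal S T eps alpha f beta w ystar uopt ->
    is_optimal Sd T eps (alpha + dalpha) (fun t => f t + df t)
      (fun t => beta t + dbeta t) (fun t => w t + dw t) (ystar + dystar)
      uoptd ->
    rnorm (uoptd - uopt) < C * nu].
Proof.
have A_sym := self_adjoint_symmetric A_sa.
have [A_lin A_dense _] := A_sa; have [c0 Ac0] := A_bd.
have S_C0 := S_gen.1; have T_ge0 := ltW T_gt0.
pose c := `|c0|; have c_ge0 : 0 <= c by exact: normr_ge0.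
have Ac x : op_dom A x -> rip ip (A x) x <= c * rnorm x ^+ 2.
  move=> Dx; apply: (le_trans (Ac0 x Dx)).
  by apply: ler_wpM2r; [exact: sqr_ge0|exact: ler_norm].
(* Common bound for [S], with rate [c], and for every [Sd], with rate [c + 4]. *)
pose M := expR ((c + 4) * T); have M_ge0 : 0 <= M by exact: expR_ge0.
pose e := 4 * (1 + T) * expR ((c + 1) * T) * M.
have e_ge0 : 0 <= e.
  by rewrite mulr_ge0// mulr_ge0 ?expR_ge0// mulr_ge0// addr_ge0.
have SM t x : 0 <= t -> t <= T -> rnorm (S t x) <= M * rnorm x.
  move=> t0 tT; apply: (le_trans (semigroup_growth ip_norm S_gen A_dense x t0 c_ge0 Ac)).
  apply: ler_wpM2r => //; rewrite ler_expR; apply: ler_pM => //; lra.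
have f_si := L2_half_line_square_integrable ip_norm T f_L2.
have w_si := L2_square_integrable ip_norm w_L2.
have p_si := tracking_data_square_integrable ip_norm S_C0 M_ge0 SM f_si w_si.
have o_si := orbit_square_integrable ip_norm S_C0 SM.
have [b [B [B_ge0 mb b_ge0 b_le beta_b]]] := weight_representative beta_Linfty.
set p := fun t => convolution S f t - w t in p_si.
pose d := ystar - convolution S f T.
pose F := tracking_fun ip S T alpha b p.
pose G := constraint_fun (S T) d.
have qF := tracking_quadratic ip_norm S_C0 (ltW alpha_gt0) SM mb b_ge0 b_le p_si.
have qG := constraint_quadratic ip_norm d (semigroup_lin S_C0 T_ge0).
pose E := eps ^+ 2 / 2.
have opt_min u : is_optimal S T eps alpha f beta w ystar u -> minimizer F G E u.
  by apply: optimal_minimizer => //; [exact: ltW|exact: beta_Linfty.1.1].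
have sc1 (x : H) : 1 %* x = x by rewrite of_real1 scale1r.
have scN1 (x : H) : (-1) %* x = - x by exact: scaleN1.
(* The constants of [minimizer_stability] depend on a minimizer of the unperturbed problem. If there
   is none, no [uopt] meets the premises and any constants do. *)
have [[u u_opt]|no_opt] := pselect (exists u, is_optimal S T eps alpha f beta w ystar u);
    last first.
  exists (1 / 2), 1; split=> //; try by clear; lra.
  by move=> ? ? ? ? ? ? ? ? ? ? u *; exfalso; apply: no_opt; exists u.
have min_u := opt_min u u_opt.
have [u0 slater] : exists u0, G u0 < E.
  apply: (slater_point sc1 scN1 qG min_u.1) => Gu.
  (* For an active constraint the residual has norm [eps > 0], so it is nonzero and some vector in
     the range of [S T] is not orthogonal to it. *)
  apply: (semigroup_range_dense ip_norm S_gen A_sym A_dense T_ge0) => Kd0.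
  have := Gu; rewrite /G /constraint_fun Kd0 rnorm0 expr0n mulr0 /E => /esym/eqP.
  by rewrite gt_eqF// divr_gt0// exprn_gt0.
pose F1 := \int[@lebesgue_measure R]_(t in `]0, T[) rnorm (f t).
have F1_ge0 : 0 <= F1 by exact: Rintegral_ge0.
pose Kc := M * (T + 1) + e * F1.
have Kc_ge0 : 0 <= Kc by rewrite addr_ge0// mulr_ge0// addr_ge0.
pose Kp := 2 * Kc ^+ 2 * T + 2.
have Kp_ge0 : 0 <= Kp by rewrite addr_ge0// mulr_ge0// mulr_ge0// sqr_ge0.
pose N1 := \int[@lebesgue_measure R]_(t in `]0, T[) rnorm (p t).
have N1_ge0 : 0 <= N1 by exact: Rintegral_ge0.
pose N2 := \int[@lebesgue_measure R]_(t in `]0, T[) (rnorm (p t) ^+ 2).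
pose Cc := 1 + Kc; have Cc_ge0 : 0 <= Cc by rewrite addr_ge0.
(* [P1] to [P5] are the constants of the perturbation and Hessian bounds; the sum [P] of their
   absolute values and [M ^+ 2] dominates each without a discussion of signs. *)
pose P1 := 1 + (M ^+ 2 + 2 * B * M * e) * T + (M + B * e) * N1 + (M + B * M) * (T + Kp).
pose P2 := (e + Cc) * M + (M + rnorm d) * e.
pose P3 := (M + rnorm d + (e + Cc)) * (e + Cc).
pose P4 := (alpha + 1) / 2 * rnorm u0 ^+ 2 +
  2^-1 * ((B + 1) * 3 * (M ^+ 2 * rnorm u0 ^+ 2 * T + N2 + Kp)).
pose P5 := alpha + B * M ^+ 2 * T.
pose P := `|P1| + `|P2| + `|P3| + `|P4| + `|P5| + M ^+ 2.
have sum_abs (x1 x2 x3 x4 x5 m : R) : 0 <= m ->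
    let s := `|x1| + `|x2| + `|x3| + `|x4| + `|x5| + m in
    [/\ x1 <= s, x2 <= s, x3 <= s, x4 <= s & x5 <= s /\ m <= s].
  move=> m0 s; have := ler_norm x1; have := ler_norm x2; have := ler_norm x3.
  have := ler_norm x4; have := ler_norm x5.
  have := normr_ge0 x1; have := normr_ge0 x2; have := normr_ge0 x3.
  by have := normr_ge0 x4; have := normr_ge0 x5; rewrite /s; move: m0; clear => *;
    split; last split; lra.
have [PP1 PP2 PP3 PP4 [PP5 PP6]] := sum_abs P1 P2 P3 P4 P5 _ (sqr_ge0 M).
rewrite -/P in PP1 PP2 PP3 PP4 PP5 PP6.
have P_ge0 : 0 <= P by apply: le_trans PP6; exact: sqr_ge0.
have weaken (a1 x y z : R) : 0 <= y -> 0 <= z -> x <= P -> a1 <= x * y * z -> a1 <= P * y * z.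
  by move=> y0 z0 xP /le_trans; apply; apply: ler_wpM2r => //; exact: ler_wpM2r.
have weaken4 (a1 x n y z : R) : 0 <= n -> 0 <= y -> 0 <= z -> x <= P ->
    a1 <= x * n * y * z -> a1 <= P * n * y * z.
  move=> n0 y0 z0 xP /le_trans; apply; do 2 apply: ler_wpM2r => //.
  exact: ler_wpM2r.
(* For [nu < alpha / 2] the perturbed cost is coercive with constant
   [(alpha + dalpha) / 2 >= alpha / 4]; the same constant serves the unperturbed Hessian. *)
have a_gt0 : 0 < alpha / 4 by rewrite divr_gt0.
have hess_coercive h : alpha / 4 * rnorm h ^+ 2 <= tracking_hess ip S T alpha b h h.
  apply: le_trans (tracking_hess_coercive ip_norm S T alpha b_ge0 h).
  by apply: ler_wpM2r; [exact: sqr_ge0|move: alpha_gt0; clear; lra].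
have hess_le x h : `|tracking_hess ip S T alpha b x h| <= P * rnorm x * rnorm h.
  apply: (weaken _ P5) => //.
  exact: (tracking_hess_le ip_norm S_C0 T_ge0 (ltW alpha_gt0) SM mb b_ge0 b_le).
have chess_le x h : `|constraint_hess ip (S T) x h| <= P * rnorm x * rnorm h.
  apply: (weaken _ (M ^+ 2)) => //.
  by apply: (constraint_hess_le ip_norm) => // y; exact: SM.
have [nu1 [C [nu1_gt0 C_gt0 stable]]] :=
  minimizer_stability sc1 scN1 (@rnorm_ge0 R k H) qF qG a_gt0 P_ge0
    hess_coercive hess_le chess_le min_u slater.
(* [1 / 2] keeps [nu] below 1, [alpha / 2] preserves coercivity, and [C + 1] makes the final
   inequality strict. *)
exists (Num.min nu1 (Num.min (1 / 2) (alpha / 2))), (C + 1); split.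
- by rewrite !lt_min nu1_gt0 !divr_gt0.
- by rewrite !gt_min; apply/orP; right; apply/orP; left; clear; lra.
- by rewrite addr_gt0.
move=> nu nu_gt0; rewrite !lt_min => /and3P[nu_nu1 nu_half nu_alpha].
move=> dalpha df dbeta dw dystar dA Sd uopt uoptd.
move=> dalpha_lt alphad_gt0 df_L2 df_lt dbeta_L dbeta_lt betad_nonneg dw_L2 dw_lt dystar_lt.
move=> _ _ Ad_sa _ _ res_lt Sd_gen uopt_opt uoptd_opt.
have nu_lt1 : nu < 1 by move: nu_half; clear; lra.
have nu_le1 := ltW nu_lt1.
have nu_ge0 := ltW nu_gt0.
(* The coercive Hessian makes the unperturbed minimizer unique, so [uopt] is the [u] for which the
   constants were chosen. *)
have -> : uopt = u.
  apply/eqP; rewrite -subr_eq0; apply/eqP/rnorm0_eq0/eqP.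
  have h0 := minimizer_hess_eq0 sc1 scN1 qF qG slater min_u (opt_min _ uopt_opt).
  have := hess_coercive (uopt - u); rewrite h0 pmulr_rle0// => h.
  by rewrite -sqrf_eq0 eq_le h sqr_ge0.
have Ad_sym := self_adjoint_symmetric Ad_sa.
have [Ad_lin Ad_dense _] := Ad_sa; have Sd_C0 := Sd_gen.1.
have dA_le x : op_dom (op_add A dA) x -> rnorm (dA x) <= 4 * nu * rnorm x.
  exact: (perturbation_le ip_norm A_lin A_sym Ad_lin Ad_sym A_dense r_gt0 nu_gt0 res_lt nu_lt1).
have SdM t x : 0 <= t -> t <= T -> rnorm (Sd t x) <= M * rnorm x.
  move=> t0 tT.
  apply: (le_trans (perturbed_growth ip_norm Sd_gen Ad_dense c_ge0 nu_le1 Ac dA_le x t0)).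
  by apply: ler_wpM2r => //; rewrite ler_expR; apply: ler_wpM2l => //; exact: addr_ge0.
have SdS t x : 0 <= t -> t <= T -> rnorm (Sd t x - S t x) <= e * nu * rnorm x.
  exact: (semigroup_perturbation ip_norm A_lin S_gen Sd_gen Ad_dense c_ge0 nu_ge0 nu_le1 Ac dA_le).
have df_si := L2_half_line_square_integrable ip_norm T df_L2.
have dw_si := L2_square_integrable ip_norm dw_L2.
have df_le := L2_half_line_Rintegral ip_norm T nu_gt0 df_L2 df_lt.
have dw_le := L2norm_lt_Rintegral ip_norm (measurable_itv0 T) nu_gt0 dw_L2 dw_lt.
have fd_si := square_integrableD ip_norm f_si df_si.
have wd_si := square_integrableD ip_norm w_si dw_si.
have pd_si := tracking_data_square_integrable ip_norm Sd_C0 M_ge0 SdM fd_si wd_si.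
have pd_p := tracking_data_perturbation ip_norm S_C0 Sd_C0 T_ge0 M_ge0 e_ge0 nu_gt0
  SM SdM SdS f_si df_si w_si dw_si df_le dw_le.
have conv_le := convolution_dist ip_norm S_C0 Sd_C0 T_ge0 M_ge0 e_ge0 nu_gt0
  SM SdM SdS f_si df_si df_le (lexx T).
have [bd [mbd bd_ge0 bd_b betad_bd]] := perturbed_weight_representative nu_ge0 mb b_ge0
  beta_b dbeta_L dbeta_lt betad_nonneg.
have od_si := orbit_square_integrable ip_norm Sd_C0 SdM.
have min_v := optimal_minimizer ip_norm (ltW eps_gt0) od_si pd_si betad_nonneg.1.1 mbd betad_bd
  uoptd_opt.
set pd := fun t => convolution Sd _ t - (w t + dw t) in pd_si pd_p min_v.
pose dd := ystar + dystar - convolution Sd (fun t => f t + df t) T.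
have bd_le t : bd t <= B + 1.
  by have := bd_b t; have := b_le t; rewrite ler_norml; move: nu_le1; clear => ? ? /andP[_ ?]; lra.
have dd_d : rnorm (dd - d) <= Cc * nu.
  rewrite /dd /d subr_interchange [ystar + _]addrC addrK.
  by apply: (le_trans (rnormB _ _)); rewrite /Cc mulrDl mul1r lerD// ltW.
have alphad_le : `|alpha + dalpha - alpha| <= nu by rewrite addrAC subrr add0r ltW.
have qFd := tracking_quadratic ip_norm Sd_C0 (ltW alphad_gt0) SdM mbd bd_ge0 bd_le pd_si.
have qGd := constraint_quadratic ip_norm dd (semigroup_lin Sd_C0 T_ge0).
have K_le x : rnorm (S T x) <= M * rnorm x by exact: SM.
have Kd_le x : rnorm (Sd T x) <= M * rnorm x by exact: SdM.
have KdK x : rnorm (Sd T x - S T x) <= e * nu * rnorm x by exact: SdS.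
apply: (@le_lt_trans _ _ (C * nu)); last by rewrite ltr_pM2r// ltrDl.
apply: (stable nu nu_gt0 nu_nu1 _ _ _ _ _ _ uoptd qFd qGd _ _ _ _ _ min_v).
- move=> x h; apply: (weaken4 _ P1) => //; first by rewrite addr_ge0.
  exact: (tracking_deriv_perturbation ip_norm S_C0 Sd_C0 T_ge0 M_ge0 B_ge0 e_ge0 Kp_ge0
    nu_gt0 nu_le1 SM SdM SdS mb b_ge0 b_le mbd bd_ge0 bd_b p_si pd_si pd_p alphad_le).
- move=> x h; apply: (weaken4 _ P2) => //; first by rewrite addr_ge0.
  exact: (constraint_deriv_perturbation ip_norm M_ge0 e_ge0 Cc_ge0 nu_ge0 K_le Kd_le KdK dd_d).
- move=> x; apply: (weaken _ P3) => //; first exact: sqr_ge0.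
  exact: (constraint_fun_perturbation ip_norm M_ge0 e_ge0 Cc_ge0 nu_ge0 nu_le1 K_le KdK dd_d).
- move=> x; apply: le_trans (tracking_fun_coercive ip_norm Sd T (alpha + dalpha) pd bd_ge0 x).
  apply: ler_wpM2r; first exact: sqr_ge0.
  by have := dalpha_lt; rewrite ltr_norml; move: nu_alpha; clear => ? /andP[? _]; lra.
- apply: le_trans PP4.
  exact: (tracking_fun_perturbation_le ip_norm Sd_C0 T_ge0 B_ge0 Kp_ge0 nu_gt0 nu_le1 SdM b_le
    mbd bd_ge0 bd_b p_si pd_si pd_p alphad_le u0 (ltW alphad_gt0)).
Qed.
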